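(* Let $n\ge 5$ and let $M^n$ be an $n$-dimensional connected hypersurface immersed in hyperbolic space $\mathbb{H}^{n+1}$ with constant Ricci eigenvalues. If $M^n$ is not of constant sectional curvature $-1$, then $M^n$ is isoparametric.
   Context: $\mathbb{H}^{n+1}$ is the hyperbolic space of constant sectional curvature $-1$. Everything is smooth; $M^n$ is given by an immersion into $\mathbb{H}^{n+1}$ and carries the induced metric $g$ (not assumed complete). A unit normal vector field $\nu$ along $M$ is fixed, $A$ is the shape operator with respect to $\nu$, and its eigenvalues (with multiplicity) are the principal curvatures. The hypersurface is called isoparametric if all its principal curvatures are constant on $M$. The Ricci eigenvalues of $M$ at $p$ are the eigenvalues of the self-adjoint Ricci operator $\widehat{\mathrm{Ric}}_p\colon T_pM\to T_pM$ defined by $g(\widehat{\mathrm{Ric}}(X),Y)=\mathrm{Ric}(X,Y)$. $M$ has constant Ricci eigenvalues if these eigenvalues, counted with multiplicity, do not depend on the point $p\in M$. *)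

(* Defs.v *)
From HB Require Import structures.
From mathcomp Require Import all_boot all_order all_algebra.
From mathcomp Require Import all_classical all_reals all_analysis.

Set Implicit Arguments.
Unset Strict Implicit.
Unset Printing Implicit Defensive.

Import Order.TTheory GRing.Theory Num.Theory.
Import numFieldNormedType.Exports.

Local Open Scope classical_set_scope.
Local Open Scope ring_scope.

(* Tangent vectors, coordinates and points of R^m are row vectors, so that the
   i-th row of the Jacobian ['J F x] is the i-th partial derivative of F, and an
   endomorphism with matrix S acts by v |-> v *m S. *)

(* C^oo on an open set U: every iterated directional derivative of f is Frechet
   differentiable at the points of U. *)
Definition smooth_on (R : realType) (V W : normedModType R) (U : set V)
    (f : V -> W) : Prop :=
  forall (vs : seq V) (x : V), U x ->
    differentiable (foldr (fun v (h : V -> W) => 'D_v h) f vs) x.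

(* [chart_inv] is only meaningful on the open set [chart_map @` chart_dom]. *)
Record chart (R : realType) (T : topologicalType) (n : nat) := Chart {
  chart_dom : set T;
  chart_map : T -> 'rV[R]_n;
  chart_inv : 'rV[R]_n -> T;
  chart_dom_open : open chart_dom;
  chart_img_open : open (chart_map @` chart_dom);
  chart_mapK : forall p, chart_dom p -> chart_inv (chart_map p) = p;
  chart_map_continuous : forall p, chart_dom p -> {for p, continuous chart_map};
  chart_inv_continuous : forall x, (chart_map @` chart_dom) x ->
    {for x, continuous chart_inv} }.

Record smooth_manifold (R : realType) (n : nat) := SmoothManifold {
  carrier :> topologicalType;
  atlas : set (chart R carrier n);
  manifold_hausdorff : hausdorff_space carrier;
  manifold_second_countable : @second_countable carrier;
  atlas_cover : forall p : carrier, exists2 c, atlas c & chart_dom c p;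
  atlas_compatible : forall c d, atlas c -> atlas d ->
    smooth_on (chart_map c @` (chart_dom c `&` chart_dom d))
              (chart_map d \o chart_inv c) }.

Definition smooth_map (R : realType) (n : nat) (M : smooth_manifold R n)
    (W : normedModType R) (f : M -> W) : Prop :=
  forall c, atlas c ->
    smooth_on (chart_map c @` chart_dom c) (f \o chart_inv c).

(* Curvature of a metric x |-> g x given by its matrix in coordinates. *)

Definition partial (R : realType) (n : nat) (i : 'I_n) (F : 'rV[R]_n -> R)
    (x : 'rV[R]_n) : R := 'D_(delta_mx 0 i) F x.

(* Gamma^k_ij *)
Definition christoffel (R : realType) (n : nat) (g : 'rV[R]_n -> 'M[R]_n)
    (i j k : 'I_n) (x : 'rV[R]_n) : R :=
  2^-1 * \sum_(l < n) invmx (g x) k l *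
    (partial i (fun y => g y j l) x + partial j (fun y => g y i l) x
     - partial l (fun y => g y i j) x).

(* The l-th component of R(d_i, d_j) d_k, where
   R(X, Y) = [nabla_X, nabla_Y] - nabla_[X, Y]. *)
Definition riemann (R : realType) (n : nat) (g : 'rV[R]_n -> 'M[R]_n)
    (i j k l : 'I_n) (x : 'rV[R]_n) : R :=
  partial i (christoffel g j k l) x - partial j (christoffel g i k l) x
  + \sum_(m < n) (christoffel g j k m x * christoffel g i m l x
                  - christoffel g i k m x * christoffel g j m l x).

(* g(R(X, Y) Y, X) / (g(X, X) g(Y, Y) - g(X, Y)^2) *)
Definition sectional (R : realType) (n : nat) (g : 'rV[R]_n -> 'M[R]_n)
    (x X Y : 'rV[R]_n) : R :=
  let ip (v w : 'rV[R]_n) := (v *m g x *m w^T) 0 0 in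
  let RXYY := \row_(l < n) \sum_(i < n) \sum_(j < n) \sum_(k < n)
                X 0 i * Y 0 j * Y 0 k * riemann g i j k l x in
  ip RXYY X / (ip X X * ip Y Y - ip X Y ^+ 2).

(* Ric(Y, Z) = tr (X |-> R(X, Y) Z) *)
Definition ricci (R : realType) (n : nat) (g : 'rV[R]_n -> 'M[R]_n)
    (x : 'rV[R]_n) : 'M[R]_n :=
  \matrix_(j < n, k < n) \sum_(i < n) riemann g i j k i x.

(* The matrix S of the endomorphism with g(S v, w) = b(v, w) for all v, w, that
   is, S *m g = b. *)
Definition raise_index (R : realType) (n : nat) (g b : 'M[R]_n) : 'M[R]_n :=
  b *m invmx g.

(* Hyperboloid model of the hyperbolic space of dimension m and curvature -1. *)

Definition lorentz_mx (R : realType) (m : nat) : 'M[R]_m.+1 :=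
  diag_mx (\row_(i < m.+1) if i == ord0 then -1 else 1).

Definition lorentz (R : realType) (m : nat) (x y : 'rV[R]_m.+1) : R :=
  (x *m lorentz_mx R m *m y^T) 0 0.

Definition hyperbolic_space (R : realType) (m : nat) : set 'rV[R]_m.+1 :=
  [set x | lorentz x x = -1 /\ 0 < x 0 ord0].

Definition hyperbolic_immersion (R : realType) (n m : nat)
    (M : smooth_manifold R n) (f : M -> 'rV[R]_m.+1) : Prop :=
  [/\ smooth_map f,
      forall p, hyperbolic_space (f p)
    & forall c, atlas c -> forall x, (chart_map c @` chart_dom c) x ->
        injective ('d (f \o chart_inv c) x)].

(* A unit normal field of f in the hyperbolic space: nu p is tangent to the
   hyperboloid at f p and orthogonal to the image of the differential of f. *)
Definition unit_normal (R : realType) (n m : nat) (M : smooth_manifold R n)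
    (f nu : M -> 'rV[R]_m.+1) : Prop :=
  [/\ smooth_map nu,
      forall p, lorentz (nu p) (nu p) = 1,
      forall p, lorentz (nu p) (f p) = 0
    & forall c, atlas c -> forall x, (chart_map c @` chart_dom c) x ->
        forall v, lorentz (nu (chart_inv c x)) ('d (f \o chart_inv c) x v) = 0].

Definition induced_metric (R : realType) (n m : nat) (M : smooth_manifold R n)
    (f : M -> 'rV[R]_m.+1) (c : chart R M n) (x : 'rV[R]_n) : 'M[R]_n :=
  let J := 'J (f \o chart_inv c) x in J *m lorentz_mx R m *m J^T.

(* (v, w) |-> - <nabla_v nu, df w>.  The ambient derivative of nu is used
   instead of the Levi-Civita one of the hyperboloid: they differ by a multiple
   of f, which is orthogonal to df w. *)
Definition second_fundamental_form (R : realType) (n m : nat)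
    (M : smooth_manifold R n) (f nu : M -> 'rV[R]_m.+1) (c : chart R M n)
    (x : 'rV[R]_n) : 'M[R]_n :=
  - ('J (nu \o chart_inv c) x *m lorentz_mx R m *m ('J (f \o chart_inv c) x)^T).

(* In the coordinate frame of c at p. *)

Definition shape_operator (R : realType) (n m : nat) (M : smooth_manifold R n)
    (f nu : M -> 'rV[R]_m.+1) (c : chart R M n) (p : M) : 'M[R]_n :=
  raise_index (induced_metric f c (chart_map c p))
              (second_fundamental_form f nu c (chart_map c p)).

Definition ricci_operator (R : realType) (n m : nat) (M : smooth_manifold R n)
    (f : M -> 'rV[R]_m.+1) (c : chart R M n) (p : M) : 'M[R]_n :=
  raise_index (induced_metric f c (chart_map c p))
              (ricci (induced_metric f c) (chart_map c p)).

(* A real number a is an eigenvalue of multiplicity [\rank (eigenspace S a)],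
   which is 0 when a is not an eigenvalue.  The case p = q with two charts at p
   holds automatically for the matrices of a field of endomorphisms. *)
Definition constant_eigenvalues (R : realType) (n : nat)
    (M : smooth_manifold R n) (S : chart R M n -> M -> 'M[R]_n) : Prop :=
  forall (c d : chart R M n) (p q : M), atlas c -> atlas d ->
    chart_dom c p -> chart_dom d q ->
    forall a : R, \rank (eigenspace (S c p) a) = \rank (eigenspace (S d q) a).

Definition constant_ricci_eigenvalues (R : realType) (n m : nat)
    (M : smooth_manifold R n) (f : M -> 'rV[R]_m.+1) : Prop :=
  constant_eigenvalues (ricci_operator f).

Definition isoparametric (R : realType) (n m : nat) (M : smooth_manifold R n)
    (f nu : M -> 'rV[R]_m.+1) : Prop :=
  constant_eigenvalues (shape_operator f nu).

Definition constant_sectional_curvature (R : realType) (n m : nat)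
    (M : smooth_manifold R n) (f : M -> 'rV[R]_m.+1) (kappa : R) : Prop :=
  forall c : chart R M n, atlas c -> forall p : M, chart_dom c p ->
  forall X Y : 'rV[R]_n, row_free (col_mx X Y) ->
    sectional (induced_metric f c) (chart_map c p) X Y = kappa.

(* Main.v *)
Require Import Defs.
From mathcomp Require Import all_boot all_order all_algebra all_fingroup.
From mathcomp Require Import all_classical all_reals all_analysis.
From mathcomp Require Import complex.
From mathcomp Require Import lra ring zify.

(** Let [S] be the shape operator, [h = tr S] and [lam_i] the principal curvatures.
    By the Gauss equation the Ricci operator is [h S - S^2 - (n - 1)]
    ([ricci_operator_metric]), so that the numbers [mu_i = lam_i (h - lam_i)] are
    constant on [M] up to order. It remains to see that the [lam_i] are.

    When [h] is constant, a principal curvature is a solution [a] or [h - a] of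
    [lam (h - lam) = mu_i], so the sum of the multiplicities of [a] and of [h - a]
    is constant. Both are upper semicontinuous, hence locally constant, and [M] is
    connected ([isoparametric_of_constant_mean_curvature]).

    When [h] is not constant, its values fill an interval. Write
    [2 lam_i = h +- sqrt (h^2 - 4 mu_i)]; then [sum_i lam_i = h] is a linear
    relation between square roots which holds for all [h] of an interval. As
    square roots with distinct [mu_i] are linearly independent
    ([sqrt_independent]), such a relation exists only when all [mu_i] vanish or
    when exactly two of them, equal to the same [kappa], do not
    ([spectrum_of_interval]). In the first case [S] has rank at most one, and the
    Gauss equation makes [M] a space of curvature -1 ([rank_one_curvature]). In the
    second one, for all but finitely many [h], all [lam_i] but two are zero
    ([exceptional_spectrum]): over an open set [S] has rank two, and the product of
    its nonzero eigenvalues is the constant [kappa].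

    The last case is impossible for [n >= 5] ([no_rank_two_hypersurface]). Let [F],
    [J], [N] be the position vector, its Jacobian and the normal. For [T] in the
    kernel of [S], the Hessian [k_T] of the function [<T J, N>] (with [T J] held
    fixed) is a symmetric form which vanishes on the kernel of [S], and so is that
    of [<F, N>], which is the second fundamental form. As the second elementary
    symmetric function of the [lam_i] is constant, [k_T] satisfies the linear
    relation [tr ((tr S - S) k_T g^-1) = 0] ([trace_hess_normal_null]), while the
    second fundamental form gives [2 kappa] in place of 0. The vectors
    [alpha F + T J] make up a space of dimension [n - 1 > 3], and symmetric forms
    on a plane one of dimension 3, so some nonzero [alpha F + T J] has a vanishing
    Hessian; the relation then forces [alpha = 0] ([exists_null_hessian]).
    Differentiate the relation along this [T]: as [T J] moves with velocity
    [X J + <T J, T J> F], where [S] kills [X] ([dnull_decomposition]), the result is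
    [2 kappa <T J, T J> = 0], a contradiction. *)

Set Implicit Arguments.
Unset Strict Implicit.
Unset Printing Implicit Defensive.

Import Order.TTheory GRing.Theory Num.Theory.
Import numFieldNormedType.Exports.

Local Open Scope ring_scope.

(** * Rank and diagonalization *)

Lemma mx11_trmx (T : Type) (A : 'M[T]_1) : A^T = A.
Proof. by apply/matrixP => i j; rewrite mxE !ord1. Qed.

Lemma bilinear_sym (K : fieldType) n (A : 'M[K]_n) (v w : 'rV[K]_n) : A^T = A ->
  (v *m A *m w^T) 0 0 = (w *m A *m v^T) 0 0.
Proof.
move=> As; rewrite -[in LHS](mx11_trmx (v *m A *m w^T)).
by rewrite !trmx_mul trmxK As mulmxA.
Qed.

Lemma low_rank_factor (K : fieldType) n d (A : 'M[K]_n) : (\rank A <= d)%N ->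
  exists (B : 'M[K]_(n, d)) (C : 'M[K]_(d, n)), A = B *m C.
Proof.
move=> Ad; exists (col_ebase A *m pid_mx (\rank A)), (pid_mx (\rank A) *m row_ebase A).
rewrite -mulmxA [pid_mx _ *m (pid_mx _ *m _)]mulmxA pid_mx_id //.
by rewrite mulmxA mulmx_ebase.
Qed.

(** Symmetric forms on a plane make up a space of dimension 3. *)
Lemma symmetric_pencil_kernel (K : fieldType) n r (P : 'M[K]_n) (k : 'rV[K]_r -> 'M[K]_n) :
  (\rank P <= 2)%N -> (3 < r)%N ->
  (forall a w w', k (a *: w + w') = a *: k w + k w') ->
  (forall w, (k w)^T = k w) -> (forall w, k w = P *m k w *m P^T) ->
  exists2 w, w != 0 & k w = 0.
Proof.
move=> rP r3 lk sk kP; have [B [C PBC]] := low_rank_factor rP.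
pose q w := C *m k w *m C^T.
have lq a w w' : q (a *: w + w') = a *: q w + q w'.
  by rewrite /q lk mulmxDr mulmxDl -scalemxAr -scalemxAl.
have q0 : q 0 = 0.
  have := lq 0 0 0; rewrite scaler0 addr0 scale0r add0r => E.
  have := lq 1 0 0; rewrite scaler0 addr0 scale1r => /eqP.
  by rewrite -subr_eq subrr eq_sym => /eqP.
have qsum w : q w = \sum_a w 0 a *: q (delta_mx 0 a).
  rewrite {1}[w]row_sum_delta; elim/big_rec2 : _ => // a y1 y2 _ <-.
  exact: lq.
pose i0 : 'I_2 := ord0; pose i1 : 'I_2 := ord_max.
pose Phi : 'M[K]_(r, 3) := \matrix_(a, b)
  (if val b == 0%N then q (delta_mx 0 a) i0 i0
   else if val b == 1%N then q (delta_mx 0 a) i0 i1 else q (delta_mx 0 a) i1 i1).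
have : kermx Phi != 0.
  rewrite -mxrank_eq0 mxrank_ker subn_eq0 -ltnNge.
  by apply: leq_ltn_trans r3; exact: rank_leq_col.
case/rowV0Pn => w /sub_kermxP wPhi w0; exists w => //.
have PhiE b : (w *m Phi) 0 b = \sum_a w 0 a * Phi a b by rewrite mxE.
have qE i j : q w i j = \sum_a w 0 a * q (delta_mx 0 a) i j.
  by rewrite qsum summxE; apply: eq_bigr => a _; rewrite mxE.
have qw : q w = 0.
  have e00 : q w i0 i0 = 0.
    rewrite qE; have := PhiE (Ordinal (isT : (0 < 3)%N)); rewrite wPhi mxE => E; rewrite [RHS]E.
    by apply: eq_bigr => a _; rewrite [in RHS]mxE.
  have e01 : q w i0 i1 = 0.
    rewrite qE; have := PhiE (Ordinal (isT : (1 < 3)%N)); rewrite wPhi mxE => E; rewrite [RHS]E.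
    by apply: eq_bigr => a _; rewrite [in RHS]mxE.
  have e11 : q w i1 i1 = 0.
    rewrite qE; have := PhiE (Ordinal (isT : (2 < 3)%N)); rewrite wPhi mxE => E; rewrite [RHS]E.
    by apply: eq_bigr => a _; rewrite [in RHS]mxE.
  have e10 : q w i1 i0 = 0.
    by rewrite -e01 -[q w in RHS]trmxK [RHS]mxE /q !trmx_mul trmxK sk mulmxA.
  have two (i : 'I_2) : i = i0 \/ i = i1.
    by case: i => -[|[|//]] Hi; [left|right]; apply/val_inj.
  by apply/matrixP => i j; rewrite [RHS]mxE; case: (two i) => ->; case: (two j) => ->.
have : P *m k w *m P^T = B *m q w *m B^T by rewrite PBC trmx_mul /q !mulmxA.
by rewrite -kP qw mulmx0 mul0mx.
Qed.

Lemma mxrank_diag (K : fieldType) n (d : 'rV[K]_n) :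
  \rank (diag_mx d) = (\sum_i (d 0%R i != 0%R))%N.
Proof.
elim: n d => [|n IH] d; first by rewrite big_ord0; apply/eqP; rewrite -leqn0 rank_leq_row.
pose a : 'rV_1 := lsubmx (d : 'rV_(1 + n)); pose b : 'rV_n := rsubmx (d : 'rV_(1 + n)).
transitivity (\rank (block_mx (diag_mx a) 0 0 (diag_mx b))).
  by rewrite -diag_mx_row hsubmxK.
rewrite rank_diag_block_mx big_ord_recl IH; congr (_ + _)%N.
  rewrite rank_rV; congr (nat_of_bool (~~ _)); apply/eqP/eqP => [/matrixP/(_ 0 0)|d0].
    by rewrite !mxE /= mulr1n => E; rewrite -[RHS]E; congr (d _ _); apply/val_inj.
  apply/matrixP => i j; rewrite !mxE !ord1 /= mulr1n -[RHS]d0.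
  by congr (d _ _); apply/val_inj.
by apply: eq_bigr => i _; rewrite mxE; congr (nat_of_bool (d _ _ != 0)); apply/val_inj.
Qed.

Section Diagonalized.
Variables (K : fieldType) (n : nat) (P S : 'M[K]_n) (d : 'rV[K]_n).
Hypotheses (Pu : P \in unitmx) (PS : P *m S = diag_mx d *m P).

Lemma diagonalized_eq : S = invmx P *m diag_mx d *m P.
Proof. by rewrite -mulmxA -PS mulKmx. Qed.

Lemma diagonalized_trace : \tr S = \sum_i d 0 i.
Proof. by rewrite diagonalized_eq mxtrace_mulC mulmxA mulmxV // mul1mx mxtrace_diag. Qed.

Lemma diagonalized_rank : \rank S = (\sum_i (d 0%R i != 0%R))%N.
Proof.
rewrite -mxrank_diag diagonalized_eq mxrankMfree ?row_free_unit // eqmxMfull //.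
by rewrite row_full_unit unitmx_inv.
Qed.

End Diagonalized.

Section DiagonalizedOperations.
Variables (K : fieldType) (n : nat) (P : 'M[K]_n).
Hypothesis Pu : P \in unitmx.

Lemma diagonalizedB S T d e : P *m S = diag_mx d *m P -> P *m T = diag_mx e *m P ->
  P *m (S - T) = diag_mx (d - e) *m P.
Proof. by move=> PS PT; rewrite mulmxBr PS PT linearB mulmxBl. Qed.

Lemma diagonalizedZ a S d : P *m S = diag_mx d *m P -> P *m (a *: S) = diag_mx (a *: d) *m P.
Proof. by move=> PS; rewrite -scalemxAr PS linearZ scalemxAl. Qed.

Lemma diagonalizedM S T d e : P *m S = diag_mx d *m P -> P *m T = diag_mx e *m P ->
  P *m (S *m T) = diag_mx (\row_i (d 0 i * e 0 i)) *m P.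
Proof. by move=> PS PT; rewrite mulmxA PS -mulmxA PT mulmxA mulmx_diag. Qed.

Lemma diagonalized_scalar a : P *m a%:M = diag_mx (const_mx a) *m P.
Proof. by rewrite diag_const_mx scalar_mxC. Qed.

Lemma diagonalized_multiplicity S d a : P *m S = diag_mx d *m P ->
  \rank (eigenspace S a) = (\sum_i (d 0%R i == a))%N.
Proof.
move=> PS; rewrite mxrank_ker.
rewrite (diagonalized_rank Pu (diagonalizedB PS (diagonalized_scalar a))).
set N := (\sum_i _)%N; set D := (\sum_i _)%N.
suff nE : (n = D + N)%N by rewrite [X in (X - N)%N]nE addnK.
rewrite -[LHS]card_ord -sum1_card /D /N -big_split /=; apply: eq_bigr => i _.
by rewrite !mxE subr_eq0; case: (d 0 i == a).
Qed.
End DiagonalizedOperations.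

Lemma reorder_family (T : eqType) n (f g : 'I_n -> T) :
  (forall b, \sum_i (f i == b) = \sum_i (g i == b))%N ->
  exists s : 'S_n, forall i, f (s i) = g i.
Proof.
move=> fg; have cnt (h : 'I_n -> T) b : count_mem b [tuple h i | i < n] = (\sum_i (h i == b))%N.
  rewrite -sum1_count big_mkcond big_tuple; apply: eq_bigr => i _.
  by rewrite tnth_mktuple /=; case: (h i == b).
have : perm_eq [tuple g i | i < n] [tuple f i | i < n].
  by apply/allP => b _; rewrite /= !cnt fg.
case/tuple_permP => s E; exists s => i.
have := congr1 (fun t => nth (f i) t i) E.
by rewrite -!tnth_nth !tnth_mktuple.
Qed.

(** * The spectral theorem for a positive definite form *)

Section SelfAdjoint.
Variables (R : rcfType) (n : nat) (g : 'M[R]_n).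
Hypothesis g_sym : g^T = g.
Hypothesis g_pos : forall v : 'rV[R]_n, v != 0 -> 0 < (v *m g *m v^T) 0 0.

Definition gdot (v w : 'rV[R]_n) : R := (v *m g *m w^T) 0 0.

Definition selfadjoint (S : 'M[R]_n) := (S *m g)^T = S *m g.

Lemma gdotC v w : gdot v w = gdot w v.
Proof. exact: bilinear_sym. Qed.

Lemma gdot_self S v w : selfadjoint S -> gdot (v *m S) w = gdot v (w *m S).
Proof.
move=> sS; rewrite /gdot -[v *m S *m g]mulmxA -sS.
by rewrite !trmx_mul g_sym !mulmxA.
Qed.

Lemma gdotDl u v w : gdot (u + v) w = gdot u w + gdot v w.
Proof. by rewrite /gdot !mulmxDl mxE. Qed.
Lemma gdotZl a v w : gdot (a *: v) w = a * gdot v w.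
Proof. by rewrite /gdot -!scalemxAl mxE. Qed.
Lemma gdotDr u v w : gdot w (u + v) = gdot w u + gdot w v.
Proof. by rewrite !(gdotC w) gdotDl. Qed.
Lemma gdotZr a v w : gdot w (a *: v) = a * gdot w v.
Proof. by rewrite !(gdotC w) gdotZl. Qed.

Lemma gdot_eq0 v : gdot v v = 0 -> v = 0.
Proof. by move=> v0; apply/eqP; apply: contraT => /g_pos; rewrite -/(gdot v v) v0 ltxx. Qed.

Lemma gdot_ge0 v : 0 <= gdot v v.
Proof.
have [->|/g_pos/ltW//] := eqVneq v 0.
by rewrite /gdot !mul0mx mxE.
Qed.

(** [gdot (v S) (v S) = gdot (v S^2) v = 0]. *)
Lemma selfadjoint_sqr_eq0 S : selfadjoint S -> S *m S = 0 -> S = 0.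
Proof.
move=> sS S2; apply/row_matrixP => i; rewrite row0 rowE.
set v := delta_mx 0 i; apply: gdot_eq0.
by rewrite -gdot_self // -mulmxA S2 mulmx0 /gdot !mul0mx mxE.
Qed.
End SelfAdjoint.

Section SelfAdjointDiag.
Variables (R : rcfType) (n' : nat).
Local Notation n := n'.+1.
Variable (g : 'M[R]_n).
Hypothesis g_sym : g^T = g.
Hypothesis g_pos : forall v : 'rV[R]_n, v != 0 -> 0 < (v *m g *m v^T) 0 0.

Lemma selfadjoint_pow S k : selfadjoint g S -> selfadjoint g (S ^+ k).
Proof.
move=> sS; elim: k => [|k IH]; rewrite /selfadjoint; first by rewrite expr0 mul1mx.
have sS' : g *m S^T = S *m g by rewrite -[in LHS]g_sym -trmx_mul.
rewrite {1}exprS -mulmxE -mulmxA trmx_mul IH -mulmxA sS' mulmxA.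
by rewrite mulmxE -exprSr.
Qed.

Lemma selfadjoint_horner S p : selfadjoint g S -> selfadjoint g (horner_mx S p).
Proof.
move=> sS; rewrite -[p]coefK poly_def rmorph_sum /= /selfadjoint.
rewrite mulmx_suml raddf_sum /=; apply: eq_bigr => i _.
rewrite linearZ /= rmorphXn /= horner_mx_X -scalemxAl linearZ /=.
by rewrite (selfadjoint_pow i sS).
Qed.

Lemma selfadjoint_nilp S k : selfadjoint g S -> S ^+ k.+1 = 0 -> S = 0.
Proof.
move=> sS; elim: k => [|k IH]; first by rewrite expr1.
move=> S0; apply: IH.
apply: (selfadjoint_sqr_eq0 g_sym g_pos (selfadjoint_pow _ sS)).
by rewrite mulmxE -exprD -addSnnS exprD S0 mul0r.
Qed.

(** A complex eigenvalue [a + ib] of a self-adjoint endomorphism has an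
    eigenvector [x + iy], and comparing the two values of [gdot (x S) y] gives
    [b (gdot x x + gdot y y) = 0]. *)
Lemma selfadjoint_eigen_real (S : 'M[R]_n) (z : R[i]) : selfadjoint g S ->
  root (map_poly (real_complex R) (char_poly S)) z -> z = real_complex R (complex.Re z).
Proof.
move=> sS; rewrite map_char_poly -eigenvalue_root_char => /eigenvalueP [v vS v0].
pose x := map_mx (@complex.Re R) v; pose y := map_mx (@complex.Im R) v.
case: z vS => a b vS /=.
have xS : x *m S = a *: x - b *: y.
  apply/rowP => j; move/rowP: vS => /(_ j)/(congr1 (@complex.Re R)).
  rewrite !mxE raddf_sum /= => E.
  transitivity (complex.Re ((a +i* b)%C * v 0 j)); last by case: (v 0 j).
  rewrite -E; apply: eq_bigr => k _; rewrite !mxE; case: (v 0 k) => c d /=; ring.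
have yS : y *m S = b *: x + a *: y.
  apply/rowP => j; move/rowP: vS => /(_ j)/(congr1 (@complex.Im R)).
  rewrite !mxE raddf_sum /= => E.
  transitivity (complex.Im ((a +i* b)%C * v 0 j)); last by case: (v 0 j) => c d /=; ring.
  rewrite -E; apply: eq_bigr => k _; rewrite !mxE; case: (v 0 k) => c d /=; ring.
have := gdot_self g_sym x y sS.
rewrite xS yS -scaleNr gdotDl gdotDr // !gdotZl !gdotZr // => E.
have {E} : b * (gdot g x x + gdot g y y) = 0 by move: E; lra.
move/eqP; rewrite mulf_eq0 => /orP [/eqP -> //|].
rewrite paddr_eq0 ?gdot_ge0 // => /andP [/eqP/(gdot_eq0 g_pos) x0 /eqP/(gdot_eq0 g_pos) y0].
case/eqP: v0; apply/rowP => j; rewrite mxE.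
move/rowP: x0 => /(_ j); move/rowP: y0 => /(_ j); rewrite !mxE.
by case: (v 0 j) => c d /= -> ->.
Qed.

(** The roots of the minimal polynomial are real. Let [q] be the product of the
    corresponding distinct linear factors: [q(S)] is nilpotent, since a power of
    [q] is a multiple of the minimal polynomial, and it is self-adjoint, hence 0. *)
Lemma selfadjoint_diagonalizable (S : 'M[R]_n) : selfadjoint g S -> diagonalizable S.
Proof.
move=> sS; set p := mxminpoly S; pose f := real_complex R.
have [r Er] := closed_field_poly_normal (map_poly f p : {poly R[i]}).
have lp : lead_coef (map_poly f p) = 1.
  by rewrite lead_coef_map (monicP (mxminpoly_monic S)) rmorph1.
rewrite lp scale1r in Er.
pose s := [seq complex.Re z | z <- r].
have Es : p = \prod_(a <- s) ('X - a%:P).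
  apply: (map_poly_inj f); rewrite Er rmorph_prod big_map /=.
  rewrite big_seq [RHS]big_seq; apply: eq_bigr => z zr.
  rewrite rmorphB /= map_polyX map_polyC /= -(selfadjoint_eigen_real sS) //.
  have : root (map_poly f p) z by rewrite Er root_prod_XsubC.
  apply: root_dvdp.
  by rewrite dvdp_map mxminpoly_dvd_char.
apply/diagonalizableP; exists (undup s); first exact: undup_uniq.
set q := \prod_(x <- undup s) _.
apply: mxminpoly_min; apply: (@selfadjoint_nilp _ (size s)).
  exact: selfadjoint_horner.
rewrite -rmorphXn /=; apply/eqP; rewrite -dvd_mxminpoly -/p Es.
apply: (@dvdp_trans _ (q ^+ size s)); last by rewrite exprS dvdp_mull.
suff H t : {subset t <= undup s} -> \prod_(a <- t) ('X - a%:P) %| q ^+ size t.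
  by apply: H => x; rewrite mem_undup.
elim: t => [_|x t IH sub]; first by rewrite big_nil dvd1p.
rewrite big_cons exprS dvdp_mul ?IH //; last first.
  by move=> y yt; apply: sub; rewrite inE yt orbT.
by rewrite /q dvdp_XsubCl root_prod_XsubC; apply: sub; rewrite mem_head.
Qed.
End SelfAdjointDiag.

(** The real spectral theorem, for a positive definite form [g]. *)
Lemma selfadjoint_spectral (R : rcfType) n (g S : 'M[R]_n) :
  g^T = g -> (forall v : 'rV[R]_n, v != 0 -> 0 < (v *m g *m v^T) 0 0) ->
  (S *m g)^T = S *m g ->
  exists2 P, P \in unitmx & exists d, P *m S = diag_mx d *m P.
Proof.
case: n g S => [|n] g S gs gp sS.
  by exists 1%:M; rewrite ?unitmx1 //; exists 0; apply/matrixP => -[].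
have [P Pu /diagonalizable_forPex [d /(simmxRL Pu) E]] := selfadjoint_diagonalizable gs gp sS.
by exists P => //; exists d; rewrite E mulmxKV.
Qed.

(** * Linear independence of square roots *)

Section OneVariable.
Local Open Scope classical_set_scope.
Local Open Scope ring_scope.
Variable R : realType.
Implicit Types l u h : R.

(** A continuous function that does not vanish identically on an interval has no
    zero on a subinterval; treat the functions one after the other. *)
Lemma shrink_zeros (I : eqType) (phi : I -> R -> R) (s : seq I) l u :
  (forall i, continuous (phi i)) -> l < u ->
  exists l' u', [/\ l <= l', l' < u', u' <= u &
    (exists2 i, i \in s & {in `]l', u'[, forall h, phi i h = 0}) \/
    {in s, forall i, {in `]l', u'[, forall h, phi i h != 0}}].
Proof.
move=> cphi lu; elim: s => [|i s IH].
  by exists l, u; split=> //; right.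
have [l' [u' [ll' lu' uu' [[j js jz]|nz]]]] := IH.
  by exists l', u'; split=> //; left; exists j => //; rewrite inE js orbT.
have [iz|/existsNP [h /not_implyP [hI /eqP ih]]] :=
  pselect ({in `]l', u'[, forall h, phi i h = 0}).
  by exists l', u'; split=> //; left; exists i; rewrite ?mem_head.
have N1 : \forall x \near h, phi i x != 0.
  have := cphi i h; move/cvgr_neq0; apply => //.
have N2 : \forall x \near h, x \in `]l', u'[%R.
  exact: near_in_itvoo.
have [e /= e0 eN] : nbhs h [set x | phi i x != 0 /\ x \in `]l', u'[%R].
  by near=> x; split; near: x.
have sub x : x \in `]h - e / 2, h + e / 2[ -> phi i x != 0 /\ x \in `]l', u'[%R.
  rewrite in_itv /= => /andP [h1 h2]; apply: eN => /=.
  rewrite /ball /= ltr_norml; apply/andP; split; lra.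
have [hl hu] : l' < h /\ h < u' by move: hI; rewrite in_itv /= => /andP [].
have [l'h u'h] : l' <= h - e/2 /\ h + e / 2 <= u'.
  split; rewrite leNgt; apply/negP => H.
    have [|_] := sub l'; first by rewrite in_itv /=; apply/andP; split; lra.
    by rewrite in_itv /= ltxx.
  have [|_] := sub u'; first by rewrite in_itv /=; apply/andP; split; lra.
  by rewrite in_itv /= ltxx andbF.
exists (h - e / 2), (h + e / 2); split; [lra|lra|lra|right].
move=> j; rewrite inE => /orP [/eqP -> x /sub []//|js x /sub [_ xI]].
exact: nz.
Unshelve. all: by end_near. Qed.

Lemma shrink_roots (p : {poly R}) l u : p != 0 -> l < u ->
  exists l' u', [/\ l <= l', l' < u', u' <= u &
    {in `]l', u'[, forall h, p.[h] != 0}].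
Proof.
move=> p0 lu.
have [l' [u' [ll' lu' uu' H]]] := @shrink_zeros unit (fun _ => horner p) [:: tt] l u
  (fun=> @continuous_horner _ p) lu.
exists l', u'; split=> //; case: H => [[[] _ pz]|/(_ tt (mem_head _ _))//].
exfalso; pose f (k : nat) : R := l' + (u' - l') * (k.+1%:R / (size p).+1%:R).
have fI k : (k < size p)%N -> f k \in `]l', u'[.
  move=> kp; rewrite in_itv /= /f.
  have k0 : 0 < k.+1%:R / (size p).+1%:R :> R by rewrite divr_gt0.
  have k1 : k.+1%:R / (size p).+1%:R < 1 :> R by rewrite ltr_pdivrMr // mul1r ltr_nat.
  move: (_ / _) k0 k1 => c c0 c1.
  by apply/andP; split; nra.
have := @max_poly_roots R p [seq f k | k <- iota 0 (size p)] p0.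
rewrite size_map size_iota ltnn => H; suff : false by []; apply: H.
  by apply/allP => x /mapP [k]; rewrite mem_iota => /andP [_ kp] ->; apply/eqP/pz/fI.
rewrite map_inj_uniq ?iota_uniq // => i j /eqP.
rewrite /f (inj_eq (addrI _)) => /eqP /mulfI -/(_ _) /divIf H.
have /eqP : i.+1%:R = j.+1%:R :> R by apply: H; rewrite ?pnatr_eq0 // subr_eq0 gt_eqF.
by rewrite eqr_nat => /eqP [].
Qed.

(** [sqrt (h^2 - a) / (h^2 - a)^k], up to factors the iterated derivatives of
    [sqrt (h^2 - a)]. *)
Definition sqrt_jet (a : R) (k : nat) (h : R) : R :=
  Num.sqrt (h ^+ 2 - a) * ((h ^+ 2 - a)^-1) ^+ k.

Lemma is_derive_sqrt_jet a k h : a < h ^+ 2 ->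
  is_derive h 1 (sqrt_jet a k) ((1 - 2 * k%:R) * h * sqrt_jet a k.+1 h).
Proof.
move=> ah; have w0 : 0 < h ^+ 2 - a by rewrite subr_gt0.
have dw : is_derive h 1 (fun x : R => x ^+ 2 - a) (2 * h).
  have -> : (fun x : R => x ^+ 2 - a) = (id ^+ 2) - cst a by [].
  apply: is_derive_eq; rewrite /=.
  by rewrite subr0 /GRing.scale /= mulr1 expr1 mulr_natl.
elim: k => [|k IH].
  have -> : sqrt_jet a 0 = Num.sqrt \o (fun x => x ^+ 2 - a).
    by apply/funext => x; rewrite /sqrt_jet expr0 mulr1.
  have ds := is_derive1_sqrt w0.
  apply: is_derive_eq.
  rewrite /sqrt_jet expr1 mulr0 subr0 mul1r.
  set t := Num.sqrt _; have t0 : t != 0 by rewrite gt_eqF // sqrtr_gt0.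
  have -> : (h ^+ 2 - a)^-1 = (t ^+ 2)^-1 by rewrite sqr_sqrtr // ltW.
  by rewrite /GRing.scale /=; field; rewrite t0.
have dv : is_derive h 1 (fun x : R => (x ^+ 2 - a)^-1) (- (2 * h) * (h ^+ 2 - a)^-1 ^+ 2).
  split; first by apply: derivableV; rewrite ?gt_eqF.
  rewrite deriveV ?gt_eqF // derive_val /GRing.scale /=.
  by field; rewrite gt_eqF.
have -> : sqrt_jet a k.+1 = sqrt_jet a k * (fun x => (x ^+ 2 - a)^-1).
  apply/funext => x; transitivity (sqrt_jet a k x * (x ^+ 2 - a)^-1) => //.
  by rewrite /sqrt_jet [_ ^+ k.+1]exprSr mulrA.
apply: is_derive_eq; rewrite /sqrt_jet /GRing.scale /= -[in RHS]natr1 !exprS.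
by ring.
Qed.

(** By linearity [sum_i w_i p(x_i) = 0] for all polynomials [p]; take for [p] the
    polynomial whose roots are the [x_i] other than [y]. *)
Lemma sum_powers_eq0 (I : finType) (w x : I -> R) :
  (forall k, \sum_i w i * x i ^+ k = 0) ->
  forall y, \sum_(i | x i == y) w i = 0.
Proof.
move=> H y.
have Hp (p : {poly R}) : \sum_i w i * p.[x i] = 0.
  under eq_bigr => i _ do rewrite horner_coef mulr_sumr.
  rewrite exchange_big big1 // => k _ /=.
  under eq_bigr => i _ do rewrite mulrCA.
  by rewrite -mulr_sumr H mulr0.
have := Hp (\prod_(i | x i != y) ('X - (x i)%:P)).
rewrite (bigID (fun i => x i == y)) /= [X in _ + X]big1 ?addr0; last first.
  move=> i ixy; rewrite horner_prod (bigD1 i) //= hornerXsubC subrr.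
  by rewrite mul0r mulr0.
pose K := \prod_(i | x i != y) (y - x i).
under eq_bigr => i /eqP iy do rewrite horner_prod iy.
have -> : \sum_(i | x i == y) w i * \prod_(i0 | x i0 != y) ('X - (x i0)%:P).[y]
   = (\sum_(i | x i == y) w i) * K.
  rewrite mulr_suml; apply: eq_bigr => i _; congr (_ * _).
  by apply: eq_bigr => j _; rewrite hornerXsubC.
move/eqP; rewrite mulf_eq0 => /orP [/eqP -> //|/eqP K0].
suff : K != 0 by rewrite K0 eqxx.
by apply/prodf_neq0 => i iy; rewrite subr_eq0 eq_sym.
Qed.

(** Differentiating a relation between the [sqrt (h^2 - a_i)] repeatedly, and
    dividing by [h] and by the odd number [1 - 2 k], gives the relations between
    the [(h^2 - a_i)^(1/2 - k)] with the same coefficients: a Vandermonde system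
    with nodes [(h^2 - a_i)^-1]. *)
Lemma sqrt_independent (I : finType) (c a : I -> R) l u : l < u ->
  {in `]l, u[, forall h, h != 0} ->
  {in `]l, u[, forall h i, a i < h ^+ 2} ->
  {in `]l, u[, forall h, \sum_i c i * Num.sqrt (h ^+ 2 - a i) = 0} ->
  forall x, \sum_(i | a i == x) c i = 0.
Proof.
move=> lu hn0 ha H x.
have Hk k : {in `]l, u[, forall h, \sum_i c i * sqrt_jet (a i) k h = 0}.
  elim: k => [|k IH] h hI.
    rewrite -[RHS](H h hI); apply: eq_bigr => i _.
    by rewrite /sqrt_jet expr0 mulr1.
  have D : is_derive h 1 (\sum_i (c i *: sqrt_jet (a i) k))
      (\sum_i c i *: ((1 - 2 * k%:R) * h * sqrt_jet (a i) k.+1 h)).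
    elim/big_ind2 : _ => [|df f dg g Df Dg|i _].
    - exact: (is_derive_cst (0 : R) h 1).
    - exact: is_deriveD.
    - have := is_derive_sqrt_jet k (ha h hI i); exact: is_deriveZ.
  have D0 : is_derive h 1 (\sum_i (c i *: sqrt_jet (a i) k)) 0.
    apply: (@near_eq_is_derive _ _ _ (cst 0)).
    near=> y; rewrite /= fct_sumE.
    have yI : y \in `]l, u[%R by near: y; exact: near_in_itvoo.
    by rewrite -[LHS](IH y yI).
  have := @derive_val _ _ _ _ _ _ _ D; rewrite (@derive_val _ _ _ _ _ _ _ D0).
  under eq_bigr => i _ do rewrite /GRing.scale /= mulrCA.
  rewrite -mulr_sumr => /esym/eqP; rewrite mulf_eq0 mulf_eq0 (negbTE (hn0 h hI)) orbF.
  case/orP => [|/eqP //]; rewrite subr_eq0 -natrM (eqr_nat R 1) => /eqP.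
  by lia.
pose h := (l + u) / 2; have hI : h \in `]l, u[.
  by rewrite in_itv /=; apply/andP; split; rewrite /h; lra.
have w0 i : 0 < h ^+ 2 - a i by rewrite subr_gt0 ha.
have := @sum_powers_eq0 I (fun i => c i * Num.sqrt (h ^+ 2 - a i))
  (fun i => (h ^+ 2 - a i)^-1) _ (h ^+ 2 - x)^-1.
have -> : \sum_(i | (h ^+ 2 - a i)^-1 == (h ^+ 2 - x)^-1) c i * Num.sqrt (h ^+ 2 - a i)
   = (\sum_(i | a i == x) c i) * Num.sqrt (h ^+ 2 - x).
  rewrite mulr_suml; apply: eq_big => [i|i].
    by rewrite (inj_eq invr_inj) (inj_eq (addrI _)) (inj_eq oppr_inj).
  by rewrite (inj_eq invr_inj) (inj_eq (addrI _)) (inj_eq oppr_inj) => /eqP ->.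
move=> E; have {}E : (\sum_(i | a i == x) c i) * Num.sqrt (h ^+ 2 - x) = 0.
  by apply: E => k; rewrite -[RHS](Hk k h hI); apply: eq_bigr => i _; rewrite mulrA.
have [i /eqP ix|none] := pickP (fun i => a i == x); last by rewrite big_pred0.
move/eqP: E; rewrite mulf_eq0 => /orP [/eqP //|].
by rewrite -ix gt_eqF // sqrtr_gt0.
Unshelve. all: by end_near. Qed.

End OneVariable.

(** * Families with prescribed sum and prescribed products [lam (h - lam)] *)

Section Pattern.
Variables (R : realType) (n : nat).
Implicit Types (mu lam : 'I_n -> R) (l u h : R).

Definition ricci_spectrum mu lam h :=
  \sum_i lam i = h /\ forall i, lam i * (h - lam i) = mu i.

Lemma sum_signs_le (A : pred 'I_n) (e : 'I_n -> bool) :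
  `|\sum_(i | A i) (-1) ^+ e i| <= #|A|%:R :> R.
Proof.
apply: le_trans (ler_norm_sum _ _ _) _.
rewrite -sum1_card natr_sum; apply: ler_sum => i _.
by rewrite normr_sign.
Qed.

(** A sum of signs that is [n - 2] in absolute value has at least [n - 2] terms, so
    at most two of the [mu i] are nonzero; and signs cancel only when there are at
    least two of them. *)
Lemma two_equal_of_signs mu (e : 'I_n -> bool) (s : R) : (2 < n)%N ->
  `|s| = 1 ->
  (forall m, m != 0 -> \sum_(i | mu i == m) (-1) ^+ e i = 0 :> R) ->
  \sum_(i | mu i == 0) (-1) ^+ e i = (n - 2)%:R * s ->
  (forall i, mu i = 0) \/
  exists i j, [/\ i != j, mu i = mu j, mu i != 0 &
                 forall k, k != i -> k != j -> mu k = 0].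
Proof.
move=> n2 s1 H H0.
have := sum_signs_le (fun i => mu i == 0) e; rewrite H0 normrM s1 mulr1 normr_nat ler_nat => Z.
have [allz|/existsNP [i /eqP mi]] := pselect (forall i, mu i = 0); first by left.
right.
have [j /andP [ji /eqP mji]|none] := pickP [pred j | (j != i) && (mu j == mu i)]; last first.
  have := H _ mi; rewrite (bigD1 i) //= big1 ?addr0.
    by move/eqP; rewrite signr_eq0.
  by move=> k /andP [mk ki]; have := none k; rewrite /= ki mk.
exists i, j; split=> //; first by rewrite eq_sym.
move=> k ki kj; apply/eqP; apply: contraT => mk.
have : (#|i |: [set j; k]| <= #|~: [set i | mu i == 0%R]|)%N.
  apply: subset_leq_card; apply/fintype.subsetP => x; rewrite !inE.
  by case/or3P => /eqP ->; rewrite ?mji.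
have := cardsC [set i | mu i == 0%R]; rewrite card_ord (cardsE (fun i => mu i == 0%R)).
rewrite cardsU1 cards2 !inE ![i == _]eq_sym [j == k]eq_sym (negPf ki) (negPf kj) (negPf ji) /=.
by move: Z; lia.
Qed.

(** For each [h] the square roots in [2 lam = h +- sqrt (h^2 - 4 mu)] satisfy a
    linear relation with some choice of signs. There are finitely many choices, so
    one of the relations holds identically on a subinterval, and the square roots
    cancel. *)
Lemma spectrum_of_interval mu l u : (2 < n)%N -> l < u ->
  {in `]l, u[, forall h, exists lam, ricci_spectrum mu lam h} ->
  (forall i, mu i = 0) \/
  exists i j, [/\ i != j, mu i = mu j, mu i != 0 &
                 forall k, k != i -> k != j -> mu k = 0].
Proof.
move=> n2 lu0 H0.
(* Outside the roots of [q], neither [h] nor a discriminant is zero. *)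
pose q : {poly R} := 'X * \prod_i ('X^2 - (4 * mu i)%:P).
have q0 : q != 0.
  rewrite mulf_neq0 ?polyX_eq0 //; apply/prodf_neq0 => i _.
  by rewrite -size_poly_eq0 size_XnsubC.
have [l1 [u1 [ll1 lu1 uu1 Hq]]] := shrink_roots q0 lu0.
have {H0}H : {in `]l1, u1[, forall h, exists lam, ricci_spectrum mu lam h}.
  move=> h; rewrite in_itv /= => /andP [h1 h2]; apply: H0.
  by rewrite in_itv /=; apply/andP; split; lra.
have hn0 : {in `]l1, u1[, forall h, h != 0}.
  move=> h hI; have := Hq h hI; rewrite hornerM hornerX mulf_eq0 negb_or.
  by case/andP.
have hmu : {in `]l1, u1[, forall h i, 4 * mu i < h ^+ 2}.
  move=> h hI i; rewrite lt_neqAle; apply/andP; split.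
    have := Hq h hI; rewrite hornerM mulf_eq0 negb_or horner_prod => /andP [_ /prodf_neq0 /(_ i isT)].
    by rewrite hornerD hornerN hornerXn hornerC subr_eq0 eq_sym.
  have [lam [_ /(_ i) <-]] := H h hI; have := sqr_ge0 (2 * lam i - h); nra.
(* As [sum_i (2 lam i - h) = - (n - 2) h], the relation has the extra term
   [(n - 2) h = +- (n - 2) sqrt (h^2)], for which the index [ord0] stands. *)
pose a (o : 'I_n.+1) : R := if unlift ord0 o is Some i then 4 * mu i else 0.
pose c (e : {ffun 'I_n.+1 -> bool}) (o : 'I_n.+1) : R :=
  (-1) ^+ e o * if unlift ord0 o is Some i then 1 else (n - 2)%:R.
pose phi e h := \sum_o c e o * Num.sqrt (h ^+ 2 - a o).
have cphi e : continuous (phi e).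
  move=> h; rewrite /phi; apply: (cvg_big (op := +%R)) => [|o _]; first exact: add_continuous.
  apply: cvgM; first exact: cvg_cst.
  apply: continuous_comp; last exact: sqrt_continuous.
  apply: cvgB; last exact: cvg_cst.
  by rewrite expr2; under eq_fun do rewrite expr2; apply: cvgM; exact: cvg_id.
have [l2 [u2 [ll2 lu2 uu2 Z]]] := shrink_zeros (index_enum {ffun 'I_n.+1 -> bool}) cphi lu1.
have sub h : h \in `]l2, u2[ -> h \in `]l1, u1[.
  rewrite !in_itv /= => /andP [h1 h2]; apply/andP; split; lra.
(* If no relation held identically, the one with the actual signs would fail. *)
case: Z => [[e _ ez]|nz]; last first.
  exfalso; pose h := (l2 + u2) / 2.
  have hI : h \in `]l2, u2[ by rewrite in_itv /=; apply/andP; split; rewrite /h; lra.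
  have [lam [slam lmu]] := H h (sub h hI).
  pose e : {ffun 'I_n.+1 -> bool} :=
    [ffun o => if unlift ord0 o is Some i then 2 * lam i - h < 0 else h < 0].
  have /negP := nz e (mem_index_enum _) h hI; apply; apply/eqP.
  rewrite /phi big_ord_recl /c /a unlift_none /e ffunE unlift_none subr0 sqrtr_sqr.
  rewrite mulrAC -numEsign.
  under eq_bigr => i _.
    rewrite liftK ffunE liftK mulr1.
    rewrite (_ : h ^+ 2 - 4 * mu i = (2 * lam i - h) ^+ 2); last by rewrite -lmu; ring.
    rewrite sqrtr_sqr -numEsign.
    over.
  rewrite sumrB -mulr_sumr slam sumr_const card_ord -mulr_natl natrB; last by lia.
  by ring.
have ind := sqrt_independent (c := c e) (a := a) lu2 (fun h hI => hn0 h (sub h hI)) _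
   (fun h hI => ez h hI).
have {}ind x : \sum_(o | a o == x) c e o = 0.
  apply: ind => h hI o; rewrite /a; case: (unlift _ _) => [i|]; first exact: hmu (sub h hI) i.
  by rewrite exprn_even_gt0 // hn0 ?sub.
pose e' i := e (lift ord0 i).
have main x : (if 0 == x then (-1) ^+ e ord0 * (n - 2)%:R else 0) +
   \sum_(i | 4 * mu i == x) (-1) ^+ e' i = 0 :> R.
  rewrite -[RHS](ind x) [in RHS]big_mkcond big_ord_recl /a /c unlift_none; congr (_ + _).
  rewrite [in LHS]big_mkcond; apply: eq_bigr => i _.
  by rewrite liftK mulr1.
apply: (@two_equal_of_signs mu e' (- (-1) ^+ e ord0)) => //.
- by rewrite normrN normr_sign.
- move=> m m0; have := main (4 * m).
  rewrite eq_sym mulf_eq0 (negPf m0) orbF pnatr_eq0 add0r => E; rewrite -[RHS]E.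
  by apply: eq_bigl => i; rewrite (inj_eq (mulfI _)) // pnatr_eq0.
- have := main 0; rewrite eqxx => /(canRL (addKr _)); rewrite addr0 => E.
  rewrite mulrN mulrC -E.
  by apply: eq_bigl => i; rewrite mulf_eq0 pnatr_eq0.
Qed.

Definition two_valued mu (i j : 'I_n) (kappa : R) :=
  [/\ i != j, mu i = kappa, mu j = kappa &
      forall k, k != i -> k != j -> mu k = 0].

(** The remaining [lam] are roots of [lam (h - lam) = 0]. With [k] of them equal to [h]
    instead of [0], the trace condition forces [h = 0], [k = 0] or
    [4 kappa = (1 - k^2) h^2]. *)
Lemma two_valued_spectrum mu i j kappa : two_valued mu i j kappa -> kappa != 0 ->
  exists2 q : {poly R}, q != 0 & forall h lam, q.[h] != 0 ->
    ricci_spectrum mu lam h -> forall k, k != i -> k != j -> lam k = 0.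
Proof.
move=> [ij mi mj mk] k0.
exists ('X * \prod_(k < n.+1) ((4 * kappa)%:P - (1 - k%:R ^+ 2) *: 'X^2)).
  rewrite mulf_neq0 ?polyX_eq0 //; apply/prodf_neq0 => k _.
  apply: contraNneq k0 => /(congr1 (fun p => p.[0])).
  rewrite hornerD hornerN hornerZ hornerXn hornerC horner0 expr0n mulr0 subr0 => /eqP.
  by rewrite mulf_eq0 pnatr_eq0.
move=> h lam; rewrite hornerM hornerX mulf_eq0 negb_or horner_prod => /andP [h0 /prodf_neq0 qk].
move=> [slam lmu].
have lk k : k != i -> k != j -> lam k = h * (lam k != 0)%:R.
  move=> ki kj; have [->|lk0] := eqVneq (lam k) 0; first by rewrite mulr0.
  have /eqP := lmu k; rewrite mk // mulf_eq0 (negPf lk0) subr_eq0 => /eqP <-.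
  by rewrite mulr1.
pose A := [set k | (k != i) && (k != j) && (lam k != 0)].
have : lam i + lam j + h * #|A|%:R = h.
  rewrite -[RHS]slam (bigD1 i) //= (bigD1 j) /=; last by rewrite eq_sym.
  rewrite addrA; congr (_ + _).
  rewrite -sum1_card natr_sum mulr_sumr big_mkcond [RHS]big_mkcond /=.
  apply: eq_bigr => k _; rewrite !inE.
  case: (boolP (k != i)) => //= ki; case: (boolP (k != j)) => //= kj.
  by rewrite [in RHS]lk //; case: (lam k != 0); rewrite ?mulr0 ?mulr1.
set a := #|A|; move=> s.
have aA : (a < n.+1)%N by rewrite ltnS /a (leq_trans (max_card _)) ?card_ord.
have := qk (Ordinal aA) isT; rewrite hornerD hornerN hornerZ hornerXn hornerC /= => q0.
have Ei := lmu i; have Ej := lmu j; rewrite mi in Ei; rewrite mj in Ej.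
have /eqP : (lam i - lam j) * (lam i + lam j - h) = 0 by nra.
rewrite mulf_eq0 => /orP [] /eqP E; last first.
  have /eqP : h * a%:R = 0 by lra.
  rewrite mulf_eq0 (negPf h0) pnatr_eq0 /= cards_eq0 => /eqP A0 k ki kj.
  apply/eqP; apply: contraT => lk0.
  have : k \in A by rewrite /A inE ki kj lk0.
  by rewrite A0 inE.
case/eqP: q0; have {}E : lam j = lam i by lra.
have li : lam i = (1 - a%:R) * h / 2 by lra.
by rewrite -Ei li; field.
Qed.

Lemma exceptional_spectrum mu l u : (2 < n)%N -> l < u ->
  {in `]l, u[, forall h, exists lam, ricci_spectrum mu lam h} ->
  (exists i, mu i != 0) ->
  exists i j kappa l' u', [/\ two_valued mu i j kappa, kappa != 0,
    l <= l' /\ l' < u', u' <= u &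
    {in `]l', u'[, forall h lam, ricci_spectrum mu lam h ->
       forall k, k != i -> k != j -> lam k = 0}].
Proof.
move=> n2 lu H [i0 mi0].
case: (spectrum_of_interval n2 lu H) => [z|[i [j [ij mij mi mk]]]].
  by rewrite z eqxx in mi0.
have tv : two_valued mu i j (mu i) by [].
have [q q0 Hq] := two_valued_spectrum tv mi.
have [l' [u' [ll' lu' uu' Hl]]] := shrink_roots q0 lu.
exists i, j, (mu i), l', u'; split=> // h hI lam rs k ki kj.
exact: (Hq h lam (Hl h hI) rs).
Qed.
End Pattern.

Local Open Scope classical_set_scope.
Local Open Scope ring_scope.

(** * Derivatives of matrix-valued functions *)

Section MatrixCalculus.
Variables (R : realType) (V : normedModType R).
Implicit Types x v : V.

Lemma derivable_big_sum (I : Type) (r : seq I) (f : I -> V -> R) x v :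
  (forall i, derivable (f i) x v) -> derivable (fun y => \sum_(i <- r) f i y) x v.
Proof.
move=> df; elim: r => [|i r IH].
  by under eq_fun do rewrite big_nil; exact: derivable_cst.
under eq_fun do rewrite big_cons; apply: derivableD; [exact: df | exact: IH].
Qed.

Lemma derive_big_sum (I : Type) (r : seq I) (f : I -> V -> R) x v :
  (forall i, derivable (f i) x v) ->
  'D_v (fun y => \sum_(i <- r) f i y) x = \sum_(i <- r) 'D_v (f i) x.
Proof.
move=> df; elim: r => [|i r IH].
  by under eq_fun do rewrite big_nil; rewrite big_nil derive_cst.
under eq_fun do rewrite big_cons; rewrite big_cons -IH deriveD //.
exact: derivable_big_sum.
Qed.

Lemma derivable_big_prod (I : Type) (r : seq I) (f : I -> V -> R) x v :
  (forall i, derivable (f i) x v) -> derivable (fun y => \prod_(i <- r) f i y) x v.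
Proof.
move=> df; elim: r => [|i r IH].
  by under eq_fun do rewrite big_nil; exact: derivable_cst.
under eq_fun do rewrite big_cons; apply: derivableM; [exact: df | exact: IH].
Qed.

Lemma derivable_entry p q (A : V -> 'M[R]_(p, q)) x v i j :
  derivable A x v -> derivable (fun y => A y i j) x v.
Proof. by move/derivable_mxP. Qed.

Lemma derive_entry p q (A : V -> 'M[R]_(p, q)) x v i j : derivable A x v ->
  'D_v A x i j = 'D_v (fun y => A y i j) x.
Proof. by move/derive_mx->; rewrite mxE. Qed.

Lemma derivable_trmx p q (A : V -> 'M[R]_(p, q)) x v :
  derivable A x v -> derivable (fun y => (A y)^T) x v.
Proof.
move=> dA; apply/derivable_mxP => i j; under eq_fun do rewrite mxE.
exact: derivable_entry.
Qed.

Lemma derive_trmx p q (A : V -> 'M[R]_(p, q)) x v : derivable A x v ->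
  'D_v (fun y => (A y)^T) x = ('D_v A x)^T.
Proof.
move=> dA; apply/matrixP => i j; rewrite [RHS]mxE derive_entry; last exact: derivable_trmx.
by rewrite derive_entry //; congr ('D_v _ x); apply/funext => y; rewrite mxE.
Qed.

Section Product.
Variables (p q r : nat).
Implicit Types (A : V -> 'M[R]_(p, q)) (B : V -> 'M[R]_(q, r)).

Lemma derivable_mulmx A B x v : derivable A x v -> derivable B x v ->
  derivable (fun y => A y *m B y) x v.
Proof.
move=> dA dB; apply/derivable_mxP => i j; under eq_fun do rewrite mxE.
by apply: derivable_big_sum => k; apply: derivableM; exact: derivable_entry.
Qed.

Lemma derive_mulmx A B x v : derivable A x v -> derivable B x v ->
  'D_v (fun y => A y *m B y) x = 'D_v A x *m B x + A x *m 'D_v B x.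
Proof.
move=> dA dB; apply/matrixP => i j.
rewrite derive_entry; last exact: derivable_mulmx.
under eq_fun do rewrite mxE.
rewrite derive_big_sum; last first.
  by move=> k; apply: derivableM; exact: derivable_entry.
rewrite !mxE -big_split /=; apply: eq_bigr => k _.
rewrite !derive_entry // deriveM; try exact: derivable_entry.
by rewrite addrC; congr (_ + _); exact: mulrC.
Qed.
End Product.

Lemma derive_mulmxl p q r (A : 'M[R]_(p, q)) (B : V -> 'M[R]_(q, r)) x v :
  derivable B x v -> 'D_v (fun y => A *m B y) x = A *m 'D_v B x.
Proof.
move=> dB; rewrite (@derive_mulmx _ _ _ (fun=> A)) //.
by rewrite derive_cst mul0mx add0r.
Qed.

Lemma derive_mulmxr p q r (A : V -> 'M[R]_(p, q)) (B : 'M[R]_(q, r)) x v :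
  derivable A x v -> 'D_v (fun y => A y *m B) x = 'D_v A x *m B.
Proof.
move=> dA; rewrite (@derive_mulmx _ _ _ A (fun=> B)) //.
by rewrite derive_cst mulmx0 addr0.
Qed.

Lemma derivable_mulmxl p q r (A : 'M[R]_(p, q)) (B : V -> 'M[R]_(q, r)) x v :
  derivable B x v -> derivable (fun y => A *m B y) x v.
Proof. by apply: derivable_mulmx; exact: derivable_cst. Qed.

Lemma derivable_mulmxr p q r (A : V -> 'M[R]_(p, q)) (B : 'M[R]_(q, r)) x v :
  derivable A x v -> derivable (fun y => A y *m B) x v.
Proof. by move=> dA; apply: derivable_mulmx => //; exact: derivable_cst. Qed.

Lemma derivable_mxtrace p (A : V -> 'M[R]_p) x v :
  derivable A x v -> derivable (fun y => \tr (A y)) x v.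
Proof. by move=> dA; apply: derivable_big_sum => i; exact: derivable_entry. Qed.

Lemma derive_mxtrace p (A : V -> 'M[R]_p) x v :
  derivable A x v -> 'D_v (fun y => \tr (A y)) x = \tr ('D_v A x).
Proof.
move=> dA; rewrite derive_big_sum; last by move=> i; exact: derivable_entry.
by apply: eq_bigr => i _; rewrite derive_entry.
Qed.

Lemma derivable_det p (A : V -> 'M[R]_p) x v :
  derivable A x v -> derivable (fun y => \det (A y)) x v.
Proof.
move=> dA; apply: derivable_big_sum => s; apply: derivableM; first exact: derivable_cst.
by apply: derivable_big_prod => i; exact: derivable_entry.
Qed.

(** Cramer's rule. *)
Lemma derivable_invmx p (A : V -> 'M[R]_p) x v :
  derivable A x v -> (\forall y \near x, A y \in unitmx) ->
  derivable (fun y => invmx (A y)) x v.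
Proof.
move=> dA Au.
apply: (@near_eq_derivable _ _ _ (fun y => (\det (A y))^-1 *: \adj (A y))).
  by apply: filterS Au => y Ay; rewrite /invmx Ay.
apply/derivable_mxP => i j; under eq_fun do rewrite !mxE.
apply: derivableM.
  apply: derivableV; last exact: derivable_det.
  by move/nbhs_singleton: Au; rewrite unitmxE unitfE.
apply: derivableM; first exact: derivable_cst.
apply: derivable_det; apply/derivable_mxP => k l; under eq_fun do rewrite !mxE.
exact: derivable_entry.
Qed.

End MatrixCalculus.

(** * Symmetry of second derivatives *)

Section Schwarz.
Variables (R : realType) (V : normedModType R).

Lemma is_derive_line (f : V -> R) (u y : V) (s : R) : derivable f (s *: u + y) u ->
  is_derive s 1 (fun s => f (s *: u + y)) ('D_u f (s *: u + y)).
Proof.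
have E : (fun h : R => h^-1 *: (f ((h *: 1 + s) *: u + y) - f (s *: u + y))) =
         (fun h : R => h^-1 *: (f (h *: u + (s *: u + y)) - f (s *: u + y))).
  by apply/funext => h; rewrite scalerDl addrA /GRing.scale /= mulr1.
move=> df; split.
  by move: df; rewrite /derivable /= E.
by rewrite /derive /= E.
Qed.

Lemma MVT_line (f : V -> R) (u y : V) (s : R) : 0 < s ->
  (forall r, 0 <= r <= s -> derivable f (r *: u + y) u) ->
  exists2 c, 0 <= c <= s & f (s *: u + y) - f y = s * 'D_u f (c *: u + y).
Proof.
move=> s0 df.
have dline r : r \in `]0, s[ -> is_derive r 1 (fun r => f (r *: u + y)) ('D_u f (r *: u + y)).
  rewrite in_itv /= => /andP [r0 rs].
  by apply: is_derive_line; apply: df; rewrite (ltW r0) (ltW rs).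
have cline : {within `[0, s], continuous (fun r => f (r *: u + y))}.
  apply: derivable_within_continuous => r; rewrite in_itv /= => r0s.
  by have := @ex_derive _ _ _ _ _ _ _ (is_derive_line (df r r0s)).
have [c cs E] := MVT s0 dline cline.
exists c; first by move: cs; rewrite in_itv /= => /andP [/ltW -> /ltW ->].
by rewrite scale0r add0r subr0 mulrC in E.
Qed.

(** The second difference of [f] along [u] and [v] is, by the mean value theorem
    applied twice, a value of ['D_v ('D_u f)] near [x]. *)
Lemma second_difference (f : V -> R) (u v x : V) (s : R) : 0 < s ->
  (forall a b, 0 <= a <= s -> 0 <= b <= s ->
     derivable f (a *: u + b *: v + x) u /\ derivable ('D_u f) (a *: u + b *: v + x) v) ->
  exists a b, [/\ 0 <= a <= s, 0 <= b <= s &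
    f (s *: u + s *: v + x) - f (s *: v + x) - (f (s *: u + x) - f x) =
    s * (s * 'D_v ('D_u f) (a *: u + b *: v + x))].
Proof.
move=> s0 df; have ss : 0 <= s <= s by rewrite ltW //=.
have s00 : (0 : R) <= 0 <= s by rewrite lexx ltW.
pose g := (fun z => f (z + s *: v)) - f.
have dg z : derivable f (z + s *: v) u -> derivable f z u ->
    derivable g z u /\ 'D_u g z = 'D_u f (z + s *: v) - 'D_u f z.
  move=> d1 d2.
  have E : (fun h : R => h^-1 *: (f (h *: u + z + s *: v) - f (z + s *: v))) =
           (fun h : R => h^-1 *: (f (h *: u + (z + s *: v)) - f (z + s *: v))).
    by apply/funext => h; rewrite addrA.
  have d3 : derivable (fun z => f (z + s *: v)) z u by move: d1; rewrite /derivable /= E.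
  have d3' : 'D_u (fun z => f (z + s *: v)) z = 'D_u f (z + s *: v).
    by rewrite /derive /= E.
  by split; [apply: derivableB; [exact: d3 | exact: d2] | rewrite (deriveB d3 d2) d3'].
have dg' r : 0 <= r <= s -> derivable g (r *: u + x) u /\
    'D_u g (r *: u + x) = 'D_u f (r *: u + x + s *: v) - 'D_u f (r *: u + x).
  move=> rs; apply: dg; first by rewrite addrAC; apply: (df _ _ rs ss).1.
  by have := (df _ _ rs s00).1; rewrite scale0r addr0.
have [a as_ Ea] := MVT_line s0 (fun r rs => (dg' r rs).1).
have [b bs Eb] : exists2 b, 0 <= b <= s &
   'D_u f (s *: v + (a *: u + x)) - 'D_u f (a *: u + x) =
   s * 'D_v ('D_u f) (b *: v + (a *: u + x)).
  apply: (@MVT_line ('D_u f) v (a *: u + x) s s0) => r rs; rewrite addrA [r *: v + _]addrC.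
  exact: (df _ _ as_ rs).2.
exists a, b; split=> //.
rewrite (dg' a as_).2 [a *: u + x + _]addrC Eb in Ea.
rewrite [a *: u + b *: v]addrC -[b *: v + a *: u + x]addrA -Ea /g !fctE.
by rewrite [s *: u + x + _]addrAC [x + s *: v]addrC; ring.
Qed.

Lemma swap_difference (A B C D : R) : A - B - (C - D) = A - C - (B - D).
Proof. by ring. Qed.

Lemma dist_le_split (P Q X e : R) : `|P - X| < e / 2 -> `|Q - X| < e / 2 -> `|P - Q| <= e.
Proof.
move=> h1 h2; rewrite (_ : P - Q = (P - X) - (Q - X)); last by ring.
by apply: le_trans (ler_normB _ _) _; rewrite [e]splitr lerD // ltW.
Qed.

(** Both mixed derivatives are limits of the same second difference, divided by
    the area of the parallelogram, and both are continuous. *)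
Lemma schwarz_real (U : set V) (f : V -> R) (u v x : V) : open U -> U x ->
  (forall y, U y -> [/\ derivable f y u, derivable f y v,
                     derivable ('D_u f) y v & derivable ('D_v f) y u]) ->
  {for x, continuous ('D_v ('D_u f))} -> {for x, continuous ('D_u ('D_v f))} ->
  'D_v ('D_u f) x = 'D_u ('D_v f) x.
Proof.
move=> oU Ux df c1 c2; apply/eqP; rewrite -subr_eq0 -normr_le0; apply/ler_addgt0Pr => e e0.
rewrite add0r.
have e20 : 0 < e / 2 by rewrite divr_gt0.
have N1 : \forall y \near x, `|'D_v ('D_u f) x - 'D_v ('D_u f) y| < e / 2.
  by move/cvgrPdist_lt : c1 => /(_ _ e20).
have N2 : \forall y \near x, `|'D_u ('D_v f) x - 'D_u ('D_v f) y| < e / 2.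
  by move/cvgrPdist_lt : c2 => /(_ _ e20).
have N3 : \forall y \near x, U y by exact: open_nbhs_nbhs.
have /nbhs_ballP [d /= d0 dN] : nbhs x [set y | [/\ U y, `|'D_v ('D_u f) x - 'D_v ('D_u f) y| < e / 2 &
   `|'D_u ('D_v f) x - 'D_u ('D_v f) y| < e / 2]].
  by apply: filterS3 N3 N1 N2 => y; split.
(* With this size the parallelogram spanned by [s u] and [s v] lies in the ball. *)
pose s := d / (2 * (`|u| + `|v| + 1)).
have uv0 : 0 < `|u| + `|v| + 1 by rewrite ltr_wpDl // addr_ge0.
have s0 : 0 < s by rewrite divr_gt0 // mulr_gt0.
have inball a b : 0 <= a <= s -> 0 <= b <= s -> ball x d (a *: u + b *: v + x).
  move=> /andP [a0 as_] /andP [b0 bs]; rewrite -ball_normE /= opprD addrCA subrr addr0 normrN.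
  apply: le_lt_trans (ler_normD _ _) _; rewrite !normrZ !ger0_norm //.
  have : s * (`|u| + `|v| + 1) = d / 2 by rewrite /s; field; rewrite gt_eqF.
  have := ler_wpM2r (normr_ge0 u) as_; have := ler_wpM2r (normr_ge0 v) bs.
  by move: (`|u|) (`|v|) => U' V'; lra.
have [a [b [as_ bs Eab]]] : exists a b, [/\ 0 <= a <= s, 0 <= b <= s &
    f (s *: u + s *: v + x) - f (s *: v + x) - (f (s *: u + x) - f x) =
    s * (s * 'D_v ('D_u f) (a *: u + b *: v + x))].
  apply: (@second_difference f u v x s s0) => a b as_ bs.
  have [Uy _ _] := dN _ (inball a b as_ bs).
  by have [du _ duv _] := df _ Uy; exact: (conj du duv).
have [a' [b' [as' bs' Eab']]] : exists a b, [/\ 0 <= a <= s, 0 <= b <= s &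
    f (s *: v + s *: u + x) - f (s *: u + x) - (f (s *: v + x) - f x) =
    s * (s * 'D_u ('D_v f) (a *: v + b *: u + x))].
  apply: (@second_difference f v u x s s0) => a' b' as' bs'.
  rewrite [a' *: v + _]addrC.
  have [Uy _ _] := dN _ (inball b' a' bs' as').
  by have [_ dv _ dvu] := df _ Uy; exact: (conj dv dvu).
have E : 'D_v ('D_u f) (a *: u + b *: v + x) = 'D_u ('D_v f) (b' *: u + a' *: v + x).
  have sn : s != 0 by rewrite gt_eqF.
  rewrite [b' *: u + _]addrC; apply: (mulfI sn); apply: (mulfI sn).
  apply: etrans (esym Eab) (etrans _ Eab'); rewrite [s *: v + s *: u]addrC.
  exact: swap_difference.
have [_ h1 _] := dN _ (inball _ _ as_ bs).
have [_ _ h2] := dN _ (inball _ _ bs' as').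
rewrite E in h1.
exact: dist_le_split h1 h2.
Qed.

End Schwarz.

Local Opaque derive derivable jacobian.

(** * Derivatives of Jacobians *)

Section Smooth.
Variables (R : realType) (V : normedModType R) (U : set V).

Lemma smooth_on_differentiable (W : normedModType R) (f : V -> W) x :
  smooth_on U f -> U x -> differentiable f x.
Proof. by move=> sf; exact: (sf [::]). Qed.

Lemma smooth_on_derivable (W : normedModType R) (f : V -> W) x v :
  smooth_on U f -> U x -> derivable f x v.
Proof. by move=> sf Ux; apply/diff_derivable/smooth_on_differentiable. Qed.

Lemma smooth_on_derive (W : normedModType R) (f : V -> W) v :
  smooth_on U f -> smooth_on U ('D_v f).
Proof. by move=> sf vs x Ux; have := sf (rcons vs v) x Ux; rewrite foldr_rcons. Qed.

Hypothesis oU : open U.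

Lemma near_open x : U x -> \forall y \near x, U y.
Proof. by move=> Ux; exact: open_nbhs_nbhs. Qed.

(** [schwarz_real] for the entries. *)
Lemma smooth_on_schwarz p q (f : V -> 'M[R]_(p, q)) u v x :
  smooth_on U f -> U x -> 'D_v ('D_u f) x = 'D_u ('D_v f) x.
Proof.
move=> sf Ux; have sd w := smooth_on_derive w sf.
have sd2 w w' := smooth_on_derive w' (sd w).
have comp1 w y i j : U y -> 'D_w (fun z => f z i j) y = 'D_w f y i j.
  by move=> Uy; rewrite derive_entry //; exact: smooth_on_derivable.
have near1 w y i j : U y -> {near y, (fun z => 'D_w f z i j) =1 'D_w (fun z => f z i j)}.
  by move=> Uy; apply: filterS (near_open Uy) => z Uz; rewrite comp1.
have near1' w y i j : U y -> {near y, 'D_w (fun z => f z i j) =1 (fun z => 'D_w f z i j)}.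
  by move=> Uy; apply: filterS (near_open Uy) => z Uz; rewrite comp1.
have comp2 w w' y i j : U y ->
    'D_w' ('D_w (fun z => f z i j)) y = 'D_w' ('D_w f) y i j.
  move=> Uy; rewrite (near_eq_derive _ (near1' w y i j Uy)) derive_entry //.
  exact: smooth_on_derivable.
have dcomp2 w w' y i j : U y -> derivable ('D_w (fun z => f z i j)) y w'.
  move=> Uy; apply: near_eq_derivable (near1 w y i j Uy) _.
  by apply: derivable_entry; exact: smooth_on_derivable.
have ccomp w w' i j : {for x, continuous ('D_w' ('D_w (fun z => f z i j)))}.
  have c : {for x, continuous ('D_w' ('D_w f))}.
    by apply: differentiable_continuous; exact: smooth_on_differentiable.
  have c' : {for x, continuous (fun y => 'D_w' ('D_w f) y i j)}.
    apply: (@continuous_comp _ _ _ ('D_w' ('D_w f)) (fun A : 'M[R]_(p, q) => A i j)) => //.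
    exact: coord_continuous.
  suff c2 : 'D_w' ('D_w (fun z => f z i j)) y @[y --> x] --> 'D_w' ('D_w f) x i j.
    by move: c2; rewrite -comp2.
  apply: cvg_trans c'.
  apply: near_eq_cvg; apply: filterS (near_open Ux) => y Uy.
  by rewrite comp2.
apply/matrixP => i j; apply: etrans (esym (comp2 u v x i j Ux)) (etrans _ (comp2 v u x i j Ux)).
apply: (schwarz_real oU Ux _ (ccomp u v i j) (ccomp v u i j)) => y Uy.
split; [apply: derivable_entry; exact: smooth_on_derivable sf Uy
       |apply: derivable_entry; exact: smooth_on_derivable sf Uy
       |exact: dcomp2|exact: dcomp2].
Qed.

End Smooth.

Section Jacobian.
Variables (R : realType) (n m : nat) (U : set 'rV[R]_n) (F : 'rV[R]_n -> 'rV[R]_m).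
Hypotheses (oU : open U) (sF : smooth_on U F).
Implicit Types (u v w x : 'rV[R]_n).

Lemma derive_jacobian v x : U x -> 'D_v F x = v *m 'J F x.
Proof. by move=> Ux; apply: deriveEjacobian; exact: smooth_on_differentiable Ux. Qed.

Lemma near_derive_jacobian v x : U x -> {near x, 'D_v F =1 (fun y => v *m 'J F y)}.
Proof. by move=> Ux; apply: filterS (near_open oU Ux) => y; exact: derive_jacobian. Qed.

Lemma derivable_rows (A : 'rV[R]_n -> 'M[R]_(n, m)) x v :
  (forall u, derivable (fun y => u *m A y) x v) -> derivable A x v.
Proof.
move=> dA; apply/derivable_mxP => i j.
have -> : (fun y => A y i j) = (fun y => (delta_mx 0 i *m A y : 'rV[R]_m) 0 j).
  by apply/funext => y; rewrite -rowE mxE.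
exact: derivable_entry.
Qed.

Lemma derivable_jacobian x v : U x -> derivable (fun y => 'J F y) x v.
Proof.
move=> Ux; apply: derivable_rows => u.
apply: near_eq_derivable (near_derive_jacobian u Ux) _.
exact: smooth_on_derivable (smooth_on_derive u sF) Ux.
Qed.

Lemma mul_derive_jacobian u v x : U x ->
  u *m 'D_v (fun y => 'J F y) x = 'D_v ('D_u F) x.
Proof.
move=> Ux; have E1 := derive_mulmxl u (@derivable_jacobian x v Ux).
have E2 := near_eq_derive v (near_derive_jacobian u Ux).
exact: etrans (esym E1) (esym E2).
Qed.

Lemma derive_jacobian_sym u v x : U x ->
  u *m 'D_v (fun y => 'J F y) x = v *m 'D_u (fun y => 'J F y) x.
Proof.
move=> Ux; apply: etrans (mul_derive_jacobian u v Ux) _.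
exact: etrans (smooth_on_schwarz oU u v sF Ux) (esym (mul_derive_jacobian v u Ux)).
Qed.

Lemma near_mul_derive_jacobian u v x : U x ->
  {near x, 'D_v ('D_u F) =1 (fun y => u *m 'D_v (fun y => 'J F y) y)}.
Proof.
by move=> Ux; apply: filterS (near_open oU Ux) => y Uy; exact: esym (mul_derive_jacobian u v Uy).
Qed.

Lemma derivable_derive_jacobian x v w : U x ->
  derivable ('D_v (fun y => 'J F y)) x w.
Proof.
move=> Ux; apply: derivable_rows => u.
apply: near_eq_derivable (near_mul_derive_jacobian u v Ux) _.
exact: smooth_on_derivable (smooth_on_derive v (smooth_on_derive u sF)) Ux.
Qed.

Lemma derive2_jacobian_sym x v w : U x ->
  'D_w ('D_v (fun y => 'J F y)) x = 'D_v ('D_w (fun y => 'J F y)) x.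
Proof.
move=> Ux.
suff H u : u *m 'D_w ('D_v (fun y => 'J F y)) x = u *m 'D_v ('D_w (fun y => 'J F y)) x.
  apply/row_matrixP => i.
  exact: etrans (rowE _ _) (etrans (H _) (esym (rowE _ _))).
have E v' w' : u *m 'D_w' ('D_v' (fun y => 'J F y)) x = 'D_w' ('D_v' ('D_u F)) x.
  have E1 := derive_mulmxl u (@derivable_derive_jacobian x v' w' Ux).
  have E2 := near_eq_derive w' (near_mul_derive_jacobian u v' Ux).
  exact: etrans (esym E1) (esym E2).
have E3 := smooth_on_schwarz oU v w (smooth_on_derive u sF) Ux.
exact: etrans (E v w) (etrans E3 (esym (E w v))).
Qed.

End Jacobian.

(** * The equations of Gauss and Weingarten *)

Section Bracket.
Variables (R : realType) (V : normedModType R) (m : nat) (L : 'M[R]_m).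

Lemma derivable_bracket p q (A : V -> 'M[R]_(p, m)) (B : V -> 'M[R]_(q, m)) x v :
  derivable A x v -> derivable B x v ->
  derivable (fun y => A y *m L *m (B y)^T) x v.
Proof.
move=> dA dB; apply: (@derivable_mulmx R V p m q (fun y => A y *m L) (fun y => (B y)^T)).
  exact: derivable_mulmxr.
exact: derivable_trmx.
Qed.

Lemma derive_bracket p q (A : V -> 'M[R]_(p, m)) (B : V -> 'M[R]_(q, m)) x v :
  derivable A x v -> derivable B x v ->
  'D_v (fun y => A y *m L *m (B y)^T) x =
  'D_v A x *m L *m (B x)^T + A x *m L *m ('D_v B x)^T.
Proof.
move=> dA dB.
have E := @derive_mulmx R V p m q (fun y => A y *m L) (fun y => (B y)^T) x v
  (@derivable_mulmxr R V p m m A L x v dA) (derivable_trmx dB).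
apply: etrans E _.
by rewrite (@derive_mulmxr R V p m m A L x v dA) (derive_trmx dB).
Qed.

Lemma derive_locally_const (W : normedModType R) (U : set V) (A : V -> W) C x v :
  open U -> U x -> (forall y, U y -> A y = C) -> 'D_v A x = 0.
Proof.
move=> oU Ux AC; apply: etrans (derive_cst C x v); apply: near_eq_derive.
by apply: filterS (near_open oU Ux) => y Uy; rewrite AC.
Qed.

Lemma derive_bracket_const p q (U : set V) (A : V -> 'M[R]_(p, m)) (B : V -> 'M[R]_(q, m)) C x v :
  open U -> U x -> (forall y, U y -> A y *m L *m (B y)^T = C) ->
  derivable A x v -> derivable B x v ->
  'D_v A x *m L *m (B x)^T = - (A x *m L *m ('D_v B x)^T).
Proof.
move=> oU Ux AC dA dB; apply/eqP; rewrite -addr_eq0; apply/eqP.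
apply: etrans (esym (derive_bracket dA dB)) _.
exact: (@derive_locally_const _ U _ C).
Qed.
End Bracket.

Section LocalHypersurface.
Variables (R : realType) (n : nat) (U : set 'rV[R]_n) (F N : 'rV[R]_n -> 'rV[R]_n.+2).
Variable L : 'M[R]_n.+2.

(** [F] parametrizes a spacelike hypersurface of the unit hyperboloid of the
    nondegenerate form [L], with unit normal [N]. *)
Record hypersurface : Prop := Hypersurface {
  hyp_open : open U;
  hyp_smooth : smooth_on U F;
  hyp_smooth_normal : smooth_on U N;
  hyp_form_sym : L^T = L;
  hyp_form_unit : L \in unitmx;
  hyp_hyperboloid : forall y, U y -> F y *m L *m (F y)^T = (- 1)%:M;
  hyp_normal_unit : forall y, U y -> N y *m L *m (N y)^T = 1%:M;
  hyp_normal_point : forall y, U y -> N y *m L *m (F y)^T = 0;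
  hyp_normal_tangent : forall y, U y -> N y *m L *m ('J F y)^T = 0;
  hyp_spacelike : forall y, U y -> forall v : 'rV[R]_n, v != 0 ->
    0 < (v *m ('J F y *m L *m ('J F y)^T) *m v^T) 0 0 }.

Definition tangent_mx y : 'M[R]_(n, n.+2) := 'J F y.
Definition dnormal_mx y : 'M[R]_(n, n.+2) := 'J N y.
Definition metric_mx y := tangent_mx y *m L *m (tangent_mx y)^T.
Definition sff_mx y := - (dnormal_mx y *m L *m (tangent_mx y)^T).
Definition shape_mx y := sff_mx y *m invmx (metric_mx y).
Definition hess_mx v y : 'M[R]_n := 'D_v tangent_mx y *m L *m (tangent_mx y)^T.
Definition connection_mx v y := hess_mx v y *m invmx (metric_mx y).

Hypothesis HS : hypersurface.
Let oU := hyp_open HS.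
Implicit Types (x v u w : 'rV[R]_n).

Lemma form_bracketC p q (A : 'M[R]_(p, n.+2)) (B : 'M[R]_(q, n.+2)) :
  (A *m L *m B^T)^T = B *m L *m A^T.
Proof. by rewrite trmx_mul trmxK trmx_mul (hyp_form_sym HS) mulmxA. Qed.

Lemma derivable_point x v : U x -> derivable F x v.
Proof. exact: smooth_on_derivable (hyp_smooth HS). Qed.
Lemma derivable_normal x v : U x -> derivable N x v.
Proof. exact: smooth_on_derivable (hyp_smooth_normal HS). Qed.
Lemma derivable_tangent x v : U x -> derivable tangent_mx x v.
Proof. exact: (derivable_jacobian oU (hyp_smooth HS)). Qed.
Lemma derivable_dnormal x v : U x -> derivable dnormal_mx x v.
Proof. exact: (derivable_jacobian oU (hyp_smooth_normal HS)). Qed.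
Lemma derive_point x v : U x -> 'D_v F x = v *m tangent_mx x.
Proof. exact: (derive_jacobian (hyp_smooth HS)). Qed.
Lemma derive_normal x v : U x -> 'D_v N x = v *m dnormal_mx x.
Proof. exact: (derive_jacobian (hyp_smooth_normal HS)). Qed.
Lemma derivable_dtangent x v w : U x -> derivable ('D_v tangent_mx) x w.
Proof. exact: (derivable_derive_jacobian oU (hyp_smooth HS)). Qed.
Lemma derivable_ddnormal x v w : U x -> derivable ('D_v dnormal_mx) x w.
Proof. exact: (derivable_derive_jacobian oU (hyp_smooth_normal HS)). Qed.
Lemma dtangent_sym u v x : U x -> u *m 'D_v tangent_mx x = v *m 'D_u tangent_mx x.
Proof. exact: (derive_jacobian_sym oU (hyp_smooth HS)). Qed.
Lemma ddnormal_sym u v x : U x -> u *m 'D_v dnormal_mx x = v *m 'D_u dnormal_mx x.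
Proof. exact: (derive_jacobian_sym oU (hyp_smooth_normal HS)). Qed.
Lemma d2tangent_sym x v w : U x -> 'D_w ('D_v tangent_mx) x = 'D_v ('D_w tangent_mx) x.
Proof. exact: (derive2_jacobian_sym oU (hyp_smooth HS)). Qed.
Lemma d2dnormal_sym x v w : U x -> 'D_w ('D_v dnormal_mx) x = 'D_v ('D_w dnormal_mx) x.
Proof. exact: (derive2_jacobian_sym oU (hyp_smooth_normal HS)). Qed.

Lemma mulmx_rowI p q (A B : 'M[R]_(p, q)) : (forall v : 'rV_p, v *m A = v *m B) -> A = B.
Proof. by move=> AB; apply/row_matrixP => i; rewrite !rowE. Qed.

Lemma self_opp0 p q (A : 'M[R]_(p, q)) : A = - A -> A = 0.
Proof.
move=> /eqP; rewrite -addr_eq0 -mulr2n -scaler_nat scaler_eq0 pnatr_eq0 /=.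
by move/eqP.
Qed.

Lemma tangent_point x : U x -> tangent_mx x *m L *m (F x)^T = 0.
Proof.
move=> Ux; apply: mulmx_rowI => v; rewrite mulmx0 !mulmxA.
have := derive_bracket_const oU Ux (hyp_hyperboloid HS)
  (@derivable_point x v Ux) (@derivable_point x v Ux).
rewrite derive_point // => E; apply: self_opp0; rewrite {1}E; congr (- _).
by rewrite -[LHS]mx11_trmx form_bracketC.
Qed.

Lemma dnormal_normal x : U x -> dnormal_mx x *m L *m (N x)^T = 0.
Proof.
move=> Ux; apply: mulmx_rowI => v; rewrite mulmx0 !mulmxA.
have := derive_bracket_const oU Ux (hyp_normal_unit HS)
  (@derivable_normal x v Ux) (@derivable_normal x v Ux).
rewrite derive_normal // => E; apply: self_opp0; rewrite {1}E; congr (- _).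
by rewrite -[LHS]mx11_trmx form_bracketC.
Qed.

Lemma tangent_normal x : U x -> tangent_mx x *m L *m (N x)^T = 0.
Proof. by move=> Ux; rewrite -form_bracketC (hyp_normal_tangent HS) // trmx0. Qed.

Lemma dnormal_point x : U x -> dnormal_mx x *m L *m (F x)^T = 0.
Proof.
move=> Ux; apply: mulmx_rowI => v; rewrite mulmx0 !mulmxA.
have := derive_bracket_const oU Ux (hyp_normal_point HS)
  (@derivable_normal x v Ux) (@derivable_point x v Ux).
rewrite derive_point // derive_normal // trmx_mul mulmxA.
by rewrite [N x *m L *m _](hyp_normal_tangent HS) // mul0mx oppr0.
Qed.

Lemma dtangent_normal x v : U x -> 'D_v tangent_mx x *m L *m (N x)^T = (v *m sff_mx x)^T.
Proof.
move=> Ux; have := derive_bracket_const oU Ux (hyp_normal_tangent HS)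
  (@derivable_normal x v Ux) (@derivable_tangent x v Ux).
rewrite derive_normal // -[N x *m L *m _]form_bracketC => E.
rewrite /sff_mx mulmxN !mulmxA E opprK trmxK //.
Qed.

(** The bracket of the symmetric second derivative of [F] with [N]. *)
Lemma sff_sym x : U x -> (sff_mx x)^T = sff_mx x.
Proof.
move=> Ux; apply: mulmx_rowI => u; apply: trmx_inj; apply: mulmx_rowI => v.
have -> : v *m (u *m (sff_mx x)^T)^T = u *m (v *m sff_mx x)^T.
  by rewrite -[LHS]mx11_trmx !trmx_mul !trmxK mulmxA.
rewrite -(dtangent_normal u Ux) -(dtangent_normal v Ux) !mulmxA.
by rewrite (dtangent_sym u v Ux).
Qed.

Lemma dtangent_point x v : U x -> 'D_v tangent_mx x *m L *m (F x)^T = - (metric_mx x *m v^T).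
Proof.
move=> Ux; have := derive_bracket_const oU Ux tangent_point
  (@derivable_tangent x v Ux) (@derivable_point x v Ux).
by rewrite derive_point // trmx_mul mulmxA.
Qed.

Lemma ddnormal_point x v : U x -> 'D_v dnormal_mx x *m L *m (F x)^T = sff_mx x *m v^T.
Proof.
move=> Ux; have := derive_bracket_const oU Ux dnormal_point
  (@derivable_dnormal x v Ux) (@derivable_point x v Ux).
by rewrite derive_point // trmx_mul mulmxA /sff_mx mulNmx.
Qed.

Lemma metric_sym x : (metric_mx x)^T = metric_mx x.
Proof. exact: form_bracketC. Qed.

Lemma metric_unit x : U x -> metric_mx x \in unitmx.
Proof.
move=> Ux; rewrite -row_free_unit -kermx_eq0; apply/rowV0P => v /sub_kermxP v0.
apply/eqP; apply: contraT => /(hyp_spacelike HS Ux).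
by rewrite -/(metric_mx x) v0 mul0mx mxE ltxx.
Qed.

Lemma invmx_metric_sym x : (invmx (metric_mx x))^T = invmx (metric_mx x).
Proof. by rewrite trmx_inv metric_sym. Qed.

Lemma shape_metric x : U x -> shape_mx x *m metric_mx x = sff_mx x.
Proof. by move=> Ux; rewrite mulmxKV // metric_unit. Qed.

Lemma connection_metric x v : U x -> connection_mx v x *m metric_mx x = hess_mx v x.
Proof. by move=> Ux; rewrite mulmxKV // metric_unit. Qed.

Lemma trmx_shape x : U x -> (shape_mx x)^T = invmx (metric_mx x) *m sff_mx x.
Proof. by move=> Ux; rewrite trmx_mul sff_sym // invmx_metric_sym. Qed.

Lemma metric_trmx_shape x : U x -> metric_mx x *m (shape_mx x)^T = sff_mx x.
Proof. by move=> Ux; rewrite trmx_shape // mulKVmx // metric_unit. Qed.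

(** The tangent vectors together with the normal and the position vector form a
    frame of the ambient space, as their Gram matrix is invertible. *)
Lemma frame_orthogonal_eq0 p (c : 'M[R]_(p, n.+2)) x : U x ->
  c *m L *m (tangent_mx x)^T = 0 -> c *m L *m (N x)^T = 0 -> c *m L *m (F x)^T = 0 -> c = 0.
Proof.
move=> Ux cJ cN cF; pose B := col_mx (tangent_mx x) (col_mx (N x) (F x)).
have fB : row_free B.
  rewrite -kermx_eq0; apply/rowV0P => w /sub_kermxP.
  rewrite -[w]hsubmxK -[rsubmx w]hsubmxK /B !mul_row_col.
  set a := lsubmx w; set b := lsubmx _; set e := rsubmx _ => E.
  have EL q (D : 'M[R]_(q, n.+2)) :
      a *m (tangent_mx x *m L *m D^T) + (b *m (N x *m L *m D^T) + e *m (F x *m L *m D^T)) = 0.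
    by rewrite !mulmxA -!mulmxDl E !mul0mx.
  have a0 : a = 0.
    have := EL _ (tangent_mx x).
    rewrite (hyp_normal_tangent HS Ux) -[F x *m L *m _]form_bracketC (tangent_point Ux).
    rewrite trmx0 !mulmx0 !addr0 => /(congr1 (mulmxr (invmx (metric_mx x)))).
    by rewrite /= mul0mx mulmxK // metric_unit.
  have b0 : b = 0.
    have := EL _ (N x).
    rewrite (hyp_normal_unit HS Ux) -[F x *m L *m _]form_bracketC (hyp_normal_point HS Ux).
    by rewrite a0 mul0mx trmx0 mulmx0 mulmx1 add0r addr0.
  have e0 : e = 0.
    have := EL _ (F x).
    rewrite (hyp_hyperboloid HS Ux) a0 b0 !mul0mx !add0r mul_mx_scalar scaleN1r.
    by move/eqP; rewrite oppr_eq0 => /eqP.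
  by rewrite a0 b0 e0 !row_mx0.
have /row_fullP [X XB] : row_full B by rewrite /row_full (eqP fB) addn2.
have cLB : c *m L *m B^T = 0 by rewrite !tr_col_mx !mul_mx_row cJ cN cF !row_mx0.
have cL : c *m L = 0.
  by rewrite -[c *m L]mulmx1 -trmx1 -XB trmx_mul mulmxA cLB mul0mx.
by rewrite -[c](mulmxK (hyp_form_unit HS)) cL mul0mx.
Qed.

(** The difference is orthogonal to the frame. The position vector comes with a
    minus sign because [<F, F> = -1]. *)
Lemma frame_expansion p (c : 'M[R]_(p, n.+2)) x : U x ->
  c = c *m L *m (tangent_mx x)^T *m invmx (metric_mx x) *m tangent_mx x
      + c *m L *m (N x)^T *m N x - c *m L *m (F x)^T *m F x.
Proof.
move=> Ux; apply/eqP; rewrite -subr_eq0; apply/eqP.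
have NJ := hyp_normal_tangent HS Ux; have NF := hyp_normal_point HS Ux.
have FJ : F x *m L *m (tangent_mx x)^T = 0 by rewrite -form_bracketC tangent_point ?trmx0.
have FN : F x *m L *m (N x)^T = 0 by rewrite -form_bracketC NF trmx0.
apply: (frame_orthogonal_eq0 Ux);
  rewrite opprD opprK opprD !mulmxDl !mulNmx.
- rewrite -![_ *m tangent_mx x *m L]mulmxA -![_ *m (tangent_mx x *m L) *m _]mulmxA.
  rewrite -/(metric_mx x) mulmxKV ?metric_unit //.
  rewrite -![_ *m N x *m L]mulmxA -![_ *m (N x *m L) *m _]mulmxA NJ.
  rewrite -![_ *m F x *m L]mulmxA -![_ *m (F x *m L) *m _]mulmxA FJ.
  by rewrite !mulmx0 oppr0 !addr0 subrr.
- rewrite -![_ *m tangent_mx x *m L]mulmxA -![_ *m (tangent_mx x *m L) *m _]mulmxA.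
  rewrite -![_ *m N x *m L]mulmxA -![_ *m (N x *m L) *m _]mulmxA.
  rewrite -![_ *m F x *m L]mulmxA -![_ *m (F x *m L) *m _]mulmxA.
  rewrite (tangent_normal Ux) FN (hyp_normal_unit HS Ux).
  by rewrite !mulmx0 mulmx1 oppr0 addr0 add0r subrr.
- rewrite -![_ *m tangent_mx x *m L]mulmxA -![_ *m (tangent_mx x *m L) *m _]mulmxA.
  rewrite -![_ *m N x *m L]mulmxA -![_ *m (N x *m L) *m _]mulmxA.
  rewrite -![_ *m F x *m L]mulmxA -![_ *m (F x *m L) *m _]mulmxA.
  rewrite (tangent_point Ux) NF (hyp_hyperboloid HS Ux).
  by rewrite !mulmx0 mul_mx_scalar scaleN1r oppr0 !add0r subrr.
Qed.

(** The derivatives of [N] have no component along [N] or [F]. *)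
Lemma weingarten x : U x -> dnormal_mx x = - (shape_mx x *m tangent_mx x).
Proof.
move=> Ux; rewrite [LHS](frame_expansion _ Ux) dnormal_normal // dnormal_point //.
by rewrite !mul0mx subr0 addr0 /shape_mx /sff_mx !mulNmx opprK.
Qed.

(** The component of the second derivatives of [F] along the normal is the second
    fundamental form, the one along [F] the metric, by differentiating
    [<J, N> = 0] and [<J, F> = 0]. *)
Lemma gauss_formula x v : U x ->
  'D_v tangent_mx x = connection_mx v x *m tangent_mx x + sff_mx x *m v^T *m N x
    + metric_mx x *m v^T *m F x.
Proof.
move=> Ux; rewrite [LHS](frame_expansion _ Ux) dtangent_normal // dtangent_point //.
by rewrite trmx_mul sff_sym // [- (metric_mx x *m _) *m _]mulNmx opprK.
Qed.

Lemma derivable_metric x v : U x -> derivable metric_mx x v.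
Proof.
by move=> Ux; exact: derivable_bracket (@derivable_tangent x v Ux) (@derivable_tangent x v Ux).
Qed.

Lemma derivable_sff x v : U x -> derivable sff_mx x v.
Proof.
move=> Ux; apply: derivableN.
exact: derivable_bracket (@derivable_dnormal x v Ux) (@derivable_tangent x v Ux).
Qed.

Lemma near_metric_unit x : U x -> \forall y \near x, metric_mx y \in unitmx.
Proof. by move=> Ux; apply: filterS (near_open oU Ux) => y; exact: metric_unit. Qed.

Lemma derivable_invmx_metric x v : U x -> derivable (fun y => invmx (metric_mx y)) x v.
Proof.
by move=> Ux; apply: derivable_invmx (@derivable_metric x v Ux) _; exact: near_metric_unit.
Qed.

Lemma derivable_shape x v : U x -> derivable shape_mx x v.
Proof.
by move=> Ux; exact: derivable_mulmx (@derivable_sff x v Ux) (@derivable_invmx_metric x v Ux).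
Qed.

Lemma derivable_hess x u v : U x -> derivable (hess_mx u) x v.
Proof.
by move=> Ux; exact: derivable_bracket (@derivable_dtangent x u v Ux) (@derivable_tangent x v Ux).
Qed.

Lemma derivable_connection x u v : U x -> derivable (connection_mx u) x v.
Proof.
by move=> Ux; exact: derivable_mulmx (@derivable_hess x u v Ux) (@derivable_invmx_metric x v Ux).
Qed.

Lemma derive_metric x v : U x -> 'D_v metric_mx x = hess_mx v x + (hess_mx v x)^T.
Proof.
move=> Ux; apply: etrans (derive_bracket L (@derivable_tangent x v Ux) (@derivable_tangent x v Ux)) _.
by rewrite form_bracketC.
Qed.
End LocalHypersurface.

(** * Curvature of the induced metric *)

Section GaussEquation.
Variables (R : realType) (n : nat) (U : set 'rV[R]_n) (F N : 'rV[R]_n -> 'rV[R]_n.+2).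
Variable L : 'M[R]_n.+2.
Hypothesis HS : hypersurface U F N L.
Let oU := hyp_open HS.
Implicit Types (x v u w : 'rV[R]_n).
Local Notation tangent := (tangent_mx F).
Local Notation dnormal := (dnormal_mx N).
Local Notation metric := (metric_mx F L).
Local Notation sff := (sff_mx F N L).
Local Notation shape := (shape_mx F N L).
Local Notation hess := (hess_mx F L).
Local Notation connection := (connection_mx F L).

Lemma d2tangent_bracket u v x : U x ->
  'D_u ('D_v tangent) x *m L *m (tangent x)^T =
  ('D_u (connection v) x + connection v x *m connection u x) *m metric x
  - sff x *m v^T *m (u *m sff x) + metric x *m v^T *m (u *m metric x).
Proof.
move=> Ux.
pose A1 := fun y => connection v y *m tangent y.
pose A2 := fun y => sff y *m v^T *m N y.
pose A3 := fun y => metric y *m v^T *m F y.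
have E0 : 'D_u ('D_v tangent) x = 'D_u (A1 + A2 + A3) x.
  apply: near_eq_derive; apply: filterS (near_open oU Ux) => y Uy.
  exact: (gauss_formula HS v Uy).
have dJ := @derivable_tangent _ _ _ _ _ _ HS x u Ux.
have dN := @derivable_normal _ _ _ _ _ _ HS x u Ux.
have dF := @derivable_point _ _ _ _ _ _ HS x u Ux.
have dc := @derivable_connection _ _ _ _ _ _ HS x v u Ux.
have dh := @derivable_sff _ _ _ _ _ _ HS x u Ux.
have dg := @derivable_metric _ _ _ _ _ _ HS x u Ux.
have dhv := @derivable_mulmxr _ _ _ _ _ sff v^T x u dh.
have dgv := @derivable_mulmxr _ _ _ _ _ metric v^T x u dg.
have d1 : derivable A1 x u := derivable_mulmx dc dJ.
have d2 : derivable A2 x u := derivable_mulmx dhv dN.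
have d3 : derivable A3 x u := derivable_mulmx dgv dF.
have E1 : 'D_u A1 x = 'D_u (connection v) x *m tangent x + connection v x *m 'D_u tangent x.
  exact: derive_mulmx dc dJ.
have E2 : 'D_u A2 x = 'D_u (fun y => sff y *m v^T) x *m N x + sff x *m v^T *m (u *m dnormal x).
  by rewrite -(derive_normal HS u Ux); exact: derive_mulmx dhv dN.
have E3 : 'D_u A3 x = 'D_u (fun y => metric y *m v^T) x *m F x + metric x *m v^T *m (u *m tangent x).
  by rewrite -(derive_point HS u Ux); exact: derive_mulmx dgv dF.
have E4 : 'D_u (A1 + A2 + A3) x = 'D_u A1 x + 'D_u A2 x + 'D_u A3 x.
  by rewrite (deriveD (derivableD d1 d2) d3) (deriveD d1 d2).
rewrite E0 E4 E1 E2 E3.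
have NJ : N x *m L *m (tangent x)^T = 0 := hyp_normal_tangent HS Ux.
have FJ : F x *m L *m (tangent x)^T = 0.
  by rewrite -(form_bracketC HS) (tangent_point HS Ux) trmx0.
have KJ : dnormal x *m L *m (tangent x)^T = - sff x by rewrite /sff opprK.
have HJ : 'D_u tangent x *m L *m (tangent x)^T = connection u x *m metric x.
  by rewrite (connection_metric HS u Ux).
have JJ : tangent x *m L *m (tangent x)^T = metric x by [].
move: (sff x) (metric x) (connection v x) (connection u x) (tangent x) (dnormal x)
  (F x) (N x) ('D_u (fun y => sff y *m v^T) x) ('D_u (fun y => metric y *m v^T) x)
  ('D_u (connection v) x) ('D_u tangent x) NJ FJ KJ HJ JJ.
move=> h g Gv Gu J K f nu B C Dc DJ NJ FJ KJ HJ JJ.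
rewrite -[LHS]mulmxA; rewrite -!mulmxA in NJ FJ KJ HJ JJ.
move: (L *m J^T) NJ FJ KJ HJ JJ => M NJ FJ KJ HJ JJ.
by rewrite !mulmxDl -!mulmxA NJ FJ KJ HJ JJ !mulmx0 !add0r !mulmxN.
Qed.

Lemma gauss_equation_algebra (Du Dv Gu Gv g h S : 'M[R]_n) (u v : 'rV[R]_n) :
  g \in unitmx -> S *m g = h ->
  (Du + Gv *m Gu) *m g - h *m v^T *m (u *m h) + g *m v^T *m (u *m g) =
  (Dv + Gu *m Gv) *m g - h *m u^T *m (v *m h) + g *m u^T *m (v *m g) ->
  Du - Dv + (Gv *m Gu - Gu *m Gv) =
  h *m v^T *m (u *m S) - h *m u^T *m (v *m S) - (g *m v^T *m u - g *m u^T *m v).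
Proof.
move=> gu Sg E; apply: (can_inj (mulmxK gu)).
rewrite !(mulmxDl, mulNmx) -!mulmxA Sg; rewrite !(mulmxDl, mulNmx) -!mulmxA in E.
move: (Du *m g) (Gv *m _) (Dv *m g) (Gu *m _) (h *m _) (h *m (u^T *m _))
  (g *m _) (g *m (u^T *m _)) E => a b a' b' c c' d d' E.
apply/matrixP => i j; move/matrixP/(_ i j): E; rewrite !mxE; lra.
Qed.

(** The tangential part of the equality of the mixed third derivatives of [F],
    computed with [gauss_formula] and [weingarten]. *)
Lemma gauss_equation u v x : U x ->
  'D_u (connection v) x - 'D_v (connection u) x
    + (connection v x *m connection u x - connection u x *m connection v x) =
  sff x *m v^T *m (u *m shape x) - sff x *m u^T *m (v *m shape x)
  - (metric x *m v^T *m u - metric x *m u^T *m v).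
Proof.
move=> Ux; have gu := metric_unit HS Ux.
have Euv := d2tangent_bracket u v Ux; have Evu := d2tangent_bracket v u Ux.
have E : ('D_u (connection v) x + connection v x *m connection u x) *m metric x
    - sff x *m v^T *m (u *m sff x) + metric x *m v^T *m (u *m metric x) =
    ('D_v (connection u) x + connection u x *m connection v x) *m metric x
    - sff x *m u^T *m (v *m sff x) + metric x *m u^T *m (v *m metric x).
  have Es := congr1 (fun A => A *m L *m (tangent x)^T) (d2tangent_sym HS v u Ux).
  exact: etrans (esym Euv) (etrans Es Evu).
have Sg := shape_metric HS Ux.
exact: (gauss_equation_algebra gu Sg E).
Qed.

Lemma hess_sym u v x : U x -> u *m hess v x = v *m hess u x.
Proof. by move=> Ux; rewrite /hess !mulmxA (dtangent_sym HS u v Ux). Qed.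

Lemma delta_mulmx_entry p q (A B : 'M[R]_(p, q)) i j l :
  (delta_mx 0 j : 'rV_p) *m A = delta_mx 0 i *m B -> A j l = B i l.
Proof. by rewrite -!rowE => /rowP /(_ l); rewrite !mxE. Qed.

Lemma hess_entry_sym i j l x : U x ->
  hess (delta_mx 0 i) x j l = hess (delta_mx 0 j) x i l.
Proof.
by move=> Ux; exact: (delta_mulmx_entry l (hess_sym (delta_mx 0 j) (delta_mx 0 i) Ux)).
Qed.

Local Opaque hess_mx connection_mx metric_mx sff_mx shape_mx.

Lemma koszul_algebra (H : 'I_n -> 'M[R]_n) (B : 'M[R]_n) i j k :
  (forall a b c, H a b c = H b a c) -> B^T = B ->
  2^-1 * \sum_l B k l *
    ((H i j l + H i l j) + (H j i l + H j l i) - (H l i j + H l j i)) = (H i *m B) j k.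
Proof.
move=> Hs Bs; rewrite mulr_sumr mxE; apply: eq_bigr => l _.
rewrite [H i l j]Hs [H j l i]Hs [H j i l]Hs -[in LHS]Bs [B^T k l]mxE.
by field.
Qed.

Lemma partial_metric a b c x : U x -> partial a (fun y => metric y b c) x =
  hess (delta_mx 0 a) x b c + hess (delta_mx 0 a) x c b.
Proof.
move=> Ux.
have E1 := derive_entry b c (@derivable_metric _ _ _ _ _ _ HS x (delta_mx 0 a) Ux).
have E2 := congr1 (fun A : 'M[R]_n => A b c) (derive_metric HS (delta_mx 0 a) Ux).
apply: etrans (esym E1) (etrans E2 _).
by move: (hess _ x) => A; rewrite !mxE.
Qed.

(** The Koszul formula: the Levi-Civita connection is the tangential part of the
    ambient derivative. *)
Lemma christoffel_metric i j k x : U x ->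
  christoffel metric i j k x = connection (delta_mx 0 i) x j k.
Proof.
move=> Ux.
have E := @koszul_algebra (fun a => hess (delta_mx 0 a) x) (invmx (metric x)) i j k
  (fun a b c => hess_entry_sym a b c Ux) (invmx_metric_sym HS x).
apply: etrans _ E; congr (_ * _); apply: eq_bigr => l _; congr (_ * (_ + _ - _)).
- exact: partial_metric.
- exact: partial_metric.
- exact: partial_metric.
Qed.

Lemma partial_christoffel a b k l x : U x ->
  partial a (christoffel metric b k l) x =
    'D_(delta_mx 0 a) (connection (delta_mx 0 b)) x k l.
Proof.
move=> Ux.
have E := derive_entry k l
  (@derivable_connection _ _ _ _ _ _ HS x (delta_mx 0 b) (delta_mx 0 a) Ux).
apply: etrans _ (esym E).
apply: near_eq_derive; apply: filterS (near_open oU Ux) => y Uy.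
exact: christoffel_metric.
Qed.

Lemma riemann_algebra (Du Dv Gu Gv g h S : 'M[R]_n) i j k l :
  Du - Dv + (Gv *m Gu - Gu *m Gv) =
  h *m (delta_mx 0 j)^T *m ((delta_mx 0 i : 'rV_n) *m S)
  - h *m (delta_mx 0 i)^T *m ((delta_mx 0 j : 'rV_n) *m S)
  - (g *m (delta_mx 0 j)^T *m (delta_mx 0 i : 'rV_n)
     - g *m (delta_mx 0 i)^T *m (delta_mx 0 j : 'rV_n)) ->
  Du k l - Dv k l + \sum_m (Gv k m * Gu m l - Gu k m * Gv m l) =
  h k j * S i l - h k i * S j l - (g k j * (i == l)%:R - g k i * (j == l)%:R).
Proof.
have col1 (A : 'M[R]_n) (B : 'rV_n) a : (A *m (delta_mx 0 a)^T *m B) k l = A k a * B 0 l.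
  rewrite trmx_delta -colE mxE big_ord1 !mxE.
  by [].
have addE (A B : 'M[R]_n) : (A + B) k l = A k l + B k l by rewrite mxE.
have oppE (A : 'M[R]_n) : (- A) k l = - A k l by rewrite mxE.
have rowE' (A : 'M[R]_n) a : ((delta_mx 0 a : 'rV_n) *m A) 0 l = A a l.
  by rewrite -rowE mxE.
have deltaE a : (delta_mx 0 a : 'rV[R]_n) 0 l = (a == l)%:R by rewrite mxE eqxx eq_sym.
have sumE : \sum_m (Gv k m * Gu m l - Gu k m * Gv m l) =
    (Gv *m Gu) k l - (Gu *m Gv) k l by rewrite sumrB !mxE.
move/matrixP/(_ k l); rewrite sumE !(addE, oppE) !col1 !rowE' !deltaE.
by [].
Qed.

(** The Christoffel symbols are the entries of [connection], so the left hand side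
    of [gauss_equation] is the Riemann tensor. *)
Lemma riemann_metric i j k l x : U x ->
  riemann metric i j k l x =
  sff x k j * shape x i l - sff x k i * shape x j l
  - (metric x k j * (i == l)%:R - metric x k i * (j == l)%:R).
Proof.
move=> Ux.
have E := riemann_algebra k l (gauss_equation (delta_mx 0 i) (delta_mx 0 j) Ux).
apply: etrans _ E; congr (_ - _ + _).
- exact: partial_christoffel.
- exact: partial_christoffel.
apply: eq_bigr => m _; congr (_ * _ - _ * _); exact: christoffel_metric.
Qed.

Lemma ricci_metric x : U x ->
  ricci metric x = \tr (shape x) *: sff x - shape x *m sff x - (n%:R - 1) *: metric x.
Proof.
move=> Ux; apply/matrixP => j k; rewrite mxE.
have hs := sff_sym HS Ux.
have E i : riemann metric i j k i x = shape x i i * sff x k j - shape x j i * sff x k i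
   - (metric x k j - metric x k i * (j == i)%:R).
  apply: etrans (riemann_metric i j k i Ux) _.
  by rewrite eqxx mulr1 [sff x k j * _]mulrC [sff x k i * _]mulrC.
apply: etrans (eq_bigr _ (fun i _ => E i)) _.
have gs := metric_sym HS x.
move: (sff x) (shape x) (metric x) hs gs => h S g hs gs {E}.
have -> : \sum_i (S i i * h k j - S j i * h k i - (g k j - g k i * (j == i)%:R)) =
    (\sum_i S i i) * h k j - (\sum_i S j i * h k i) - (n%:R * g k j - g k j).
  rewrite !sumrB -mulr_suml sumr_const card_ord; congr (_ - (_ - _)).
    by rewrite mulr_natl.
  rewrite (bigD1 j) //= eqxx mulr1 big1 ?addr0 // => i ij.
  by rewrite eq_sym (negPf ij) mulr0.
have -> : \sum_i S j i * h k i = (S *m h) j k.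
  by rewrite mxE; apply: eq_bigr => i _; rewrite -[in RHS]hs [h^T i k]mxE.
have -> : h k j = h j k by rewrite -[in LHS]hs mxE.
have -> : g k j = g j k by rewrite -[in LHS]gs mxE.
rewrite !mxE /mxtrace; ring.
Qed.

(** Raise an index in the trace of the Gauss equation; the term [n - 1] comes from
    the curvature -1 of the hyperbolic space. *)
Lemma ricci_operator_metric x : U x ->
  raise_index (metric x) (ricci metric x) =
  \tr (shape x) *: shape x - shape x *m shape x - (n%:R - 1)%:M.
Proof.
move=> Ux; rewrite /raise_index (ricci_metric Ux) !mulmxDl !mulNmx -!scalemxAl.
rewrite mulmxV ?(metric_unit HS Ux) // scalemx1.
by rewrite -mulmxA.
Qed.

Lemma bilinear_sum (A : 'M[R]_n) (v w : 'rV[R]_n) :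
  (v *m A *m w^T) 0 0 = \sum_j \sum_k w 0 j * v 0 k * A k j.
Proof.
rewrite mxE; apply: eq_bigr => j _; rewrite !mxE mulr_suml.
by apply: eq_bigr => k _; ring.
Qed.

Lemma curvature_contraction (h g S : 'M[R]_n) (X Y : 'rV[R]_n) l :
  \sum_i \sum_j \sum_k X 0 i * Y 0 j * Y 0 k *
    (h k j * S i l - h k i * S j l - (g k j * (i == l)%:R - g k i * (j == l)%:R)) =
  (Y *m h *m Y^T) 0 0 * (X *m S) 0 l - (Y *m h *m X^T) 0 0 * (Y *m S) 0 l
  - ((Y *m g *m Y^T) 0 0 * X 0 l - (Y *m g *m X^T) 0 0 * Y 0 l).
Proof.
have deltaE (Z : 'rV[R]_n) : Z 0 l = \sum_i Z 0 i * (i == l)%:R.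
  rewrite (bigD1 l) //= eqxx mulr1 big1 ?addr0 // => i il.
  by rewrite (negPf il) mulr0.
have T1 (A : 'M[R]_n) (b : 'I_n -> R) :
    \sum_i \sum_j \sum_k X 0 i * Y 0 j * Y 0 k * (A k j * b i) =
    (Y *m A *m Y^T) 0 0 * \sum_i X 0 i * b i.
  rewrite bilinear_sum mulrC mulr_suml; apply: eq_bigr => i _.
  rewrite mulr_sumr; apply: eq_bigr => j _; rewrite mulr_sumr; apply: eq_bigr => k _; ring.
have T2 (A : 'M[R]_n) (b : 'I_n -> R) :
    \sum_i \sum_j \sum_k X 0 i * Y 0 j * Y 0 k * (A k i * b j) =
    (Y *m A *m X^T) 0 0 * \sum_i Y 0 i * b i.
  rewrite exchange_big bilinear_sum mulrC mulr_suml; apply: eq_bigr => i _.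
  rewrite mulr_sumr; apply: eq_bigr => j _; rewrite mulr_sumr; apply: eq_bigr => k _; ring.
rewrite [X 0 l]deltaE [Y 0 l]deltaE ![(_ *m S) 0 l]mxE.
rewrite -!T1 -!T2 -!sumrB; apply: eq_bigr => i _; rewrite -!sumrB; apply: eq_bigr => j _.
rewrite -!sumrB; apply: eq_bigr => k _; ring.
Qed.

Lemma curvature_plane_algebra (h g S : 'M[R]_n) (X Y : 'rV[R]_n) (Z : 'rV[R]_n) :
  S *m g = h -> h^T = h -> g^T = g ->
  (forall l, Z 0 l = (Y *m h *m Y^T) 0 0 * (X *m S) 0 l - (Y *m h *m X^T) 0 0 * (Y *m S) 0 l
  - ((Y *m g *m Y^T) 0 0 * X 0 l - (Y *m g *m X^T) 0 0 * Y 0 l)) ->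
  (Z *m g *m X^T) 0 0 =
  (X *m h *m X^T) 0 0 * (Y *m h *m Y^T) 0 0 - (X *m h *m Y^T) 0 0 ^+ 2 -
  ((X *m g *m X^T) 0 0 * (Y *m g *m Y^T) 0 0 - (X *m g *m Y^T) 0 0 ^+ 2).
Proof.
move=> Sg hs gs HZ.
have -> : Z = (Y *m h *m Y^T) 0 0 *: (X *m S) - (Y *m h *m X^T) 0 0 *: (Y *m S)
  - ((Y *m g *m Y^T) 0 0 *: X - (Y *m g *m X^T) 0 0 *: Y).
  apply/rowP => l; rewrite HZ.
  by move: (X *m S) (Y *m S) => A B; rewrite !mxE.
rewrite (bilinear_sym X Y hs) (bilinear_sym X Y gs).
rewrite !(mulmxDl, mulNmx) -!scalemxAl -![_ *m S *m g]mulmxA Sg.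
move: (_ *m h *m _) (Y *m h *m _) (Y *m h *m _) (X *m g *m _) (Y *m g *m _) (Y *m g *m _).
by move=> a b c d e f; rewrite !mxE; ring.
Qed.

Lemma sectional_metric x X Y : U x ->
  let g v w := (v *m metric x *m w^T) 0 0 in
  let h v w := (v *m sff x *m w^T) 0 0 in
  sectional metric x X Y =
  (h X X * h Y Y - h X Y ^+ 2 - (g X X * g Y Y - g X Y ^+ 2))
   / (g X X * g Y Y - g X Y ^+ 2).
Proof.
move=> Ux g h; rewrite /sectional /g /h; congr (_ / _).
apply: (curvature_plane_algebra (shape_metric HS Ux) (sff_sym HS Ux) (metric_sym HS x)) => l.
apply: etrans (curvature_contraction _ _ _ _ _ l); rewrite mxE.
apply: eq_bigr => i _; apply: eq_bigr => j _; apply: eq_bigr => k _.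
congr (_ * _); exact: riemann_metric.
Qed.
End GaussEquation.

(** * Shape operators of rank two *)

Section Nullity.
Variables (R : realType) (n : nat) (U : set 'rV[R]_n) (F N : 'rV[R]_n -> 'rV[R]_n.+2).
Variable L : 'M[R]_n.+2.
Hypothesis HS : hypersurface U F N L.
Variable kappa : R.
Let oU := hyp_open HS.
Implicit Types (x y v u T : 'rV[R]_n) (c : 'rV[R]_n.+2).
Local Notation tangent := (tangent_mx F).
Local Notation dnormal := (dnormal_mx N).
Local Notation metric := (metric_mx F L).
Local Notation sff := (sff_mx F N L).
Local Notation shape := (shape_mx F N L).
Local Notation hess := (hess_mx F L).
Local Notation e_ i := (delta_mx 0 i).

(* Together with [shape_rank] below, these say that the eigenvalues of the shape
   operator are [r], [s] with [r s = kappa], and [0]. *)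
Hypothesis k0 : kappa != 0.
Hypothesis shape_cubic : forall y, U y ->
  (\tr (shape y) *: shape y - shape y *m shape y) *m shape y = kappa *: shape y.
Hypothesis trace_const : forall y, U y ->
  \tr (\tr (shape y) *: shape y - shape y *m shape y) = 2 * kappa.

(** As [(tr S) S - S^2] is multiplication by [kappa] on the image of [S], this is
    the projector onto the kernel of [S] along its image. Unlike a basis of the
    kernel it is given by a formula, and can be differentiated. *)
Definition nullproj y : 'M[R]_n :=
  1%:M - kappa^-1 *: (\tr (shape y) *: shape y - shape y *m shape y).

Lemma nullproj_shape y : U y -> nullproj y *m shape y = 0.
Proof.
move=> Uy; rewrite mulmxBl mul1mx -scalemxAl shape_cubic // scalerA mulVf //.
by rewrite scale1r subrr.
Qed.

Lemma null_nullproj y T : T *m shape y = 0 -> T *m nullproj y = T.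
Proof.
move=> T0; rewrite mulmxBr mulmx1 -scalemxAr mulmxBr mulmxA -scalemxAr T0.
by rewrite mul0mx scaler0 subr0 scaler0 subr0.
Qed.

Lemma nullproj_dnormal y : U y -> nullproj y *m dnormal y = 0.
Proof. by move=> Uy; rewrite (weingarten HS Uy) mulmxN mulmxA nullproj_shape // mul0mx oppr0. Qed.

Lemma nullproj_sff y : U y -> nullproj y *m sff y = 0.
Proof. by move=> Uy; rewrite -(shape_metric HS Uy) mulmxA nullproj_shape // mul0mx. Qed.

Lemma null_dnormal y T : U y -> T *m shape y = 0 -> T *m dnormal y = 0.
Proof. by move=> Uy T0; rewrite (weingarten HS Uy) mulmxN mulmxA T0 mul0mx oppr0. Qed.

Lemma null_sff y T : U y -> T *m shape y = 0 -> T *m sff y = 0.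
Proof. by move=> Uy T0; rewrite -(shape_metric HS Uy) mulmxA T0 mul0mx. Qed.

Lemma dnormal_null y p (T : 'M[R]_(p, n)) : U y -> T *m sff y = 0 ->
  dnormal y *m L *m (T *m tangent y)^T = 0.
Proof.
move=> Uy T0; rewrite trmx_mul mulmxA.
have -> : dnormal y *m L *m (tangent y)^T = - sff y by rewrite /sff_mx opprK.
by rewrite mulNmx -[sff y](sff_sym HS Uy) -trmx_mul T0 trmx0 oppr0.
Qed.

Lemma derivable_shape_sqr y v : U y -> derivable (fun y => shape y *m shape y) y v.
Proof.
by move=> Uy; exact: derivable_mulmx (@derivable_shape _ _ _ _ _ _ HS y v Uy)
  (@derivable_shape _ _ _ _ _ _ HS y v Uy).
Qed.

Lemma derivable_trace_shape y v : U y ->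
  derivable (fun y => \tr (shape y) *: shape y) y v.
Proof.
move=> Uy; apply/derivable_mxP => i j; under eq_fun do rewrite mxE.
apply: derivableM.
  by exact: derivable_mxtrace (@derivable_shape _ _ _ _ _ _ HS y v Uy).
by exact: derivable_entry (@derivable_shape _ _ _ _ _ _ HS y v Uy).
Qed.

Lemma derivable_nullproj y v : U y -> derivable nullproj y v.
Proof.
move=> Uy; apply: derivableB; first exact: derivable_cst.
apply: derivableZ; apply: derivableB; first exact: derivable_trace_shape.
exact: derivable_shape_sqr.
Qed.

(** Differentiate [nullproj dN = 0]. *)
Lemma null_derive_dnormal y v T : U y -> T *m shape y = 0 ->
  T *m 'D_v dnormal y = - (T *m 'D_v nullproj y *m dnormal y).
Proof.
move=> Uy T0.
have E1 := derive_mulmx (@derivable_nullproj y v Uy) (@derivable_dnormal _ _ _ _ _ _ HS y v Uy).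
have E2 : 'D_v (fun y => nullproj y *m dnormal y) y = 0.
  exact: (@derive_locally_const _ _ _ U _ 0 _ _ oU Uy nullproj_dnormal).
have E := etrans (esym E1) E2; have TP := null_nullproj T0.
move: ('D_v nullproj y) ('D_v dnormal y) (nullproj y) (dnormal y) E TP => P' K' P K E TP.
apply/eqP; rewrite -addr_eq0 addrC; apply/eqP.
by rewrite -[X in _ + X *m _]TP -mulmxA -[T *m P *m _]mulmxA -mulmxDr E mulmx0.
Qed.

Lemma derivable_null_tangent y v : U y -> derivable (fun y => nullproj y *m tangent y) y v.
Proof.
move=> Uy.
exact: derivable_mulmx (@derivable_nullproj y v Uy) (@derivable_tangent _ _ _ _ _ _ HS y v Uy).
Qed.

(** [D_v (nullproj J)]: for null [T] the derivative of the extension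
    [T nullproj] of [T] to a field of null vectors. *)
Definition dnull v y := 'D_v nullproj y *m tangent y + nullproj y *m 'D_v tangent y.

Lemma derive_null_tangent y v : U y -> 'D_v (fun y => nullproj y *m tangent y) y = dnull v y.
Proof.
move=> Uy.
exact: derive_mulmx (@derivable_nullproj y v Uy) (@derivable_tangent _ _ _ _ _ _ HS y v Uy).
Qed.

Lemma bracket_dnormal_null y v : U y ->
  'D_v dnormal y *m L *m (nullproj y *m tangent y)^T = - (dnormal y *m L *m (dnull v y)^T).
Proof.
move=> Uy; rewrite -(derive_null_tangent v Uy).
apply: (derive_bracket_const oU Uy _ (@derivable_dnormal _ _ _ _ _ _ HS y v Uy)
  (@derivable_null_tangent y v Uy)) => z Uz.
exact: dnormal_null (nullproj_sff Uz).
Qed.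

(** The Hessians of the functions [<c, N>] at [y]. *)
Definition hess_normal c y : 'M[R]_n :=
  \matrix_(i, j) ('D_(e_ j) dnormal y *m L *m c^T) i 0.

Lemma hess_normal_col c y j : hess_normal c y *m (e_ j)^T = 'D_(e_ j) dnormal y *m L *m c^T.
Proof.
apply/colP => i; by rewrite trmx_delta -colE [LHS]mxE /hess_normal [LHS]mxE.
Qed.

Lemma col_deltaP (A B : 'M[R]_n) :
  (forall j, A *m (e_ j : 'rV_n)^T = B *m (e_ j)^T) -> A = B.
Proof.
move=> AB; apply/matrixP => i j; move/colP/(_ i): (AB j).
by rewrite !trmx_delta -!colE !mxE.
Qed.

Lemma row_deltaP p (A B : 'M[R]_(n, p)) :
  (forall j, (e_ j : 'rV_n) *m A = e_ j *m B) -> A = B.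
Proof. by move=> AB; apply/row_matrixP => i; rewrite !rowE. Qed.

Lemma delta_row_bracket (A B : 'M[R]_(n, n.+2)) i j c :
  (e_ i : 'rV_n) *m A = e_ j *m B ->
  (A *m L *m c^T) i 0 = (B *m L *m c^T) j 0.
Proof.
have mE (C : 'M[R]_(n, 1)) k : C k 0 = ((e_ k : 'rV_n) *m C) 0 0 by rewrite -rowE mxE.
by move=> AB; rewrite mE [RHS]mE !mulmxA AB.
Qed.

Lemma hess_normal_sym c y : U y -> (hess_normal c y)^T = hess_normal c y.
Proof.
move=> Uy; apply/matrixP => i j; rewrite [LHS]mxE /hess_normal [LHS]mxE [RHS]mxE.
exact: (delta_row_bracket c (ddnormal_sym HS (e_ j) (e_ i) Uy)).
Qed.

Lemma hess_normalP a c d y :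
  hess_normal (a *: c + d) y = a *: hess_normal c y + hess_normal d y.
Proof.
apply: col_deltaP => j; rewrite mulmxDl -scalemxAl !hess_normal_col.
by rewrite linearP mulmxDr -scalemxAr.
Qed.

Lemma hess_normal_point y : U y -> hess_normal (F y) y = sff y.
Proof.
move=> Uy; apply: col_deltaP => j; rewrite hess_normal_col.
exact: (ddnormal_point HS (e_ j) Uy).
Qed.

(** By [null_derive_dnormal] the derivative of [dN] in a null row is in the image
    of [dN], which is orthogonal to the null tangent vectors. *)
Lemma null_hess_normal (Y : 'rV[R]_n) T y : U y -> Y *m shape y = 0 -> T *m shape y = 0 ->
  Y *m hess_normal (T *m tangent y) y = 0.
Proof.
move=> Uy Y0 T0; apply: trmx_inj; apply: row_deltaP => j; apply: trmx_inj.
rewrite trmx_mul trmxK trmx0 mulmx0 trmx0 -mulmxA hess_normal_col !mulmxA.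
rewrite (null_derive_dnormal (e_ j) Uy Y0) !mulNmx -!mulmxA.
by rewrite [dnormal y *m _]mulmxA (dnormal_null Uy (null_sff Uy T0)) !mulmx0 oppr0.
Qed.

(** Row [i] holds the coordinates of the [i]-th partial derivative of the null
    field [T nullproj]. *)
Definition null_slope T y : 'M[R]_n := \matrix_i (T *m 'D_(e_ i) nullproj y).

Lemma null_slope_row T y i : (e_ i : 'rV_n) *m null_slope T y = T *m 'D_(e_ i) nullproj y.
Proof. by rewrite -rowE rowK. Qed.

Lemma derive_dnormal_null T y : U y -> T *m shape y = 0 ->
  'D_T dnormal y = - (null_slope T y *m dnormal y).
Proof.
move=> Uy T0; apply: row_deltaP => i.
apply: etrans (ddnormal_sym HS (e_ i) T Uy) _.
by rewrite mulmxN mulmxA null_slope_row; exact: null_derive_dnormal.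
Qed.

Lemma null_dnull T y v : U y -> T *m shape y = 0 ->
  T *m dnull v y = T *m 'D_v nullproj y *m tangent y + v *m 'D_T tangent y.
Proof.
move=> Uy T0; rewrite mulmxDr !mulmxA (null_nullproj T0).
exact: (congr1 (fun Z => T *m 'D_v nullproj y *m tangent y + Z) (dtangent_sym HS T v Uy)).
Qed.

Lemma slope_algebra (K J H : 'M[R]_(n, n.+2)) (A S h : 'M[R]_n) v :
  K = - (S *m J) -> K *m L *m J^T = - h ->
  - (K *m L *m (v *m A *m J + v *m H)^T) = (h *m A^T + S *m (H *m L *m J^T)^T) *m v^T.
Proof.
move=> KE KJ; rewrite (form_bracketC HS).
rewrite (_ : v *m A *m J + v *m H = v *m (A *m J + H)); last by rewrite mulmxDr mulmxA.
rewrite [(v *m _)^T]trmx_mul [K *m L *m _]mulmxA -mulNmx; congr (_ *m v^T).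
rewrite linearD /= trmx_mul mulmxDr opprD; congr (_ + _).
  by rewrite mulmxA KJ mulNmx opprK.
by rewrite KE !mulNmx opprK !mulmxA.
Qed.

(** As [<dN, T J> = 0] for null fields, the derivative can be moved from [dN] to
    the null field [T nullproj J]. *)
Lemma hess_normal_null T y : U y -> T *m shape y = 0 ->
  hess_normal (T *m tangent y) y = sff y *m (null_slope T y)^T + shape y *m (hess T y)^T.
Proof.
move=> Uy T0; apply: col_deltaP => j; rewrite hess_normal_col.
have -> : T *m tangent y = T *m (nullproj y *m tangent y) by rewrite mulmxA null_nullproj.
rewrite [(T *m (_ *m _))^T]trmx_mul mulmxA (bracket_dnormal_null _ Uy).
rewrite mulNmx -[dnormal y *m L *m _ *m _]mulmxA -trmx_mul (null_dnull _ Uy T0).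
rewrite -null_slope_row.
apply: (slope_algebra _ _ _ (weingarten HS Uy)).
by rewrite /sff_mx opprK.
Qed.

(** Two expressions for the derivative of [dN = - S J] along [T], one of them from
    the nullity of [T]. *)
Lemma derive_shape_null T y : U y -> T *m shape y = 0 ->
  null_slope T y *m sff y = - ('D_T shape y *m metric y + shape y *m hess T y).
Proof.
move=> Uy T0.
have dS := @derivable_shape _ _ _ _ _ _ HS y T Uy.
have dJ := @derivable_tangent _ _ _ _ _ _ HS y T Uy.
have E1 : 'D_T dnormal y = 'D_T (- (fun y => shape y *m tangent y)) y.
  apply: near_eq_derive; apply: filterS (near_open oU Uy) => z Uz.
  exact: (weingarten HS Uz).
have E2 := deriveN (derivable_mulmx dS dJ).
have E3 := derive_mulmx dS dJ.
have E : null_slope T y *m dnormal y = 'D_T shape y *m tangent y + shape y *m 'D_T tangent y.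
  apply: oppr_inj; apply: etrans (esym (derive_dnormal_null Uy T0)) _.
  exact: etrans E1 (etrans E2 (congr1 -%R E3)).
have KJ : dnormal y *m L *m (tangent y)^T = - sff y by rewrite /sff_mx opprK.
have JJ : tangent y *m L *m (tangent y)^T = metric y by [].
have HJ : 'D_T tangent y *m L *m (tangent y)^T = hess T y by [].
move: ('D_T shape y) ('D_T tangent y) (null_slope T y) E KJ JJ HJ.
move=> S' J' A E KJ JJ HJ.
apply: oppr_inj; rewrite -mulmxN -KJ opprK -JJ -HJ !mulmxA E.
by rewrite !mulmxDl.
Qed.

(** The algebra of [derive2_dnormal_null], over abstract matrices: [P] stands for
    [nullproj], [K] for [dN], primes and indices for derivatives. *)
Lemma second_null_algebra (T : 'rV[R]_n) (P P' : 'M[R]_n) (Ki K'' K Kj J D A B : 'M[R]_(n, n.+2))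
  (a : 'rV[R]_n) :
  T *m P = T ->
  (P' *m Ki + P *m K'') *m L *m B^T = - (A *m L *m D^T) ->
  A = P *m Ki -> B = P *m J ->
  Kj *m L *m (P *m J)^T = - (K *m L *m D^T) ->
  T *m Ki = - (a *m K) ->
  Ki *m L *m (T *m (P *m J))^T = 0 ->
  Kj *m L *m (T *m (P *m J))^T = 0 ->
  T *m K'' *m L *m (T *m (P *m J))^T = 0.
Proof.
move=> TP E1 AE BE E4 E5 ki kj; subst A B.
have {}kj : K *m L *m D^T *m T^T = 0.
  by apply: oppr_inj; rewrite -mulNmx -E4 -[_ *m T^T]mulmxA -trmx_mul kj oppr0.
have e : P *m K'' *m L *m (P *m J)^T =
    - (P *m Ki *m L *m D^T) - P' *m Ki *m L *m (P *m J)^T.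
  by rewrite -E1 !mulmxDl addrAC subrr add0r.
have {}e := congr1 (mulmx T) e; rewrite mulmxBr mulmxN !mulmxA TP E5 in e.
rewrite [(T *m _)^T]trmx_mul mulmxA e mulmxBl !mulNmx opprK.
rewrite -[a *m K *m L]mulmxA -[a *m (K *m L) *m _]mulmxA -[a *m _ *m T^T]mulmxA kj mulmx0 add0r.
rewrite -[T *m P' *m Ki]mulmxA -!mulmxA -trmx_mul.
by move: ki; rewrite -!mulmxA => ->; rewrite !mulmx0 oppr0.
Qed.

(** Solve for the derivative [S'] of the shape operator in terms of the Hessian
    [k] and of the connection term [H]. The latter drops out of the trace, as [S]
    is self-adjoint for [g] and commutes with [tr S - S]. *)
Lemma trace_algebra (g h S S' H A k : 'M[R]_n) :
  g \in unitmx -> g^T = g -> S *m g = h -> h^T = h -> k^T = k ->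
  k = h *m A^T + S *m H^T -> A *m h = - (S' *m g + S *m H) ->
  \tr (((\tr S)%:M - S) *m S') = 0 ->
  \tr (((\tr S)%:M - S) *m k *m invmx g) = 0.
Proof.
move=> gu gs Sg hs ks kE AE tS; set W := _ - S in tS *.
have kE2 : k = A *m h + H *m S^T.
  by rewrite -ks kE linearD /= !trmx_mul !trmxK hs.
have STg : S^T *m invmx g = invmx g *m S.
  have gST : g *m S^T = S *m g by rewrite -{1}gs -trmx_mul Sg hs.
  by rewrite -[S^T](mulKmx gu) gST !mulmxA mulmxK.
have WS : S *m W = W *m S by rewrite mulmxBr mulmxBl scalar_mxC.
have S'E : S' *m g = - k + H *m S^T - S *m H.
  rewrite kE2 AE opprD opprK.
  move: (S' *m g) (S *m H) (H *m S^T) => a b c.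
  by apply/matrixP => i j; rewrite !mxE; ring.
have {S'E}S'E : S' = (- k + H *m S^T - S *m H) *m invmx g by rewrite -S'E mulmxK.
clearbody W.
have E1 : \tr (W *m H *m S^T *m invmx g) = \tr (W *m S *m H *m invmx g).
  by rewrite -[W *m H *m _ *m _]mulmxA STg mulmxA mxtrace_mulC !mulmxA WS.
have E2 : W *m S' = - (W *m k *m invmx g) + W *m H *m S^T *m invmx g - W *m S *m H *m invmx g.
  by rewrite S'E !(mulmxDr, mulmxDl, mulNmx, mulmxN) !mulmxA.
have tE (a b c : 'M[R]_n) : \tr (- a + b - c) = - \tr a + \tr b - \tr c.
  by rewrite linearB linearD linearN.
by move: tS; rewrite E2 tE E1; lra.
Qed.

Lemma derive_trace_const T y : U y ->
  \tr (((\tr (shape y))%:M - shape y) *m 'D_T shape y) = 0.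
Proof.
move=> Uy.
have dS := @derivable_shape _ _ _ _ _ _ HS y T Uy.
have dt := derivable_mxtrace dS.
have E0 : 'D_T (fun y => \tr (shape y) * \tr (shape y) - \tr (shape y *m shape y)) y = 0.
  apply: (@derive_locally_const _ _ _ U _ (2 * kappa) _ _ oU Uy) => z Uz.
  by rewrite -(trace_const Uz) linearB /= linearZ.
have d1 : derivable (fun y => \tr (shape y) * \tr (shape y)) y T := derivableM dt dt.
have d2 : derivable (fun y => \tr (shape y *m shape y)) y T.
  exact: derivable_mxtrace (@derivable_shape_sqr y T Uy).
have E1 := deriveB d1 d2.
have E2 : 'D_T (fun y => \tr (shape y) * \tr (shape y)) y =
    \tr (shape y) * \tr ('D_T shape y) + \tr (shape y) * \tr ('D_T shape y).
  by apply: etrans (deriveM dt dt) _; rewrite (derive_mxtrace dS).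
have E3 : 'D_T (fun y => \tr (shape y *m shape y)) y =
    \tr ('D_T shape y *m shape y + shape y *m 'D_T shape y).
  apply: etrans (derive_mxtrace (@derivable_shape_sqr y T Uy)) _.
  by rewrite (derive_mulmx dS dS).
have E : \tr (shape y) * \tr ('D_T shape y) + \tr (shape y) * \tr ('D_T shape y)
   - \tr ('D_T shape y *m shape y + shape y *m 'D_T shape y) = 0.
  by rewrite -E2 -E3; exact: etrans (esym E1) E0.
move: (shape y) ('D_T shape y) E => S S' E.
rewrite mulmxBl mul_scalar_mx linearB /= linearZ /=.
move: E; rewrite mxtraceD [\tr (S' *m S)]mxtrace_mulC; lra.
Qed.

(** As [sum_(i < j) lam_i lam_j] is constant, its derivative in a null direction
    vanishes. *)
Lemma trace_hess_normal_null T y : U y -> T *m shape y = 0 ->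
  \tr (((\tr (shape y))%:M - shape y) *m hess_normal (T *m tangent y) y *m invmx (metric y)) = 0.
Proof.
move=> Uy T0.
exact: (trace_algebra (metric_unit HS Uy) (metric_sym HS y) (shape_metric HS Uy)
  (sff_sym HS Uy) (hess_normal_sym _ Uy) (hess_normal_null Uy T0)
  (derive_shape_null Uy T0) (derive_trace_const T Uy)).
Qed.

(** The differential at [S] of half the function [tr ((tr S) S - S^2)], on the
    endomorphism with matrix [B g^-1]. *)
Definition gauss_trace y (B : 'M[R]_n) : R :=
  \tr (((\tr (shape y))%:M - shape y) *m B *m invmx (metric y)).

Lemma gauss_traceP y a (B C : 'M[R]_n) :
  gauss_trace y (a *: B + C) = a * gauss_trace y B + gauss_trace y C.
Proof. by rewrite /gauss_trace mulmxDr mulmxDl linearD /= -scalemxAr -scalemxAl linearZ. Qed.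

Lemma gauss_trace_sff y : U y -> gauss_trace y (sff y) = 2 * kappa.
Proof.
move=> Uy; rewrite -(trace_const Uy) /gauss_trace -[_ *m sff y *m _]mulmxA -/(shape y).
by rewrite mulmxBl mul_scalar_mx.
Qed.

Hypothesis shape_rank : forall y, U y -> (\rank (shape y) <= 2)%N.
Hypothesis n_gt4 : (4 < n)%N.

Lemma nullprojC_rank y : U y -> (\rank (1%:M - nullproj y)%R <= 2)%N.
Proof.
move=> Uy; apply: leq_trans (shape_rank Uy); rewrite /nullproj opprB addrC subrK.
rewrite -mul_scalar_mx -mulmxBl -mul_scalar_mx mulmxA; exact: mxrankM_maxr.
Qed.

Lemma null_fixed y (B : 'M[R]_n) : B^T = B ->
  nullproj y *m B = 0 -> B = (1%:M - nullproj y) *m B *m (1%:M - nullproj y)^T.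
Proof.
move=> Bs PB; have E : (1%:M - nullproj y) *m B = B by rewrite mulmxBl mul1mx PB subr0.
by rewrite E -[in RHS]Bs -trmx_mul E Bs.
Qed.

(** The position vector and the null tangent vectors span a space of dimension
    [n - 1 > 3], so one of its elements [alpha F + T J] has a vanishing Hessian.
    The first order relation forces [alpha = 0]. *)
Lemma exists_null_hessian y : U y ->
  exists T, [/\ T != 0, T *m shape y = 0 & hess_normal (T *m tangent y) y = 0].
Proof.
move=> Uy; pose B := row_base (kermx (shape y)).
have BS : B *m shape y = 0.
  by apply/sub_kermxP; rewrite eq_row_base.
have fB : row_free B := row_base_free _.
have rB : (3 < 1 + \rank (kermx (shape y)))%N.
  by rewrite mxrank_ker; have := shape_rank Uy; move: n_gt4; lia.
pose C := col_mx (F y) (B *m tangent y).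
have k_lin a (w w' : 'rV[R]_(1 + \rank (kermx (shape y)))) : hess_normal ((a *: w + w') *m C) y =
    a *: hess_normal (w *m C) y + hess_normal (w' *m C) y.
  by rewrite mulmxDl -scalemxAl hess_normalP.
have null_k (w : 'rV[R]_(1 + \rank (kermx (shape y)))) : nullproj y *m hess_normal (w *m C) y = 0.
  rewrite -[w]hsubmxK mul_row_col; move: (lsubmx w) (rsubmx w) => a b.
  rewrite [a]mx11_scalar mul_scalar_mx hess_normalP (hess_normal_point Uy).
  rewrite mulmxDr -scalemxAr (nullproj_sff Uy) scaler0 add0r mulmxA.
  apply: row_deltaP => i; rewrite mulmx0 mulmxA.
  apply: null_hess_normal => //; first by rewrite -mulmxA nullproj_shape // mulmx0.
  by rewrite -mulmxA BS mulmx0.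
have [w w0 kw] := @symmetric_pencil_kernel _ _ _ _ _ (nullprojC_rank Uy) rB k_lin
  (fun w => hess_normal_sym _ Uy) (fun w => null_fixed (hess_normal_sym _ Uy) (null_k w)).
pose alpha := lsubmx w 0 0; pose T := rsubmx w *m B.
have T0 : T *m shape y = 0 by rewrite -mulmxA BS mulmx0.
have kE : alpha *: sff y + hess_normal (T *m tangent y) y = 0.
  rewrite -kw -[w in RHS]hsubmxK mul_row_col [lsubmx w in RHS]mx11_scalar mul_scalar_mx.
  by rewrite hess_normalP (hess_normal_point Uy) -mulmxA.
have alpha0 : alpha = 0.
  have := gauss_traceP y alpha (sff y) (hess_normal (T *m tangent y) y).
  have tk : gauss_trace y (hess_normal (T *m tangent y) y) = 0.
    exact: trace_hess_normal_null.
  have t0 : gauss_trace y 0 = 0 by rewrite /gauss_trace mulmx0 mul0mx mxtrace0.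
  rewrite kE gauss_trace_sff // tk t0 addr0 => /esym/eqP.
  by rewrite !mulf_eq0 (negPf k0) orbF pnatr_eq0 orbF => /eqP.
exists T; split=> //; last by move: kE; rewrite alpha0 scale0r add0r.
apply: contra w0 => /eqP TB0; rewrite -[w]hsubmxK [lsubmx w]mx11_scalar -/alpha alpha0.
have -> : rsubmx w = 0 by apply: (row_free_inj fB); rewrite mul0mx.
by rewrite raddf0 row_mx0.
Qed.

(** The second derivative of [<T J, N>] with [T] extended to a null field: by
    differentiating [T (D_i (dN)) L (T J)^T = 0], where all other terms vanish when
    the Hessian of [<T J, N>] does. *)
Lemma derive2_dnormal_null y T i : U y -> T *m shape y = 0 ->
  hess_normal (T *m tangent y) y = 0 ->
  'D_T ('D_(e_ i) dnormal) y *m L *m (T *m tangent y)^T = 0.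
Proof.
move=> Uy T0 k00.
have k0col j : 'D_(e_ j) dnormal y *m L *m (T *m tangent y)^T = 0.
  by rewrite -hess_normal_col k00 mul0mx.
have nullC z v : U z -> nullproj z *m 'D_v dnormal z = - ('D_v nullproj z *m dnormal z).
  move=> Uz; apply/eqP; rewrite -addr_eq0 addrC; apply/eqP.
  have E1 := derive_mulmx (@derivable_nullproj z v Uz) (@derivable_dnormal _ _ _ _ _ _ HS z v Uz).
  apply: etrans (esym E1) _.
  exact: (@derive_locally_const _ _ _ U _ 0 _ _ oU Uz nullproj_dnormal).
pose A z := nullproj z *m 'D_(e_ i) dnormal z.
pose B z := nullproj z *m tangent z.
have AB z : U z -> A z *m L *m (B z)^T = 0.
  move=> Uz; rewrite /A nullC // !mulNmx -[_ *m dnormal z *m L]mulmxA -mulmxA.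
  by rewrite (dnormal_null Uz (nullproj_sff Uz)) mulmx0 oppr0.
have dK v := @derivable_ddnormal _ _ _ _ _ _ HS y (e_ i) v Uy.
have dP v := @derivable_nullproj y v Uy.
have dA v : derivable A y v := derivable_mulmx (dP v) (dK v).
have TP := null_nullproj T0.
have E j : T *m 'D_(e_ j) ('D_(e_ i) dnormal) y *m L *m (T *m tangent y)^T = 0.
  have E1 := derive_bracket_const oU Uy AB (dA (e_ j)) (@derivable_null_tangent y (e_ j) Uy).
  have E2 := derive_mulmx (dP (e_ j)) (dK (e_ j)).
  have E3 := derive_null_tangent (e_ j) Uy.
  have E4 := bracket_dnormal_null (e_ j) Uy.
  have E5 := null_derive_dnormal (e_ i) Uy T0.
  have E6 : A y = nullproj y *m 'D_(e_ i) dnormal y by [].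
  have E7 : B y = nullproj y *m tangent y by [].
  have E8 : T *m tangent y = T *m (nullproj y *m tangent y) by rewrite mulmxA TP.
  have E1' := etrans (congr1 (fun Z => Z *m L *m (B y)^T) (esym E2)) E1.
  rewrite E3 in E1'.
  have k0i := k0col i; have k0j := k0col j.
  rewrite E8 in k0i k0j *.
  exact: (second_null_algebra TP E1' E6 E7 E4 E5 k0i k0j).
apply: row_deltaP => j; rewrite mulmx0 !mulmxA.
have F1 := d2dnormal_sym HS (e_ i) T Uy.
have F2 := derive_mulmxl (e_ j : 'rV[R]_n) (@derivable_ddnormal _ _ _ _ _ _ HS y T (e_ i) Uy).
have F3 : 'D_(e_ i) (fun z => (e_ j : 'rV_n) *m 'D_T dnormal z) y =
    'D_(e_ i) (fun z => T *m 'D_(e_ j) dnormal z) y.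
  apply: near_eq_derive; apply: filterS (near_open oU Uy) => z Uz.
  exact: (ddnormal_sym HS (e_ j) T Uz).
have F4 := derive_mulmxl T (@derivable_ddnormal _ _ _ _ _ _ HS y (e_ j) (e_ i) Uy).
have F5 := d2dnormal_sym HS (e_ j) (e_ i) Uy.
have F6 : (e_ j : 'rV_n) *m 'D_T ('D_(e_ i) dnormal) y = T *m 'D_(e_ j) ('D_(e_ i) dnormal) y.
  have F1' := congr1 (mulmx (e_ j : 'rV[R]_n)) F1.
  have F5' := congr1 (mulmx T) F5.
  have G1 := etrans F4 F5'.
  have G2 := etrans F3 G1.
  have G3 := etrans (esym F2) G2.
  have G4 := etrans F1' G3.
  exact: G4.
exact: etrans (congr1 (fun Z => Z *m L *m (T *m tangent y)^T) F6) (E j).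
Qed.

(** The extension of [T J] to a field of null tangent vectors. *)
Definition null_extension T z := T *m (nullproj z *m tangent z).

Lemma derivable_hess_normal_null T y v : U y ->
  derivable (fun z => hess_normal (null_extension T z) z) y v.
Proof.
move=> Uy; apply/derivable_mxP => i j.
have E : (fun z => hess_normal (null_extension T z) z i j) =
    (fun z => ('D_(e_ j) dnormal z *m L *m (T *m (nullproj z *m tangent z))^T) i 0).
  by apply/funext => z; rewrite mxE.
have dK := @derivable_ddnormal _ _ _ _ _ _ HS y (e_ j) v Uy.
have dB : derivable (fun z => T *m (nullproj z *m tangent z)) y v.
  by apply: derivable_mulmxl; exact: derivable_null_tangent.
have d : derivable (fun z => 'D_(e_ j) dnormal z *m L *m (T *m (nullproj z *m tangent z))^T) y v.
  exact: derivable_bracket dK dB.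
by rewrite E; move/derivable_mxP: d => /(_ i 0).
Qed.

(** The variation of the second derivative of [N] does not contribute, by
    [derive2_dnormal_null]. *)
Lemma derive_hess_normal_null T y : U y -> T *m shape y = 0 ->
  hess_normal (T *m tangent y) y = 0 ->
  'D_T (fun z => hess_normal (null_extension T z) z) y = hess_normal (T *m dnull T y) y.
Proof.
move=> Uy T0 k00; apply/matrixP => i j.
have dk := @derivable_hess_normal_null T y T Uy.
have dK := @derivable_ddnormal _ _ _ _ _ _ HS y (e_ j) T Uy.
have dB : derivable (fun z => T *m (nullproj z *m tangent z)) y T.
  by apply: derivable_mulmxl; exact: derivable_null_tangent.
have E1 := derive_entry i j dk.
have E2 : 'D_T (fun z => hess_normal (null_extension T z) z i j) y =
  'D_T (fun z => ('D_(e_ j) dnormal z *m L *m (T *m (nullproj z *m tangent z))^T) i 0) y.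
  by congr ('D_T _ y); apply/funext => z; rewrite mxE.
have d : derivable (fun z => 'D_(e_ j) dnormal z *m L *m (T *m (nullproj z *m tangent z))^T) y T.
  exact: derivable_bracket dK dB.
have E3 := derive_entry i 0 d.
have E4 := derive_bracket L dK dB.
have E5 : 'D_T (fun z => T *m (nullproj z *m tangent z)) y = T *m dnull T y.
  apply: etrans (derive_mulmxl T (@derivable_null_tangent y T Uy)) _.
  exact: (congr1 (mulmx T) (derive_null_tangent T Uy)).
have E6 := derive2_dnormal_null j Uy T0 k00.
have E7 : T *m (nullproj y *m tangent y) = T *m tangent y.
  by rewrite mulmxA null_nullproj.
have E123 := etrans E1 (etrans E2 (esym E3)).
apply: etrans E123 _.
rewrite /hess_normal mxE; apply: (congr1 (fun A : 'M[R]_(n, 1) => A i 0)).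
apply: etrans E4 _; rewrite E5 E7.
exact: etrans (congr1 (fun Z => Z + _) E6) (add0r _).
Qed.

(** The derivative of the null field [T nullproj J] along [T] has no component along
    [N], since [N] is constant in null directions; the one along [F] comes from
    differentiating [<T J, F> = 0]; and the tangential one is null because the
    Hessian of [<T J, N>] vanishes. *)
Lemma dnull_decomposition T y : U y -> T *m shape y = 0 ->
  hess_normal (T *m tangent y) y = 0 ->
  exists2 X, X *m shape y = 0 &
    T *m dnull T y = X *m tangent y + (T *m metric y *m T^T) 0 0 *: F y.
Proof.
move=> Uy T0 k00.
have dB := @derivable_null_tangent y T Uy.
have dB' := derive_null_tangent T Uy.
have TB : T *m (nullproj y *m tangent y) = T *m tangent y by rewrite mulmxA null_nullproj.
have PN : forall z, U z -> nullproj z *m tangent z *m L *m (N z)^T = 0.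
  by move=> z Uz; rewrite -mulmxA -[nullproj z *m _ *m _]mulmxA mulmxA -mulmxA
    [tangent z *m _]mulmxA (tangent_normal HS Uz) mulmx0.
have PF : forall z, U z -> nullproj z *m tangent z *m L *m (F z)^T = 0.
  by move=> z Uz; rewrite -mulmxA -[nullproj z *m _ *m _]mulmxA mulmxA -mulmxA
    [tangent z *m _]mulmxA (tangent_point HS Uz) mulmx0.
have ZN : T *m dnull T y *m L *m (N y)^T = 0.
  have := derive_bracket_const oU Uy PN dB (@derivable_normal _ _ _ _ _ _ HS y T Uy).
  rewrite dB' (derive_normal HS T Uy) (null_dnormal Uy T0) trmx0 mulmx0 oppr0 => E.
  by rewrite -!mulmxA; rewrite -mulmxA in E; rewrite E mulmx0.
have ZF : T *m dnull T y *m L *m (F y)^T = - (T *m metric y *m T^T).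
  have := derive_bracket_const oU Uy PF dB (@derivable_point _ _ _ _ _ _ HS y T Uy).
  rewrite dB' (derive_point HS T Uy) => E.
  rewrite -!mulmxA; rewrite -mulmxA in E; rewrite E mulmxN.
  by rewrite !mulmxA (null_nullproj T0) trmx_mul !mulmxA.
have KZ : dnormal y *m L *m (T *m dnull T y)^T = 0.
  apply: oppr_inj; rewrite oppr0 trmx_mul mulmxA -mulNmx -(bracket_dnormal_null _ Uy).
  rewrite -[_ *m T^T]mulmxA -trmx_mul TB; apply: row_deltaP => i; rewrite mulmx0.
  have k00i := hess_normal_col (T *m tangent y) y i; rewrite k00 mul0mx in k00i.
  have G := congr1 (fun Z => Z *m L *m (T *m tangent y)^T) (ddnormal_sym HS (e_ i) T Uy).
  rewrite !mulmxA; apply: etrans G _.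
  by rewrite -[T *m _ *m L]mulmxA -mulmxA -k00i mulmx0.
pose X := T *m dnull T y *m L *m (tangent y)^T *m invmx (metric y).
exists X; last first.
  rewrite {1}(frame_expansion HS (T *m dnull T y) Uy) ZN ZF mul0mx addr0 mulNmx opprK.
  by rewrite -[(_ 0 0) *: F y]mul_scalar_mx -mx11_scalar.
have gu := metric_unit HS Uy.
apply: (can_inj (mulmxK gu)); rewrite mul0mx -mulmxA (shape_metric HS Uy).
rewrite -(metric_trmx_shape HS Uy) mulmxA /X mulmxKV //.
move: KZ; rewrite (weingarten HS Uy) !mulNmx => /eqP; rewrite oppr_eq0 => /eqP /(congr1 trmx).
by rewrite (form_bracketC HS) trmx0 trmx_mul mulmxA.
Qed.

(** Differentiating the first order relation along a null [T] with vanishing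
    Hessian yields [<T J, T J> 2 kappa = 0]. *)
Theorem no_rank_two_hypersurface y : ~ U y.
Proof.
move=> Uy; have [T [Tn0 T0 k00]] := exists_null_hessian Uy.
have [X X0 ZE] := dnull_decomposition Uy T0 k00.
pose k z := hess_normal (null_extension T z) z.
pose W z := (\tr (shape z))%:M - shape z.
have nullT z : U z -> T *m nullproj z *m shape z = 0.
  by move=> Uz; rewrite -mulmxA nullproj_shape // mulmx0.
have first_order z : U z -> \tr (W z *m k z *m invmx (metric z)) = 0.
  move=> Uz; rewrite /k /null_extension mulmxA.
  exact: trace_hess_normal_null Uz (nullT z Uz).
have dS := @derivable_shape _ _ _ _ _ _ HS y T Uy.
have dW : derivable W y T.
  apply: derivableB; last exact: dS.
  apply/derivable_mxP => i j; under eq_fun do rewrite mxE -mulr_natr.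
  apply: derivableM; last exact: derivable_cst.
  exact: derivable_mxtrace dS.
have dk : derivable k y T := @derivable_hess_normal_null T y T Uy.
have dI := @derivable_invmx_metric _ _ _ _ _ _ HS y T Uy.
have dWk : derivable (fun z => W z *m k z) y T := derivable_mulmx dW dk.
have d : derivable (fun z => W z *m k z *m invmx (metric z)) y T := derivable_mulmx dWk dI.
have E1 := derive_mxtrace d.
have E0 : 'D_T (fun z => \tr (W z *m k z *m invmx (metric z))) y = 0.
  exact: (@derive_locally_const _ _ _ U _ 0 _ _ oU Uy first_order).
have E2 : 'D_T (fun z => W z *m k z *m invmx (metric z)) y =
    'D_T (fun z => W z *m k z) y *m invmx (metric y)
    + W y *m k y *m 'D_T (fun z => invmx (metric z)) y := derive_mulmx dWk dI.
have E3 := derive_mulmx dW dk.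
have ky : k y = 0.
  by rewrite /k /null_extension mulmxA (null_nullproj T0).
have E4 : 'D_T k y = hess_normal (T *m dnull T y) y := derive_hess_normal_null Uy T0 k00.
have E5 : \tr (W y *m 'D_T k y *m invmx (metric y)) = 0.
  have E := etrans (esym E1) E0; rewrite E2 E3 ky !mulmx0 mul0mx addr0 add0r in E.
  exact: E.
have : gauss_trace y (hess_normal (T *m dnull T y) y) = 0 by rewrite -E4.
rewrite ZE addrC hess_normalP (hess_normal_point Uy) gauss_traceP gauss_trace_sff //.
have -> : gauss_trace y (hess_normal (X *m tangent y) y) = 0.
  exact: trace_hess_normal_null Uy X0.
move/eqP; rewrite addr0 !mulf_eq0 (negPf k0) pnatr_eq0 /= orbF.
by rewrite gt_eqF //; exact: (hyp_spacelike HS Uy Tn0).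
Qed.
End Nullity.

(** * Semicontinuity of the rank *)

Section EntryContinuity.
Variables (R : realType) (X : topologicalType).

Definition entrywise_continuous p q (A : X -> 'M[R]_(p, q)) x :=
  forall i j, {for x, continuous (fun y => A y i j)}.

Lemma continuous_at_sum (I : Type) (r : seq I) (f : I -> X -> R) x :
  (forall i, {for x, continuous (f i)}) -> {for x, continuous (fun y => \sum_(i <- r) f i y)}.
Proof.
move=> cf; apply: (cvg_big (op := +%R)) => [|i _]; first exact: add_continuous.
exact: cf.
Qed.

Lemma continuous_at_prod (I : Type) (r : seq I) (f : I -> X -> R) x :
  (forall i, {for x, continuous (f i)}) -> {for x, continuous (fun y => \prod_(i <- r) f i y)}.
Proof.
move=> cf; elim: r => [|i r IH].
  rewrite (_ : (fun y => _) = fun=> 1); first exact: cvg_cst.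
  by apply/funext => y; rewrite big_nil.
rewrite (_ : (fun y => _) = fun y => f i y * \prod_(j <- r) f j y).
  exact: (cvgM (cf i) IH).
by apply/funext => y; rewrite big_cons.
Qed.

Lemma continuous_near_eq (f g : X -> R) x : (\forall y \near x, f y = g y) ->
  {for x, continuous f} -> {for x, continuous g}.
Proof.
move=> fg cf; rewrite /prop_for /continuous_at -(nbhs_singleton fg).
by apply: cvg_trans cf; exact: near_eq_cvg.
Qed.

Lemma entrywise_ext p q (A B : X -> 'M[R]_(p, q)) x :
  (\forall y \near x, A y = B y) -> entrywise_continuous A x -> entrywise_continuous B x.
Proof.
move=> AB cA i j; apply: continuous_near_eq (cA i j).
by apply: filterS AB => y ->.
Qed.

Lemma entrywise_cst p q (A : 'M[R]_(p, q)) x : entrywise_continuous (fun=> A) x.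
Proof. by move=> i j; exact: cvg_cst. Qed.

Lemma entrywise_tr p q (A : X -> 'M[R]_(p, q)) x :
  entrywise_continuous A x -> entrywise_continuous (fun y => (A y)^T) x.
Proof.
move=> cA i j; have := cA j i.
by rewrite (_ : (fun y => (A y)^T i j) = fun y => A y j i) //; apply/funext => y; rewrite mxE.
Qed.

Lemma entrywiseN p q (A : X -> 'M[R]_(p, q)) x :
  entrywise_continuous A x -> entrywise_continuous (fun y => - A y) x.
Proof.
move=> cA i j; rewrite (_ : (fun y => (- A y) i j) = fun y => - A y i j); last first.
  by apply/funext => y; rewrite mxE.
exact: (cvgN (cA i j)).
Qed.

Lemma entrywiseD p q (A B : X -> 'M[R]_(p, q)) x :
  entrywise_continuous A x -> entrywise_continuous B x ->
  entrywise_continuous (fun y => A y + B y) x.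
Proof.
move=> cA cB i j; rewrite (_ : (fun y => (A y + B y) i j) = fun y => A y i j + B y i j); last first.
  by apply/funext => y; rewrite mxE.
exact: (cvgD (cA i j) (cB i j)).
Qed.

Lemma entrywiseM p q r (A : X -> 'M[R]_(p, q)) (B : X -> 'M[R]_(q, r)) x :
  entrywise_continuous A x -> entrywise_continuous B x ->
  entrywise_continuous (fun y => A y *m B y) x.
Proof.
move=> cA cB i j.
rewrite (_ : (fun y => (A y *m B y) i j) = fun y => \sum_k A y i k * B y k j); last first.
  by apply/funext => y; rewrite mxE.
by apply: continuous_at_sum => k; exact: (cvgM (cA i k) (cB k j)).
Qed.

Lemma entrywise_trace p (A : X -> 'M[R]_p) x :
  entrywise_continuous A x -> {for x, continuous (fun y => \tr (A y))}.
Proof. by move=> cA; apply: continuous_at_sum => i; exact: cA. Qed.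

Lemma entrywise_det p (A : X -> 'M[R]_p) x :
  entrywise_continuous A x -> {for x, continuous (fun y => \det (A y))}.
Proof.
move=> cA; apply: continuous_at_sum => s; apply: cvgM; first exact: cvg_cst.
by apply: continuous_at_prod => i; exact: cA.
Qed.

Lemma entrywise_inv p (A : X -> 'M[R]_p) x :
  entrywise_continuous A x -> (\forall y \near x, A y \in unitmx) ->
  entrywise_continuous (fun y => invmx (A y)) x.
Proof.
move=> cA Au; apply: (@entrywise_ext _ _ (fun y => (\det (A y))^-1 *: \adj (A y))).
  by apply: filterS Au => y Ay; rewrite /invmx Ay.
move=> i j.
rewrite (_ : (fun y => _) = fun y => (\det (A y))^-1 * ((-1) ^+ (j + i) * \det (row' j (col' i (A y))))); last first.
  by apply/funext => y; rewrite !mxE.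
apply: cvgM.
  apply: cvgV; last exact: entrywise_det.
  by move/nbhs_singleton: Au; rewrite unitmxE unitfE.
apply: cvgM; first exact: cvg_cst.
apply: entrywise_det => k l.
rewrite (_ : (fun y => _) = fun y => A y (lift j k) (lift i l)) //.
by apply/funext => y; rewrite !mxE.
Qed.

(** The rank is lower semicontinuous, as it is witnessed by a nonzero minor. *)
Lemma rank_semicontinuous p q (A : X -> 'M[R]_(p, q)) x :
  entrywise_continuous A x -> \forall y \near x, (\rank (A x) <= \rank (A y))%N.
Proof.
move=> cA; pose r := \rank (A x).
have [B BA] : exists B, B *m col_base (A x) = 1%:M.
  exact/row_fullP/col_base_full.
have [C AC] : exists C, row_base (A x) *m C = 1%:M.
  exact/row_freeP/row_base_free.
have E : B *m A x *m C = 1%:M.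
  apply: etrans (congr1 (fun M => B *m M *m C) (esym (mulmx_base (A x)))) _.
  by rewrite mulmxA BA mul1mx AC.
have cd : {for x, continuous (fun y => \det (B *m A y *m C))}.
  apply: entrywise_det; apply: entrywiseM; last exact: entrywise_cst.
  by apply: entrywiseM => //; exact: entrywise_cst.
have : \forall y \near x, \det (B *m A y *m C) != 0.
  by move/cvgr_neq0 : cd; apply; rewrite E det1 oner_eq0.
apply: filterS => y dy.
have -> : \rank (A x) = \rank (B *m A y *m C).
  by apply/esym/eqP; rewrite -/(row_free _) row_free_unit unitmxE unitfE.
exact: leq_trans (mxrankM_maxl _ _) (mxrankM_maxr _ _).
Qed.
End EntryContinuity.

Section LocalContinuity.
Variables (R : realType) (n : nat) (U : set 'rV[R]_n) (F N : 'rV[R]_n -> 'rV[R]_n.+2).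
Variable L : 'M[R]_n.+2.

Lemma entrywise_jacobian m (G : 'rV[R]_n -> 'rV[R]_m) x : open U -> smooth_on U G -> U x ->
  entrywise_continuous (fun y => 'J G y) x.
Proof.
move=> oU sG Ux i j.
have c : {for x, continuous ('D_(delta_mx 0 i) G)}.
  apply: differentiable_continuous.
  exact: smooth_on_differentiable (smooth_on_derive _ sG) Ux.
have c' : {for x, continuous (fun y => 'D_(delta_mx 0 i) G y 0 j)}.
  apply: (@continuous_comp _ _ _ ('D_(delta_mx 0 i) G) (fun A : 'rV[R]_m => A 0 j)) => //.
  exact: coord_continuous.
have E y : U y -> 'D_(delta_mx 0 i) G y 0 j = 'J G y i j.
  move=> Uy; apply: etrans (congr1 (fun A : 'rV[R]_m => A 0 j) (derive_jacobian sG (delta_mx 0 i) Uy)) _.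
  by move: ('J G y) => A; rewrite -rowE mxE.
apply: continuous_near_eq c'.
by apply: filterS (near_open oU Ux) => y Uy; exact: E.
Qed.

Lemma entrywise_shape x : hypersurface U F N L -> U x ->
  entrywise_continuous (shape_mx F N L) x.
Proof.
move=> HS Ux; have oU := hyp_open HS.
have cJ := entrywise_jacobian oU (hyp_smooth HS) Ux.
have cK := entrywise_jacobian oU (hyp_smooth_normal HS) Ux.
have cL : entrywise_continuous (fun=> L) x by exact: entrywise_cst.
apply: entrywiseM.
  apply: entrywiseN; apply: entrywiseM; last exact: entrywise_tr cJ.
  exact: entrywiseM cK cL.
apply: entrywise_inv; last exact: (near_metric_unit HS Ux).
apply: entrywiseM; last exact: entrywise_tr cJ.
exact: entrywiseM cJ cL.
Qed.

Lemma hypersurface_sub W : open W -> W `<=` U ->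
  hypersurface U F N L -> hypersurface W F N L.
Proof.
move=> oW WU [oU sF sN Ls Lu FF NN NF NJ pos]; split=> //.
- by move=> vs x /WU; exact: sF.
- by move=> vs x /WU; exact: sN.
- by move=> y /WU; exact: FF.
- by move=> y /WU; exact: NN.
- by move=> y /WU; exact: NF.
- by move=> y /WU; exact: NJ.
- by move=> y /WU; exact: pos.
Qed.

Lemma shape_diagonalized x : hypersurface U F N L -> U x ->
  exists2 P, P \in unitmx & exists d, P *m shape_mx F N L x = diag_mx d *m P.
Proof.
move=> HS Ux; apply: (@selfadjoint_spectral _ _ (metric_mx F L x)).
- exact: metric_sym HS x.
- by move=> v v0; exact: (hyp_spacelike HS Ux v0).
- by rewrite (shape_metric HS Ux) (sff_sym HS Ux).
Qed.
End LocalContinuity.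

(** * Charts of an immersed hypersurface *)

Section Lorentz.
Variables (R : realType) (m : nat).
Local Notation L := (lorentz_mx R m).
Implicit Types x y w : 'rV[R]_m.+1.

Lemma lorentz_mx_sym : L^T = L.
Proof. exact: tr_diag_mx. Qed.

Lemma lorentz_mx_bracketC p q (A : 'M[R]_(p, m.+1)) (B : 'M[R]_(q, m.+1)) :
  (A *m L *m B^T)^T = B *m L *m A^T.
Proof. by rewrite trmx_mul trmxK trmx_mul lorentz_mx_sym mulmxA. Qed.

Lemma lorentz_mx_unit : L \in unitmx.
Proof.
have LL : L *m L = 1%:M.
  rewrite mulmx_diag; apply/matrixP => i j; rewrite !mxE.
  by case: (i == ord0); rewrite ?mulrNN mulr1.
by case: (mulmx1_unit LL).
Qed.

Lemma lorentzE x y :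
  lorentz x y = - (x 0 0 * y 0 0) + \sum_(i < m) x 0 (lift ord0 i) * y 0 (lift ord0 i).
Proof.
rewrite /lorentz mxE big_ord_recl; congr (_ + _).
  rewrite mul_mx_diag !mxE eqxx; ring.
apply: eq_bigr => i _; rewrite mul_mx_diag !mxE /= mulr1 //.
Qed.

(** The orthogonal complement of a timelike vector is spacelike: with
    [<x, x> = -1] and [<w, x> = 0], Lagrange's identity reads
    [x_0^2 <w, w> = sum_i (x_0 w_i - w_0 x_i)^2 + w_0^2]. *)
Lemma lorentz_orthogonal_pos x w : lorentz x x = -1 -> lorentz w x = 0 -> w != 0 ->
  0 < lorentz w w.
Proof.
rewrite !lorentzE; set sxx := \sum_(i < m) x _ _ * _; set swx := \sum_(i < m) w _ _ * x _ _.
set sww := \sum_(i < m) w _ _ * w _ _ => xx wx w0.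
have E : \sum_(i < m) (x 0 0 * w 0 (lift ord0 i) - w 0 0 * x 0 (lift ord0 i)) ^+ 2 =
   x 0 0 ^+ 2 * sww - 2 * x 0 0 * w 0 0 * swx + w 0 0 ^+ 2 * sxx.
  rewrite /sww /swx /sxx !mulr_sumr -sumrB -big_split /=.
  by apply: eq_bigr => i _; ring.
have pos : 0 <= \sum_(i < m) (x 0 0 * w 0 (lift ord0 i) - w 0 0 * x 0 (lift ord0 i)) ^+ 2.
  by apply: sumr_ge0 => i _; exact: sqr_ge0.
have sxx0 : 0 <= sxx by apply: sumr_ge0 => i _; rewrite -expr2 sqr_ge0.
have x00 : 1 <= x 0 0 ^+ 2 by nra.
have key : x 0 0 ^+ 2 * (- (w 0 0 * w 0 0) + sww) =
   \sum_(i < m) (x 0 0 * w 0 (lift ord0 i) - w 0 0 * x 0 (lift ord0 i)) ^+ 2 + w 0 0 ^+ 2.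
  rewrite E.
  have -> : swx = w 0 0 * x 0 0 by lra.
  have -> : sxx = x 0 0 * x 0 0 - 1 by lra.
  by ring.
have x02 : 0 < x 0 0 ^+ 2 by lra.
rewrite -(pmulr_rgt0 _ x02) key lt_neqAle addr_ge0 ?sqr_ge0 // andbT eq_sym.
apply: contra w0; rewrite paddr_eq0 ?sqr_ge0 // sqrf_eq0 => /andP [S0 /eqP w00].
have {}S0 i : w 0 (lift ord0 i) = 0.
  move: S0; rewrite psumr_eq0; last by move=> j _; exact: sqr_ge0.
  move/allP => /(_ i (mem_index_enum _)); rewrite /= sqrf_eq0 w00 mul0r subr0 mulf_eq0.
  case/orP => /eqP // x0; move: x02; by rewrite x0 expr0n ltxx.
apply/eqP/rowP => j; rewrite mxE.
by case: (unliftP ord0 j) => [i ->|-> //].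
Qed.
End Lorentz.

Section Chart.
Variables (R : realType) (n : nat) (M : smooth_manifold R n) (f nu : M -> 'rV[R]_n.+2).
Hypotheses (Hf : hyperbolic_immersion f) (Hnu : unit_normal f nu).
Local Notation L := (lorentz_mx R n.+1).

Definition chart_image (c : chart R M n) : set 'rV[R]_n := chart_map c @` chart_dom c.

Lemma mx11_lorentz m (x y : 'rV[R]_m.+1) : x *m lorentz_mx R m *m y^T = (lorentz x y)%:M.
Proof. exact: mx11_scalar. Qed.

(** The tangent vectors are orthogonal to the timelike position vector, so the
    induced metric is positive definite. *)
Lemma chart_hypersurface c : atlas c ->
  hypersurface (chart_image c) (f \o chart_inv c) (nu \o chart_inv c) L.
Proof.
move=> ac; have [sf ff df] := Hf; have [sn nn nf ndf] := Hnu.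
have oU : open (chart_image c) := @chart_img_open _ _ _ c.
have FF y : (f \o chart_inv c) y *m L *m ((f \o chart_inv c) y)^T = (- 1)%:M.
  by rewrite mx11_lorentz; have [-> _] := ff (chart_inv c y).
have JE y v : chart_image c y ->
   'd (f \o chart_inv c) y v = v *m 'J (f \o chart_inv c) y.
  move=> Uy; rewrite -(derive_jacobian (sf c ac) v Uy) deriveE //.
  exact: smooth_on_differentiable (sf c ac) Uy.
split=> //.
- exact: sf.
- exact: sn.
- exact: lorentz_mx_sym.
- exact: lorentz_mx_unit.
- by move=> y _; rewrite mx11_lorentz nn.
- by move=> y _; rewrite mx11_lorentz nf raddf0.
- move=> y Uy; apply: trmx_inj; apply: mulmx_rowI => v; rewrite trmx0 mulmx0.
  apply: trmx_inj; rewrite trmx_mul trmxK trmx0 -[_ *m v^T]mulmxA -trmx_mul -(JE y v Uy).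
  by rewrite mx11_lorentz ndf // raddf0.
move=> y Uy v v0; set J := 'J _ y.
have -> : v *m (J *m L *m J^T) *m v^T = (v *m J) *m L *m (v *m J)^T.
  by rewrite trmx_mul !mulmxA.
rewrite -/(lorentz _ _); apply: (@lorentz_orthogonal_pos _ _ ((f \o chart_inv c) y)).
- by have [] := ff (chart_inv c y).
- have dF : derivable (f \o chart_inv c) y v := smooth_on_derivable (sf c ac) Uy.
  have := derive_bracket_const oU Uy (fun z _ => FF z) dF dF.
  rewrite (derive_jacobian (sf c ac) v Uy) -/J => E.
  suff E0 : v *m J *m L *m ((f \o chart_inv c) y)^T = 0 by rewrite /lorentz E0 mxE.
  apply: self_opp0; rewrite {1}E; congr (- _).
  by rewrite -[LHS]mx11_trmx lorentz_mx_bracketC.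
- apply: contra v0 => /eqP vJ; apply/eqP.
  by apply: (df c ac y Uy); rewrite JE // vJ linear0.
Qed.

Lemma chart_imageP c p : chart_dom c p -> chart_image c (chart_map c p).
Proof. by move=> cp; exists p. Qed.

(** The Jacobians of the coordinate expressions of [G] in two charts differ by
    the Jacobian of the change of charts, which does not depend on [G]. *)
Lemma jacobian_change m (G : M -> 'rV[R]_m) c d p : smooth_map G -> atlas c -> atlas d ->
  chart_dom c p -> chart_dom d p ->
  'J (G \o chart_inv c) (chart_map c p) =
  'J (chart_map d \o chart_inv c) (chart_map c p) *m 'J (G \o chart_inv d) (chart_map d p).
Proof.
move=> sG ac ad cp dp; set x := chart_map c p.
have Ux := chart_imageP cp; have Ud := chart_imageP dp.
have xp : chart_inv c x = p := chart_mapK cp.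
have dtau : differentiable (chart_map d \o chart_inv c) x.
  apply: smooth_on_differentiable (atlas_compatible ac ad) _.
  by exists p.
have tx : (chart_map d \o chart_inv c) x = chart_map d p by rewrite /= xp.
have dGd : differentiable (G \o chart_inv d) ((chart_map d \o chart_inv c) x).
  by rewrite tx; exact: smooth_on_differentiable (sG d ad) Ud.
have dGc : differentiable (G \o chart_inv c) x.
  exact: smooth_on_differentiable (sG c ac) Ux.
have near_dom : \forall y \near x, chart_dom d (chart_inv c y).
  apply: (chart_inv_continuous Ux); rewrite xp.
  by apply: open_nbhs_nbhs; split=> //; exact: chart_dom_open.
have near_eq : \forall y \near x,
    (G \o chart_inv c) y = ((G \o chart_inv d) \o (chart_map d \o chart_inv c)) y.
  by apply: filterS near_dom => y dy; rewrite /= chart_mapK.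
apply: mulmx_rowI => v; rewrite mulmxA.
have E1 := deriveEjacobian v dGc.
have E2 := near_eq_derive v near_eq.
have dcomp := differentiable_comp dtau dGd.
have E3 := deriveE v dcomp.
have E4 := congr1 (fun h => h v) (diff_comp dtau dGd).
have E5 : 'd (chart_map d \o chart_inv c) x v = v *m 'J (chart_map d \o chart_inv c) x.
  exact: etrans (esym (deriveE v dtau)) (deriveEjacobian v dtau).
have E6 w : 'd (G \o chart_inv d) (chart_map d p) w = w *m 'J (G \o chart_inv d) (chart_map d p).
  have dG : differentiable (G \o chart_inv d) (chart_map d p) by rewrite -tx.
  exact: etrans (esym (deriveE w dG)) (deriveEjacobian w dG).
have E := etrans (esym E1) (etrans E2 (etrans E3 E4)).
apply: etrans E _.
rewrite -E5 -E6 -[in RHS]tx.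
by [].
Qed.
End Chart.

Section Similar.
Variables (K : fieldType) (n : nat) (A B T : 'M[K]_n).
Hypotheses (Tu : T \in unitmx) (AT : A *m T = T *m B).

Lemma similar_trace : \tr A = \tr B.
Proof. by rewrite -[A](mulmxK Tu) AT mxtrace_mulC mulmxA mulVmx // mul1mx. Qed.

Lemma similar_multiplicity a : \rank (eigenspace A a) = \rank (eigenspace B a).
Proof.
rewrite !mxrank_ker; congr (_ - _)%N.
have E : (A - a%:M) *m T = T *m (B - a%:M) by rewrite mulmxBl mulmxBr AT scalar_mxC.
rewrite -(@mxrankMfree _ _ _ _ (A - a%:M) T) ?row_free_unit // E eqmxMfull //.
by rewrite row_full_unit.
Qed.
End Similar.

Lemma transport_shape (K : fieldType) n (T g h g' h' S S' : 'M[K]_n) :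
  T \in unitmx -> g \in unitmx -> g' = T *m g *m T^T -> h' = T *m h *m T^T ->
  S *m g = h -> S' *m g' = h' -> S' *m T = T *m S.
Proof.
move=> Tu gu -> -> <- E; apply: (can_inj (mulmxK gu)); rewrite -[RHS]mulmxA.
have Ttu : T^T \in unitmx by rewrite unitmx_tr.
apply: (can_inj (mulmxK Ttu)).
by move: E; rewrite !mulmxA.
Qed.

Section ChartShape.
Variables (R : realType) (n : nat) (M : smooth_manifold R n) (f nu : M -> 'rV[R]_n.+2).
Hypotheses (Hf : hyperbolic_immersion f) (Hnu : unit_normal f nu).
Local Notation L := (lorentz_mx R n.+1).
Local Notation shp := (shape_operator f nu).

(** The matrix [T] is the Jacobian of the change of charts. *)
Lemma shape_operator_change c d p : atlas c -> atlas d -> chart_dom c p -> chart_dom d p ->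
  exists2 T, T \in unitmx & shp c p *m T = T *m shp d p.
Proof.
move=> ac ad cp dp; have [sf _ _] := Hf; have [sn _ _ _] := Hnu.
have Hc := chart_hypersurface Hf Hnu ac; have Hd := chart_hypersurface Hf Hnu ad.
have Jf := jacobian_change sf ac ad cp dp; have Jn := jacobian_change sn ac ad cp dp.
set T := jacobian (chart_map d \o chart_inv c) (chart_map c p) in Jf Jn.
have gc := metric_unit Hc (chart_imageP cp); have gd := metric_unit Hd (chart_imageP dp).
have Eg : metric_mx (f \o chart_inv c) L (chart_map c p) =
    T *m metric_mx (f \o chart_inv d) L (chart_map d p) *m T^T.
  by rewrite /metric_mx /tangent_mx Jf trmx_mul !mulmxA.
have Eh : sff_mx (f \o chart_inv c) (nu \o chart_inv c) L (chart_map c p) =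
    T *m sff_mx (f \o chart_inv d) (nu \o chart_inv d) L (chart_map d p) *m T^T.
  by rewrite /sff_mx /tangent_mx /dnormal_mx Jf Jn trmx_mul mulmxN mulNmx !mulmxA.
have Tu : T \in unitmx by move: gc; rewrite Eg !unitmx_mul -andbA => /andP [].
exists T => //.
exact: (transport_shape Tu gd Eg Eh (shape_metric Hd (chart_imageP dp))
  (shape_metric Hc (chart_imageP cp))).
Qed.

Lemma shape_operator_diagonalized c p : atlas c -> chart_dom c p ->
  exists2 P, P \in unitmx & exists d, P *m shp c p = diag_mx d *m P.
Proof.
move=> ac cp; exact: (shape_diagonalized (chart_hypersurface Hf Hnu ac) (chart_imageP cp)).
Qed.

Lemma ricci_operatorE c p : atlas c -> chart_dom c p ->
  ricci_operator f c p = \tr (shp c p) *: shp c p - shp c p *m shp c p - (n%:R - 1)%:M.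
Proof.
move=> ac cp; exact: (ricci_operator_metric (chart_hypersurface Hf Hnu ac) (chart_imageP cp)).
Qed.

(** The Ricci operator is a polynomial in the shape operator, hence diagonal in the
    same basis; [n - 1] is its constant term up to sign. *)
Lemma ricci_multiplicity c p P d b : atlas c -> chart_dom c p -> P \in unitmx ->
  P *m shp c p = diag_mx d *m P ->
  \rank (eigenspace (ricci_operator f c p) (b - (n%:R - 1))) =
  (\sum_i (d 0%R i * (\tr (shp c p) - d 0%R i) == b)%R)%N.
Proof.
move=> ac cp Pu PS; rewrite (ricci_operatorE ac cp).
have PQ := diagonalizedB (diagonalizedB (diagonalizedZ (\tr (shp c p)) PS) (diagonalizedM PS PS))
  (diagonalized_scalar P (n%:R - 1)).
rewrite (diagonalized_multiplicity Pu _ PQ); apply: eq_bigr => i _.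
rewrite !mxE (inj_eq (addIr _)); congr (nat_of_bool (_ == b)).
by rewrite mulrBr mulrC.
Qed.

Lemma shape_operator_continuous c p : atlas c -> chart_dom c p ->
  entrywise_continuous (fun q => shp c q) p.
Proof.
move=> ac cp i j.
have H := entrywise_shape (chart_hypersurface Hf Hnu ac) (chart_imageP cp).
exact: (@continuous_comp _ _ _ (chart_map c)
  (fun y => shape_mx (f \o chart_inv c) (nu \o chart_inv c) L y i j) p (chart_map_continuous cp) (H i j)).
Qed.

Lemma near_chart (c : chart R M n) p : chart_dom c p -> \forall q \near p, chart_dom c q.
Proof. by move=> cp; apply: open_nbhs_nbhs; split=> //; exact: chart_dom_open. Qed.

(** A shape operator of rank at most one does not contribute to the Gauss
    equation. *)
Lemma rank_one_curvature : (forall c p, atlas c -> chart_dom c p -> (\rank (shp c p) <= 1)%N) ->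
  constant_sectional_curvature f (-1).
Proof.
move=> r1 c ac p cp X Y XY; have HC := chart_hypersurface Hf Hnu ac.
have Ux := chart_imageP cp; set x := chart_map c p in Ux *.
apply: etrans (sectional_metric HC X Y Ux) _.
have gs := metric_sym HC x; have hs := sff_sym HC Ux.
have gpos := hyp_spacelike HC Ux.
have := r1 c p ac cp; rewrite -[\rank _]/(\rank (shape_mx (f \o chart_inv c) (nu \o chart_inv c) L x)).
have := shape_metric HC Ux.
move: (shape_mx _ _ _ x) => S Sg rS.
have {rS}rh : (\rank (sff_mx (f \o chart_inv c) (nu \o chart_inv c) L x) <= 1)%N.
  by rewrite -Sg; apply: leq_trans (mxrankM_maxl _ _) rS.
have gpos' (v : 'rV[R]_n) : v != 0 ->
    0 < (v *m metric_mx (f \o chart_inv c) L x *m v^T) 0 0 := gpos v.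
move: (sff_mx _ _ _ x) (metric_mx _ _ x) gs hs rh gpos' {Sg gpos} => h g gs hs rh gpos.
pose B (v w : 'rV[R]_n) := (v *m h *m w^T) 0 0.
rewrite -/(gdot g X X) -/(gdot g Y Y) -/(gdot g X Y); set G := gdot g.
rewrite -/(B X X) -/(B Y Y) -/(B X Y).
have [b [w hE]] := low_rank_factor rh.
have BE v u : B v u = (v *m b) 0 0 * (w *m u^T) 0 0.
  by rewrite /B hE mulmxA -[_ *m w *m _]mulmxA mxE big_ord1.
have BC v u : B v u = B u v by exact: bilinear_sym.
have -> : B X X * B Y Y - B X Y ^+ 2 = 0.
  by rewrite expr2 {2}(BC X Y) !BE; ring.
rewrite sub0r mulNr divff //; apply: contraTneq XY => G0.
apply/negP => fXY.
have free a e : a *: X + e *: Y = 0 -> a = 0 /\ e = 0.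
  move=> E; have : row_mx a%:M e%:M *m col_mx X Y = 0 *m col_mx X Y :> 'rV_n.
    by rewrite mul_row_col !mul_scalar_mx E mul0mx.
  move/(row_free_inj fXY); rewrite -[0]row_mx0 => /eq_row_mx [/matrixP/(_ 0 0) + /matrixP/(_ 0 0)].
  by rewrite !mxE eqxx !mulr1n.
(* A zero Gram determinant would make [X] and [Y] dependent. *)
have Z0 : G X Y *: X + (- G X X) *: Y = 0.
  apply/eqP; apply: contraT => /gpos.
  rewrite -/(gdot g _ _) (gdotDl g) !(gdotDr gs) !(gdotZl g) !(gdotZr gs) (gdotC gs Y X).
  rewrite -/G [X in 0 < X](_ : _ = G X X * (G X X * G Y Y - G X Y ^+ 2)); last by ring.
  by rewrite G0 mulr0 ltxx.
have [_ /eqP] := free _ _ Z0; rewrite oppr_eq0 => /eqP GX.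
have X0 : X = 0 by apply/eqP; apply: contraT => /gpos; rewrite -/(gdot g X X) -/G GX ltxx.
have [] := free 1 0; first by rewrite X0 scaler0 scale0r addr0.
by move/eqP; rewrite oner_eq0.
Qed.
End ChartShape.

(** * Constancy of the principal curvatures *)

Lemma locally_constant_connected (T : topologicalType) (V : Type) (h : T -> V) :
  connected [set: T] -> (forall p, \forall q \near p, h q = h p) ->
  forall p q, h q = h p.
Proof.
move=> cT hh p q; have oB (v : V) : open [set q | h q = v].
  by rewrite openE => r /= <-; exact: hh.
suff B : [set q | h q = h p] = [set: T].
  by have : [set: T] q by []; rewrite -B.
apply: cT; first by exists p.
  by exists [set q | h q = h p]; rewrite ?setTI.
exists [set q | h q = h p]; rewrite ?setTI // -openC openE => r /= rp.
by apply: filterS (hh r) => s /= ->.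
Qed.

Section Spectrum.
Variables (K : fieldType) (n : nat).

Lemma diagonalized_inj (P A B : 'M[K]_n) (d : 'rV[K]_n) : P \in unitmx ->
  P *m A = diag_mx d *m P -> P *m B = diag_mx d *m P -> A = B.
Proof. by move=> Pu PA PB; rewrite (diagonalized_eq Pu PA) (diagonalized_eq Pu PB). Qed.

Lemma multiplicity_le (A B : 'M[K]_n) a :
  (\rank (B - a%:M)%R <= \rank (A - a%:M)%R)%N ->
  (\rank (eigenspace A a) <= \rank (eigenspace B a))%N.
Proof. by move=> AB; rewrite !mxrank_ker leq_sub2l. Qed.

Lemma sum_perm_count (d : 'rV[K]_n) (s : 'S_n) (Q : pred K) :
  (\sum_i Q (d 0%R i) = \sum_i Q (d 0%R (s i)))%N.
Proof. by rewrite (reindex_inj (@perm_inj _ s)). Qed.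
End Spectrum.

Lemma never_lt_constant (T : Type) (R : realType) (h : T -> R) :
  (forall p q, h p < h q -> False) -> forall p q, h q = h p.
Proof. by move=> hF p q; case: (ltgtP (h q) (h p)) => // /hF. Qed.

Lemma pair_le_eq (b : bool) (m m' k k' : nat) : (m <= m')%N -> (k <= k')%N ->
  (if b then m else m + k)%N = (if b then m' else m' + k')%N -> m = m'.
Proof. by case: b => //; lia. Qed.

Section Global.
Variables (R : realType) (n : nat) (M : smooth_manifold R n) (f nu : M -> 'rV[R]_n.+2).
Hypotheses (Hf : hyperbolic_immersion f) (Hnu : unit_normal f nu).
Local Notation L := (lorentz_mx R n.+1).
Local Notation shp := (shape_operator f nu).
Hypothesis Hric : constant_ricci_eigenvalues f.
Hypothesis conM : connected [set: M].

(** The diagonal entries are reordered by [s] because [mu] lists the products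
    [lam (tr S - lam)] in an order that is the same at all points. *)
Definition has_spectrum (S : 'M[R]_n) (mu lam : 'I_n -> R) :=
  exists P (d : 'rV[R]_n) (s : 'S_n), [/\ P \in unitmx, P *m S = diag_mx d *m P,
    (forall i, d 0 (s i) = lam i) & ricci_spectrum mu lam (\tr S)].

(** For [mu] take the products [lam (tr S - lam)] at one point; at the other points
    the Ricci eigenvalues, hence the products, are a rearrangement of them. *)
Lemma constant_ricci_spectrum (c0 : chart R M n) p0 : atlas c0 -> chart_dom c0 p0 ->
  exists mu, forall c p, atlas c -> chart_dom c p -> exists lam, has_spectrum (shp c p) mu lam.
Proof.
move=> ac0 cp0; have [P0 P0u [d0 PS0]] := shape_operator_diagonalized Hf Hnu ac0 cp0.
exists (fun i => d0 0 i * (\tr (shp c0 p0) - d0 0 i)) => c p ac cp.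
have [P Pu [d PS]] := shape_operator_diagonalized Hf Hnu ac cp.
have [|s sE] := @reorder_family _ n (fun i => d 0 i * (\tr (shp c p) - d 0 i))
   (fun i => d0 0 i * (\tr (shp c0 p0) - d0 0 i)).
  move=> b; rewrite -(ricci_multiplicity Hf Hnu b ac cp Pu PS).
  by rewrite -(ricci_multiplicity Hf Hnu b ac0 cp0 P0u PS0); exact: Hric.
exists (fun i => d 0 (s i)), P, d, s; split=> //; split; last exact: sE.
by rewrite (diagonalized_trace Pu PS) [RHS](reindex_inj (@perm_inj _ s)).
Qed.

Lemma spectrum_multiplicity S mu lam a : has_spectrum S mu lam ->
  \rank (eigenspace S a) = (\sum_i (lam i == a))%N.
Proof.
move=> [P [d [s [Pu PS sE _]]]]; rewrite (diagonalized_multiplicity Pu a PS).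
rewrite (sum_perm_count d s (fun x => x == a)).
by apply: eq_bigr => i _; rewrite sE.
Qed.

Lemma spectrum_rank S mu lam : has_spectrum S mu lam ->
  \rank S = (\sum_i (lam i != 0%R))%N.
Proof.
move=> [P [d [s [Pu PS sE _]]]]; rewrite (diagonalized_rank Pu PS).
rewrite (sum_perm_count d s (fun x => x != 0)).
by apply: eq_bigr => i _; rewrite sE.
Qed.

Lemma spectrum_gauss_trace S mu lam : has_spectrum S mu lam ->
  \tr (\tr S *: S - S *m S) = \sum_i mu i.
Proof.
move=> [P [d [s [Pu PS sE [_ lm]]]]].
have PQ := diagonalizedB (diagonalizedZ (\tr S) PS) (diagonalizedM PS PS).
rewrite (diagonalized_trace Pu PQ) (reindex_inj (@perm_inj _ s)) /=.
by apply: eq_bigr => i _; rewrite !mxE sE -lm; ring.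
Qed.

Lemma spectrum_cubic S mu lam kappa : has_spectrum S mu lam ->
  (forall i, mu i * lam i = kappa * lam i) ->
  (\tr S *: S - S *m S) *m S = kappa *: S.
Proof.
move=> [P [d [s [Pu PS sE [_ lm]]]]] H.
have PQ := diagonalizedB (diagonalizedZ (\tr S) PS) (diagonalizedM PS PS).
have PQS := diagonalizedM PQ PS.
apply: (diagonalized_inj Pu PQS); rewrite (diagonalizedZ kappa PS).
congr (diag_mx _ *m P); apply/rowP => j; rewrite -[j](permKV s) !mxE sE.
by rewrite -H -lm; ring.
Qed.

(** The equation [x (h - x) = a (h - a)] has the solutions [a] and [h - a] only. *)
Lemma spectrum_pair_multiplicity S mu lam (a : R) : has_spectrum S mu lam ->
  (if (a == \tr S - a)%R then \rank (eigenspace S a)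
   else \rank (eigenspace S a) + \rank (eigenspace S (\tr S - a)%R))%N =
  (\sum_i (mu i == a * (\tr S - a))%R)%N.
Proof.
move=> Hs; rewrite !(spectrum_multiplicity _ Hs).
have [_ [_ [_ [_ _ _ [_ lm]]]]] := Hs; set h := \tr S in lm *.
have mE i : (mu i == a * (h - a)) = (lam i == a) || (lam i == h - a).
  rewrite -lm -subr_eq0 -[lam i == a]subr_eq0 -[lam i == h - a]subr_eq0.
  rewrite (_ : _ - _ = - ((lam i - a) * (lam i - (h - a)))); last by ring.
  by rewrite oppr_eq0 mulf_eq0.
case: ifPn => [/eqP E|ne].
  by apply: eq_bigr => i _; rewrite mE -E orbb.
rewrite -big_split /=; apply: eq_bigr => i _; rewrite mE.
by case: eqP => [->|_] //=; rewrite (negPf ne).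
Qed.

Variable pc : M -> chart R M n.
Hypothesis pcP : forall p, atlas (pc p) /\ chart_dom (pc p) p.

Definition mean_curvature p := \tr (shp (pc p) p).
Definition multiplicity a p := \rank (eigenspace (shp (pc p) p) a).

Lemma mean_curvatureE c p : atlas c -> chart_dom c p -> \tr (shp c p) = mean_curvature p.
Proof.
move=> ac cp; have [ap pp] := pcP p.
have [T Tu ST] := shape_operator_change Hf Hnu ac ap cp pp.
exact: similar_trace Tu ST.
Qed.

Lemma multiplicityE a c p : atlas c -> chart_dom c p ->
  \rank (eigenspace (shp c p) a) = multiplicity a p.
Proof.
move=> ac cp; have [ap pp] := pcP p.
have [T Tu ST] := shape_operator_change Hf Hnu ac ap cp pp.
exact: similar_multiplicity Tu ST a.
Qed.

Lemma mean_curvature_continuous : continuous mean_curvature.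
Proof.
move=> p; have [ap pp] := pcP p.
have ct := entrywise_trace (shape_operator_continuous Hf Hnu ap pp).
apply: (continuous_near_eq _ ct); apply: filterS (near_chart pp) => q pq.
exact: mean_curvatureE.
Qed.

(** The rank of [S - a] is lower semicontinuous. *)
Lemma multiplicity_semicontinuous a p :
  \forall q \near p, (multiplicity a q <= multiplicity a p)%N.
Proof.
have [ap pp] := pcP p.
have cS := shape_operator_continuous Hf Hnu ap pp.
have cA : entrywise_continuous (fun q => shp (pc p) q + (- a%:M)) p.
  by apply: entrywiseD => //; exact: entrywise_cst.
have r := rank_semicontinuous cA.
apply: filterS2 (near_chart pp) r => q pq rq.
exact: leq_trans (eq_leq (esym (multiplicityE a ap pq))) (multiplicity_le rq).
Qed.

(** By [spectrum_pair_multiplicity] the multiplicities of [a] and [h - a] have a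
    constant sum. As neither can increase near a point, neither can decrease. *)
Lemma isoparametric_of_constant_mean_curvature mu :
  (forall c p, atlas c -> chart_dom c p -> exists lam, has_spectrum (shp c p) mu lam) ->
  (forall p q, mean_curvature q = mean_curvature p) -> isoparametric f nu.
Proof.
move=> Hmu Hc c d p q ac ad cp dq a.
suff lc : forall r, \forall s \near r, multiplicity a s = multiplicity a r.
  have A := multiplicityE a ac cp; have B := multiplicityE a ad dq.
  have C := locally_constant_connected conM lc q p.
  have ABC := etrans A (etrans C (esym B)).
  exact: ABC.
move=> {p q cp dq} p.
have pair q : (if (a == mean_curvature p - a)%R then multiplicity a q
   else multiplicity a q + multiplicity (mean_curvature p - a)%R q)%N =
   (\sum_i (mu i == a * (mean_curvature p - a))%R)%N.
  have [aq qq] := pcP q; have [lam Hs] := Hmu _ _ aq qq.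
  apply: etrans _ (etrans (spectrum_pair_multiplicity a Hs) _); rewrite -(Hc p q) //.
have Ep := pair p.
apply: filterS2 (multiplicity_semicontinuous a p)
  (multiplicity_semicontinuous (mean_curvature p - a) p) => q le1 le2.
have Eq := etrans (pair q) (esym Ep).
exact: pair_le_eq le1 le2 Eq.
Qed.

Hypothesis n_gt4 : (4 < n)%N.

(** By connectedness the mean curvature would take all values of an interval. Then
    [exceptional_spectrum] applies, and yields an open set on which the shape
    operator has rank at most two and satisfies the assumptions of
    [no_rank_two_hypersurface]. *)
Lemma mean_curvature_not_lt mu i0 :
  (forall c p, atlas c -> chart_dom c p -> exists lam, has_spectrum (shp c p) mu lam) ->
  mu i0 != 0 -> forall p q, mean_curvature p < mean_curvature q -> False.
Proof.
move=> Hmu mi0 p q pq; set l := mean_curvature p in pq; set u := mean_curvature q in pq.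
have attained : {in `]l, u[, forall h, exists r, mean_curvature r = h}.
  move=> h; rewrite in_itv /= => /andP [lh hu].
  have ci : connected (mean_curvature @` [set: M]).
    apply: connected_continuous_connected conM _.
    by apply: continuous_subspaceT; exact: mean_curvature_continuous.
  move/connected_intervalP : ci => ci.
  have [r _ rh] : (mean_curvature @` [set: M]) h.
    by apply: (ci l u); [exists p|exists q|rewrite (ltW lh) (ltW hu)].
  by exists r.
clearbody l u.
have spec : {in `]l, u[, forall h, exists lam, ricci_spectrum mu lam h}.
  move=> h hI; have [r rh] := attained h hI; have [ar rr] := pcP r.
  have [lam [P [d [s [_ _ _ rs]]]]] := Hmu _ _ ar rr.
  by exists lam; rewrite -rh.
have n2 : (2 < n)%N by lia.
have [i [j [kappa [l' [u' [[ij mi mj mk] k0 [ll' lu'] uu' off]]]]]] :=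
  exceptional_spectrum n2 pq spec (ex_intro _ i0 mi0).
have [|r rh] := attained ((l' + u') / 2).
  by rewrite in_itv /=; apply/andP; split; lra.
have [ar rr] := pcP r; set c := pc r in ar rr.
have HS := chart_hypersurface Hf Hnu ar.
pose F := f \o chart_inv c; pose N := nu \o chart_inv c.
pose W := [set y | chart_image c y /\ \tr (shape_mx F N L y) \in `]l', u'[%R].
have oW : open W.
  rewrite openE => y [Uy tI]; rewrite /interior.
  have ct := entrywise_trace (entrywise_shape HS Uy).
  have near_t : \forall z \near y, \tr (shape_mx F N L z) \in `]l', u'[%R.
    exact: (ct _ (near_in_itvoo tI)).
  by apply: filterS2 (near_open (hyp_open HS) Uy) near_t => z; split.
have HW : hypersurface W F N L by apply: hypersurface_sub HS => // y [].
have data y : W y -> exists lam, has_spectrum (shape_mx F N L y) mu lam /\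
    forall k, k != i -> k != j -> lam k = 0.
  move=> [[s cs <-] tI]; have [lam Hs] := Hmu c s ar cs.
  exists lam; split; first exact: Hs.
  have [P [d [sg [_ _ _ rs]]]] := Hs.
  exact: off tI _ rs.
have Wr : W (chart_map c r).
  split; first exact: chart_imageP.
  have -> : \tr (shape_mx F N L (chart_map c r)) = (l' + u') / 2.
    by rewrite -rh -(mean_curvatureE ar rr).
  by rewrite in_itv /=; apply/andP; split; lra.
have ji : j != i by rewrite eq_sym.
apply: (@no_rank_two_hypersurface _ _ W F N L HW kappa k0 _ _ _ n_gt4 _ Wr).
- move=> y /data [lam [Hs lk]]; apply: (spectrum_cubic Hs) => k.
  have [->|ki] := eqVneq k i; first by rewrite mi.
  have [->|kj] := eqVneq k j; first by rewrite mj.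
  by rewrite lk // !mulr0.
- move=> y /data [lam [Hs lk]]; rewrite (spectrum_gauss_trace Hs).
  rewrite (bigD1 i) //= (bigD1 j) //= big1 ?addr0; last by move=> k /andP [ki kj]; rewrite mk.
  by rewrite mi mj; ring.
- move=> y /data [lam [Hs lk]]; rewrite (spectrum_rank Hs).
  rewrite (bigD1 i) //= (bigD1 j) //= big1 ?addn0.
    by case: (lam i != 0); case: (lam j != 0).
  by move=> k /andP [ki kj]; rewrite lk // eqxx.
Qed.
End Global.

Theorem corollary1p11 (R : realType) (n : nat) (M : smooth_manifold R n)
    (f nu : M -> 'rV[R]_n.+2) :
  (5 <= n)%N ->
  connected [set: M] ->
  hyperbolic_immersion f ->
  unit_normal f nu ->
  constant_ricci_eigenvalues f ->
  ~ constant_sectional_curvature f (-1) ->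
  isoparametric f nu.
Proof.
move=> n5 conM Hf Hnu Hric curv c0 d0 p0 q0 ac0 ad0 cp0 dq0 a.
have chart_at (p : M) : exists c : chart R M n, atlas c /\ chart_dom c p.
  by have [c ac cp] := atlas_cover p; exists c.
have [pc pcP] := choice chart_at.
have [mu Hmu] := constant_ricci_spectrum Hf Hnu Hric ac0 cp0.
suff Hc : forall p q, mean_curvature f nu pc q = mean_curvature f nu pc p.
  exact: (isoparametric_of_constant_mean_curvature Hf Hnu conM pcP Hmu Hc).
(* If all [mu i] vanish, the principal curvatures are 0 or [h]; as their sum is
   [h], at most one of them is nonzero. *)
have [i0 mi0] : exists i, mu i != 0.
  apply: contrapT => mu0; apply: curv; apply: (rank_one_curvature Hf Hnu) => c p ac cp.
  have [lam Hs] := Hmu c p ac cp; rewrite (spectrum_rank Hs).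
  have [_ [_ [_ [_ _ _ [slam lm]]]]] := Hs; set h := \tr _ in slam lm.
  have lamE i : lam i = h * (lam i != 0)%:R.
    have : mu i = 0 by apply: contrapT => /eqP mi; apply: mu0; exists i.
    rewrite -lm => /eqP; rewrite mulf_eq0 subr_eq0.
    by case: eqP => [->|_] /=; rewrite ?mulr0 // mulr1 => /eqP.
  have E : h * (\sum_i (lam i != 0%R))%N%:R = h.
    by rewrite natr_sum mulr_sumr -[RHS]slam; apply: eq_bigr => i _; rewrite -lamE.
  have [h0|h0] := eqVneq h 0.
    by rewrite big1 // => i _; rewrite lamE h0 mul0r eqxx.
  have /eqP : h * ((\sum_i (lam i != 0%R))%N%:R - 1) = 0 by rewrite mulrBr E mulr1 subrr.
  by rewrite mulf_eq0 (negPf h0) subr_eq0 (eqr_nat _ _ 1) => /eqP ->.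
have lt_false := mean_curvature_not_lt Hf Hnu conM pcP n5 Hmu mi0.
exact: never_lt_constant lt_false.
Qed.
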